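(* Let $0<\alpha<1$ and $1\le q<2$. Suppose $p\ge n$, $k_1\le k_2\lesssim\frac n{\log p}$ and $\widehat\beta^L$ is the Lasso estimator defined in the context with $A>4\sqrt2$. Let $$\mathrm{CI}^2_\alpha(Z,k_2,q)=\left[\Big(\frac{\psi(Z)}{\frac1{n_2}\chi^2_{1-\alpha/2}(n_2)}-\sigma_0^2\Big)_+,\ (16k_2)^{\frac2q-1}\Big(\frac{\psi(Z)}{\frac1{n_2}\chi^2_{\alpha/2}(n_2)}-\sigma_0^2\Big)_+\right],$$ $$\psi(Z)=\min\Big\{\frac1{n_2}\big\|y^{(2)}-X^{(2)}\widehat\beta^L\big\|_2^2,\ \sigma_0^2\log p\Big\}.$$ Then $$\liminf_{n,p\to\infty}\ \inf_{\theta\in\Theta_0(k_2)}\mathbb P_\theta\big(\|\widehat\beta^L-\beta\|_q^2\in\mathrm{CI}^2_\alpha(Z,k_2,q)\big)\ge1-\alpha$$ and $$\sup_{\theta\in\Theta_0(k_1)}\mathbf E_\theta\,\mathbf L\big(\mathrm{CI}^2_\alpha(Z,k_2,q)\big)\lesssim k_2^{\frac2q-1}\Big(k_1\frac{\log p}{n}+\frac1{\sqrt n}\Big)\sigma_0^2 .$$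
   Context: Model: one observes $Z=(X,y)$ with $y=X\beta+\epsilon$, $X\in\mathbb R^{n\times p}$ with i.i.d. rows $X_{i\cdot}\sim N_p(0,\Sigma)$, $\epsilon\sim N_n(0,\sigma^2\mathrm I)$ independent of $X$. The parameter is $\theta=(\beta,\Sigma,\sigma)$; $\mathbb P_\theta,\mathbf E_\theta$ are probability and expectation under $\theta$, and $\beta$ in the coverage statement is the first component of $\theta$. $\Theta_0(k)=\{(\beta,\mathrm I,\sigma_0):\|\beta\|_0\le k\}$, where $\sigma_0>0$ is the known noise level and $\|\beta\|_0$ is the number of nonzero coordinates. $a_+=\max\{a,0\}$; $\chi^2_\tau(m)$ is the $\tau$-quantile of the $\chi^2$ distribution with $m$ degrees of freedom; $\mathbf L$ of an interval is its length. For positive sequences, $a_n\lesssim b_n$ means $a_n\le Cb_n$ for all $n$, with $C$ a generic positive constant, and $a_n\asymp b_n$ means $a_n\lesssim b_n$ and $b_n\lesssim a_n$. Lasso: $Z$ is randomly split into subsamples $Z^{(1)}=(y^{(1)},X^{(1)})$ and $Z^{(2)}=(y^{(2)},X^{(2)})$ of sizes $n_1$ and $n_2$ with $n_1\asymp n_2$, and $$\widehat\beta^L=\arg\min_{\beta\in\mathbb R^p}\frac{\|y^{(1)}-X^{(1)}\beta\|_2^2}{n_1}+\lambda\sum_{j=1}^p\frac{\|X^{(1)}_{\cdot j}\|_2}{\sqrt{n_1}}|\beta_j|,\qquad \lambda=A\sqrt{\tfrac{\log p}{n_1}}\,\sigma_0,$$ where $X^{(1)}_{\cdot j}$ is the $j$-th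 column of $X^{(1)}$ and $A$ is a pre-specified constant.
   Formalization: The condition k_2 ≲ n/log p is read as k_2 ≤ c n/log p with a sufficiently small constant c>0 depending only on α, q, A and the ratio bound in n_1≍n_2; with an arbitrarily large constant the coverage claim fails (e.g. p=n², k_2=Cn/log p, C large). *)

(* Defs.v *)
From HB Require Import structures.
From mathcomp Require Import all_boot all_order all_algebra.
From mathcomp Require Import perm.
From mathcomp Require Import all_classical all_reals all_analysis.

Set Implicit Arguments.
Unset Strict Implicit.
Unset Printing Implicit Defensive.
Import Order.TTheory GRing.Theory Num.Theory.
Import numFieldNormedType.Exports.
Local Open Scope classical_set_scope.
Local Open Scope ring_scope.

Definition measure_matrix_display : measure_display.
Proof. exact: default_measure_display. Qed.

Section measurable_matrix.
Context {R : realType}.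
Variables m n : nat.

Definition entry_cylinders : set (set 'M[R]_(m, n)) :=
  [set [set M : 'M[R]_(m, n) | ijB.2 (M ijB.1.1 ijB.1.2)] |
     ijB in [set ijB : 'I_m * 'I_n * set R | measurable ijB.2]].

Let matrix_set0 : <<s entry_cylinders >> set0.
Proof. exact: sigma_algebra0. Qed.

Let matrix_setC A : <<s entry_cylinders >> A -> <<s entry_cylinders >> (~` A).
Proof. exact: sigma_algebraC. Qed.

Let matrix_bigcup (F : (set 'M[R]_(m, n))^nat) :
  (forall i, <<s entry_cylinders >> (F i)) ->
  <<s entry_cylinders >> (\bigcup_i F i).
Proof. exact: sigma_algebra_bigcup. Qed.

HB.instance Definition _ := @isMeasurable.Build measure_matrix_display
  'M[R]_(m, n) <<s entry_cylinders >> matrix_set0 matrix_setC matrix_bigcup.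

End measurable_matrix.

Section norms.
Context {R : realType} {n : nat}.
Implicit Types v : 'cV[R]_n.

Definition l0norm v : nat := #|[pred i | v i 0 != 0]|.
Definition l2norm v : R := Num.sqrt (\sum_i v i 0 ^+ 2).
Definition lqnorm (q : R) v : R := (\sum_i `|v i 0| `^ q) `^ q^-1.

End norms.

Section chi2.
Context {R : realType}.

Local Notation RB := (measurableTypeR R).

Definition sqr_add (z : RB * RB) : RB := (z.1 : R) ^+ 2 + (z.2 : R).

Lemma measurable_sqr_add : measurable_fun [set: RB * RB] sqr_add.
Proof.
apply: measurable_realfun.measurable_funD => //.
by apply: measurable_realfun.measurable_funX; exact: measurable_fst.
Qed.

HB.instance Definition _ :=
  isMeasurableFun.Build _ _ _ _ sqr_add measurable_sqr_add.

(* Law of the sum of the squares of m independent N(0,1) variables. *)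
Fixpoint chi2_prob (m : nat) : probability RB R :=
  if m is m'.+1 then
    distribution (normal_prob 0 1 \x chi2_prob m')%E sqr_add
  else dirac (0 : RB).

Definition chi2_quantile (tau : R) (m : nat) : R :=
  inf [set x | (tau%:E <= chi2_prob m [set` `]-oo, x]])%E].

End chi2.

Section model.
Context {R : realType} {d : measure_display} {T : measurableType d}.
Implicit Type P : probability T R.

Definition std_normal_vector P (n : nat) (V : T -> 'cV[R]_n) :=
  measurable_fun setT V /\
  forall B : 'I_n -> set R, (forall i, measurable (B i)) ->
    P [set w | forall i, B i (V w i 0)] =
    (\prod_(i < n) normal_prob 0 1 (B i))%E.

(* V ~ N_n(0, Sigma) for nonsingular Sigma: V = L g, where L is the Cholesky
   factor of Sigma and g has independent N(0,1) coordinates.  Singular Sigma are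
   excluded by 0 < L i i. *)
Definition normal_vector P (n : nat) (Sigma : 'M[R]_n) (V : T -> 'cV[R]_n) :=
  exists L : 'M[R]_n,
    [/\ is_trig_mx L, forall i, 0 < L i i, L *m L^T = Sigma &
        std_normal_vector P (fun w => invmx L *m V w)].

Definition independent_rows P (n p : nat) (X : T -> 'M[R]_(n, p)) :=
  forall B : 'I_n -> set 'rV[R]_p, (forall i, measurable (B i)) ->
    P [set w | forall i, B i (row i (X w))] =
    (\prod_(i < n) P [set w | B i (row i (X w))])%E.

Definition independent_matrices P (m n p q : nat)
    (U : T -> 'M[R]_(m, n)) (V : T -> 'M[R]_(p, q)) :=
  forall B C, measurable B -> measurable C ->
    P [set w | B (U w) /\ C (V w)] =
    (P [set w | B (U w)] * P [set w | C (V w)])%E.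

End model.

Record param (R : realType) (p : nat) := Param {
  coef : 'cV[R]_p;
  design_cov : 'M[R]_p;
  noise_sd : R }.

Definition Theta0 (R : realType) (p : nat) (sigma0 : R) (k : nat) :
    set (param R p) :=
  [set theta | [/\ (l0norm (coef theta) <= k)%N, design_cov theta = 1%:M &
                   noise_sd theta = sigma0]].

(* Law of the data Z = (X, y) under theta; the noise is y - X beta. *)
Record linear_model (R : realType) d (T : measurableType d)
    (P : probability T R) (n p : nat) (theta : param R p)
    (X : T -> 'M[R]_(n, p)) (y : T -> 'cV[R]_n) : Prop := {
  design_rows_indep : independent_rows P X;
  design_rows_normal : forall i,
    normal_vector P (design_cov theta) (fun w => (row i (X w))^T);
  noise_normal : normal_vector P (noise_sd theta ^+ 2)%:M
    (fun w => y w - X w *m coef theta);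
  design_noise_indep :
    independent_matrices P X (fun w => y w - X w *m coef theta) }.

(* pi is a uniformly random permutation of the observations, independent of the
   data.  The first n1 rows of the permuted data form the first subsample. *)
Definition random_split (R : realType) d (T : measurableType d)
    (P : probability T R) (n p : nat)
    (X : T -> 'M[R]_(n, p)) (y : T -> 'cV[R]_n) (pi : T -> 'S_n) : Prop :=
  (forall s, measurable [set w | pi w = s]) /\
  forall s (B : set ('M[R]_(n, p) * 'cV[R]_n)), measurable B ->
    P [set w | pi w = s /\ B (X w, y w)] =
    (((n`!)%:R^-1)%:E * P [set w | B (X w, y w)])%E.

Definition subsample1 (R : realType) (n1 n2 p : nat) (s : 'S_(n1 + n2))
    (X : 'M[R]_(n1 + n2, p)) (y : 'cV[R]_(n1 + n2)) :
    'M[R]_(n1, p) * 'cV[R]_n1 :=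
  (usubmx (row_perm s X), usubmx (row_perm s y)).

Definition subsample2 (R : realType) (n1 n2 p : nat) (s : 'S_(n1 + n2))
    (X : 'M[R]_(n1 + n2, p)) (y : 'cV[R]_(n1 + n2)) :
    'M[R]_(n2, p) * 'cV[R]_n2 :=
  (dsubmx (row_perm s X), dsubmx (row_perm s y)).

Section lasso.
Context {R : realType}.
Variables (sigma0 : R) (n p : nat).
Implicit Type Z : 'M[R]_(n, p) * 'cV[R]_n.

Definition lasso_penalty (A : R) : R :=
  A * Num.sqrt (ln p%:R / n%:R) * sigma0.

Definition lasso_objective (A : R) Z (b : 'cV[R]_p) : R :=
  l2norm (Z.2 - Z.1 *m b) ^+ 2 / n%:R +
  lasso_penalty A *
    \sum_j l2norm (col j Z.1) / Num.sqrt n%:R * `|b j 0|.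

(* The minimizer need not be unique for every Z; bhat is any selection. *)
Definition is_lasso (A : R) (bhat : 'M[R]_(n, p) * 'cV[R]_n -> 'cV[R]_p) :=
  forall Z b, lasso_objective A Z (bhat Z) <= lasso_objective A Z b.

Definition psi Z (bhat : 'cV[R]_p) : R :=
  Num.min (l2norm (Z.2 - Z.1 *m bhat) ^+ 2 / n%:R) (sigma0 ^+ 2 * ln p%:R).

Definition CI2 (alpha q : R) (k2 : nat) Z (bhat : 'cV[R]_p) : interval R :=
  `[ Num.max (psi Z bhat / (n%:R^-1 * chi2_quantile (1 - alpha / 2) n)
              - sigma0 ^+ 2) 0,
     (16 * k2%:R) `^ (2 / q - 1) *
     Num.max (psi Z bhat / (n%:R^-1 * chi2_quantile (alpha / 2) n)
              - sigma0 ^+ 2) 0 ].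

End lasso.

(* Main.v *)
(* Given the first subsample, the residuals of the second one are independent
   centered normal variables with variance sigma0^2 + |v|^2, where v is the error
   of the Lasso.  Hence Q = |y2 - X2 betaL|^2 / (sigma0^2 + |v|^2) is exactly
   chi-square with n2 degrees of freedom, whatever betaL is, and the quantiles of
   this law give a two-sided interval for |v|_2^2.  When betaL - beta lies in the
   cone |v|_1^2 <= 16 k2 |v|_2^2, Hoelder's inequality bounds |v|_q^2 between
   |v|_2^2 and (16 k2)^(2/q - 1) |v|_2^2, which gives the coverage; the truncation
   of psi is inactive since |v|_2^2 = O(k2 log p / n) sigma0^2 is bounded.  The
   expected length is governed by E|Q/n2 - 1| = O(n2^(-1/2)), by the rate
   |v|_2^2 = O(k1 log p / n), and, on the exceptional event, by the truncation at
   sigma0^2 log p.  The restricted eigenvalue condition on the cone is obtained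
   from Maurey's empirical method: v is approximated by a multiple of an integer
   combination of m = O(k) signed unit vectors, and there are only (2p)^m of these
   to control. *)
Require Import Defs.
From HB Require Import structures.
From mathcomp Require Import all_boot all_order all_algebra.
From mathcomp Require Import perm ring lra.
From mathcomp Require Import all_classical all_reals all_analysis.
From mathcomp Require Import measurable_realfun.

Set Implicit Arguments.
Unset Strict Implicit.
Unset Printing Implicit Defensive.
Import Order.TTheory GRing.Theory Num.Theory.
Import numFieldNormedType.Exports.
Local Open Scope classical_set_scope.
Local Open Scope ring_scope.

(** * Normal and chi-square laws *)

(** Every probability bound holds at one sample size and one parameter; limits enter only in the
    last theorem. The condition A > 4 sqrt 2 serves two different noise levels tau, where 2 tau / A
    is the share of the penalty spent on the noise. Coverage needs the cone constant 3, because of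
    the factor 16 k2 in the interval, hence sqrt 2 < tau < A / 4; there a failure probability that
    merely tends to 0 is enough. The length carries a factor ln p on the exceptional event and wants
    probability p^-2; there tau = 2 sqrt 2 < A / 2, and the cone constant may be large since it only
    affects constants. Sparsity 0 is treated apart: k ln p <= c n then says nothing about ln p / n,
    so column norms are not controlled, and the upper endpoint of the interval is 0, so coverage
    asks for exact recovery. This holds once the noise is dominated and no column vanishes.
    Conditioning on the first subsample is Tonelli over disjoint blocks of one array of independent
    normals, made of the design and the standardised noise, for each fixed permutation; averaging
    over permutations then loses nothing. *)

Section normal_law.
Context {R : realType}.
Local Notation RB := (measurableTypeR R).
Local Notation mu := (@lebesgue_measure R).
Local Open Scope ereal_scope.

(** The Radon-Nikodym derivative of [normal_prob m s] and the explicit density have equal integrals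
    over every measurable set, so they agree almost everywhere and can be exchanged in the change of
    variables formula. *)
Lemma ge0_integral_normal (m s : R) (f : RB -> \bar R) :
  measurable_fun setT f -> (forall x, 0 <= f x) ->
  \int[normal_prob m s]_x f x = \int[mu]_x (f x * (normal_pdf m s x)%:E).
Proof.
move=> mf f0.
have dom := normal_prob_dominates m s.
rewrite -(Radon_Nikodym_SigmaFinite.change_of_variables dom f0)//.
have ipdf := integrable_normal_pdf m s.
apply: ae_eq_integral => //.
- apply: emeasurable_funM => //.
  exact: measurable_int (Radon_Nikodym_SigmaFinite.f_integrable dom).
- by apply: emeasurable_funM => //; exact: measurable_int ipdf.
- apply: ae_eqe_mul2l; apply: integral_ae_eq => //.
  + exact: (Radon_Nikodym_SigmaFinite.f_integrable dom).
  + exact: measurable_int ipdf.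
  + by move=> A _ mA; rewrite -Radon_Nikodym_SigmaFinite.f_integral.
Qed.

(** Lebesgue measure is determined by its values on half-open intervals, so it suffices that the
    rescaled image measure gives them their length. *)
Lemma lebesgue_measure_affine (m b : R) (A : set R) : b != 0%R ->
  measurable A ->
  mu A = `|b|%R%:E * mu [set y | A (m + b * y)%R].
Proof.
move=> b0 mA.
pose g (y : RB) : RB := (m + b * y)%R.
have mf : measurable_fun setT g.
  by apply: measurable_funD => //; exact: measurable_funM.
pose F : {mfun RB >-> RB} := HB.pack g (isMeasurableFun.Build _ _ _ _ g mf).
pose k : {nonneg R} := NngNum (normr_ge0 b).
rewrite (@lebesgue_measure_unique _ (mscale k (pushforward mu F)))//.
move=> _ [[x y]] /= xy <-; rewrite /mscale/= /pushforward.
have [b_gt0|b_le0] := ltP 0%R b.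
  have -> : F @^-1` `]x, y] = [set` `](x - m)%R / b, (y - m)%R / b]%R].
    apply/seteqP; split => z /=; rewrite !in_itv/= ltr_pdivrMr// ler_pdivlMr//;
    by rewrite ltrBlDl lerBrDl (mulrC z).
  rewrite !lebesgue_measure_itv/= !lte_fin ltr_pM2r ?invr_gt0// ltrD2r.
  case: ifPn => _; last by rewrite mule0.
  by rewrite -EFinD -EFinM gtr0_norm//; congr (_%:E); field.
(* A negative slope exchanges the two ends: the preimage becomes closed on the left and open on the
   right, with the same measure. *)
have b_lt0 : (b < 0)%R by rewrite lt_neqAle b0.
have -> : F @^-1` `]x, y] = [set` `[(y - m)%R / b, (x - m)%R / b[%R].
  apply/seteqP; split => z /=; rewrite !in_itv/= ltr_ndivlMr// ler_ndivrMr//;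
  by rewrite ltrBlDl lerBrDl (mulrC z) andbC.
rewrite !lebesgue_measure_itv/= !lte_fin ltr_nM2r ?invr_lt0// ltrD2r.
case: ifPn => _; last by rewrite mule0.
by rewrite -EFinD -EFinM ltr0_norm//; congr (_%:E); field.
Qed.

Lemma normal_prob_affine (m b : R) (A : set R) : b != 0%R -> measurable A ->
  normal_prob 0 1 [set y | A (m + b * y)%R] = normal_prob m b A.
Proof.
move=> b0 mA.
have mg : measurable_fun setT (fun y : RB => (m + b * y : RB)%R).
  by apply: measurable_funD => //; exact: measurable_funM.
pose g (y : RB) : RB := (m + b * y)%R.
pose F : {mfun RB >-> RB} := HB.pack g (isMeasurableFun.Build _ _ _ _ g mg).
pose k : {nonneg R} := NngNum (normr_ge0 b).
have mf : measurable_fun setT (fun x => (normal_pdf m b x)%:E).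
  by apply/measurable_EFinP; exact: measurable_normal_pdf.
have pe : forall y, normal_pdf 0 1 y = (`|b| * normal_pdf m b (m + b * y))%R.
  move=> y; rewrite !normal_pdfE ?oner_neq0// /normal_peak /normal_fun.
  rewrite subr0 expr1n mul1r addrAC subrr add0r mulrA; congr (_ * expR _)%R.
    rewrite -mulrnAr sqrtrM ?sqr_ge0// sqrtr_sqr invfM mulrA.
    by rewrite divff ?normr_eq0// mul1r.
  by field.
rewrite /normal_prob [RHS](_ : _ =
    \int[mscale k (pushforward mu F)]_(x in A) (normal_pdf m b x)%:E); last first.
  apply: eq_measure_integral => B mB _.
  exact: lebesgue_measure_affine.
rewrite ge0_integral_mscale//=; last 2 first.
- exact: measurable_funTS.
- by move=> x _; rewrite lee_fin normal_pdf_ge0.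
rewrite ge0_integral_pushforward//=; last 2 first.
- exact: measurable_funTS.
- by move=> x _; rewrite lee_fin normal_pdf_ge0.
rewrite -ge0_integralZl//=.
- by apply: eq_integral => y _; rewrite pe EFinM.
- by rewrite -(setTI (_ @^-1` _)); exact: (mg measurableT).
- by apply: measurable_funTS; exact: (measurableT_comp mf mg).
- by move=> x _; rewrite lee_fin normal_pdf_ge0.
Qed.

Lemma normal_pdf_sqr (m s t : R) : (s ^+ 2 = t ^+ 2)%R ->
  normal_pdf m s = normal_pdf m t.
Proof.
move=> st; have st0 : (s == 0%R) = (t == 0%R).
  by rewrite -[LHS](sqrf_eq0 s) st sqrf_eq0.
by apply/funext => x; rewrite /normal_pdf st0 /normal_peak /normal_fun st.
Qed.

Lemma normal_pdf_mul (a b x z : R) : b != 0%R ->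
  let c := Num.sqrt (a ^+ 2 + b ^+ 2) in
  (normal_pdf 0 1 x * normal_pdf (a * x) b z =
   normal_pdf 0 c z * normal_pdf (a * z / c ^+ 2) (b / c) x)%R.
Proof.
move=> b0 c.
have c20 : (0 < a ^+ 2 + b ^+ 2)%R.
  by rewrite ltr_wpDl ?sqr_ge0// exprn_even_gt0.
have c2 : (c ^+ 2 = a ^+ 2 + b ^+ 2)%R by rewrite sqr_sqrtr// ltW.
have c0 : c != 0%R by rewrite gt_eqF// sqrtr_gt0.
have bc : (b / c != 0)%R by rewrite mulf_neq0 ?invr_eq0.
rewrite !normal_pdfE ?oner_neq0// /normal_peak /normal_fun.
rewrite mulrACA [RHS]mulrACA -!expRD; congr (_ * expR _)%R.
  rewrite -!invfM -!sqrtrM; last 2 first.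
  - by rewrite mulrn_wge0// mulr_ge0 ?sqr_ge0 ?pi_ge0.
  - by rewrite mulrn_wge0// mulr_ge0 ?sqr_ge0 ?pi_ge0.
  by congr (Num.sqrt _)^-1%R; field.
rewrite c2 expr_div_n c2; field.
by rewrite b0 gt_eqF.
Qed.

Lemma measurable_normal_affine2 (a b : R) (B : set RB) : measurable B ->
  measurable_fun setT (fun x : RB => normal_prob 0 1 [set y | B (a * x + b * y)%R]).
Proof.
move=> mB.
have mg : measurable_fun setT (fun w : RB * RB => (a * w.1 + b * w.2 : RB)%R).
  by apply: measurable_funD; apply: measurable_funM.
have := @measurable_fun_xsection _ _ RB RB R (normal_prob 0 1)
  [set w : RB * RB | B (a * w.1 + b * w.2)%R].
have mE : measurable [set w : RB * RB | B (a * w.1 + b * w.2)%R].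
  by rewrite -(setTI [set w | _]); exact: (mg measurableT).
move=> /(_ mE); apply: eq_measurable_fun => x _ /=; congr (normal_prob 0 1 _).
by apply/seteqP; split => y /=; rewrite /xsection/= inE.
Qed.

(** After Tonelli and [normal_pdf_mul], the inner integral is that of a conditional density in x,
    which equals 1. *)
Lemma normal_conv2 (a b : R) (B : set R) : b != 0%R -> measurable B ->
  \int[normal_prob 0 1]_x normal_prob (a * x) b B =
  normal_prob 0 (Num.sqrt (a ^+ 2 + b ^+ 2)) B.
Proof.
move=> b0 mB; set c := Num.sqrt _.
pose f (w : RB * RB) : \bar R :=
  (normal_pdf 0 1 w.1 * normal_pdf (a * w.1) b w.2 * \1_B w.2)%:E.
have mf : measurable_fun setT f.
  apply/measurable_EFinP; apply: measurable_funM; last first.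
    by apply: measurableT_comp => //; exact: measurable_indic.
  apply: measurable_funM.
    by apply: measurableT_comp => //; exact: measurable_normal_pdf.
  rewrite (_ : (fun _ => _) = (fun x : RB * RB =>
    normal_peak b * expR (- (x.2 - a * x.1) ^+ 2 / (b ^+ 2 *+ 2)))%R); last first.
    by apply/funext => -[x y] /=; rewrite normal_pdfE.
  apply: measurable_funM => //; apply: measurableT_comp => //.
  apply: measurable_funM => //; apply: measurableT_comp => //.
  apply: measurable_funX; apply: measurable_funB => //.
  by apply: measurable_funM.
have f0 w : 0 <= f w.
  by rewrite lee_fin !mulr_ge0 ?normal_pdf_ge0.
have inner x : (normal_prob (a * x) b B * (normal_pdf 0 1 x)%:E =
    \int[mu]_y f (x, y)).
  rewrite /normal_prob integral_mkcond muleC -ge0_integralZl//=.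
  - apply: eq_integral => y _; rewrite /f/= -mulrA EFinM; congr *%E.
    by rewrite patchE indicE; case: ifPn => _; rewrite ?mulr1 ?mulr0.
  - apply/(measurable_restrictT _ _).1 => //; apply: measurable_funTS.
    by apply/measurable_EFinP; exact: measurable_normal_pdf.
  - by move=> y _; apply: erestrict_ge0 => z _; rewrite lee_fin normal_pdf_ge0.
  - by rewrite lee_fin normal_pdf_ge0.
rewrite ge0_integral_normal//; last first.
  have := measurable_normal_affine2 a b mB.
  by apply: eq_measurable_fun => x _; exact: normal_prob_affine.
under eq_integral do rewrite inner.
rewrite (fubini_tonelli f)// /normal_prob [RHS]integral_mkcond.
apply: eq_integral => z _.
rewrite (_ : \int[mu]_x f (x, z) = \int[mu]_x ((normal_pdf 0 c z * \1_B z)%:E *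
    (normal_pdf (a * z / c ^+ 2) (b / c) x)%:E)); last first.
  apply: eq_integral => x _; rewrite /f/= normal_pdf_mul// -/c -EFinM.
  by congr (_%:E); ring.
rewrite ge0_integralZl//=.
- rewrite integral_normal_pdf mule1 patchE indicE.
  by case: ifPn => _; rewrite ?mulr1 ?mulr0.
- by apply/measurable_EFinP; exact: measurable_normal_pdf.
- by move=> x _; rewrite lee_fin normal_pdf_ge0.
- by rewrite lee_fin mulr_ge0 ?normal_pdf_ge0.
Qed.

Lemma normal_prob_sqr (m s t : R) : (s ^+ 2 = t ^+ 2)%R ->
  normal_prob m s = normal_prob m t.
Proof. by move=> st; rewrite /normal_prob (normal_pdf_sqr _ st). Qed.

(** The law is written as an image of N(0,1) because it is a point mass when a = b = 0, and
    [normal_prob 0 c] is the law of a scaled standard normal only for nonzero c. *)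
Lemma normal_lin2 (a b : R) (B : set RB) : measurable B ->
  \int[normal_prob 0 1]_x normal_prob 0 1 [set y | B (a * x + b * y)%R] =
  normal_prob 0 1 [set z | B (Num.sqrt (a ^+ 2 + b ^+ 2) * z)%R].
Proof.
move=> mB; set c := Num.sqrt _.
have cE : (c ^+ 2 = a ^+ 2 + b ^+ 2)%R by rewrite sqr_sqrtr ?addr_ge0 ?sqr_ge0.
have scale s : s != 0%R ->
    normal_prob 0 1 [set z | B (s * z)%R] = normal_prob 0 s B.
  move=> s0; rewrite -(normal_prob_affine 0 s0 mB).
  by apply: congr1; apply/seteqP; split => z /=; rewrite add0r.
have [b0|b0] := eqVneq b 0%R; last first.
  rewrite scale; last first.
    by rewrite -sqrf_eq0 cE gt_eqF// ltr_wpDl ?sqr_ge0// exprn_even_gt0.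
  rewrite -(normal_conv2 a b0 mB); apply: eq_integral => x _.
  exact: normal_prob_affine.
have [a0|a0] := eqVneq a 0%R.
  have -> : c = 0%R by apply/eqP; rewrite -sqrf_eq0 cE a0 b0 expr0n addr0.
  rewrite a0 b0; under eq_integral.
    move=> x _; under eq_set do rewrite !mul0r addr0.
    over.
  under [in RHS]eq_set do rewrite mul0r.
  have mC : measurable [set _ : RB | B 0%R].
    have [B0|B0] := pselect (B 0%R).
      by rewrite (_ : [set _ | _] = setT)//; apply/seteqP; split.
    by rewrite (_ : [set _ | _] = set0)//; apply/seteqP; split.
  by rewrite integral_cst//= probability_setT mule1.
have ca : (c ^+ 2 = a ^+ 2)%R by rewrite cE b0 expr0n addr0.
have c0 : c != 0%R by rewrite -(sqrf_eq0 c) ca sqrf_eq0.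
rewrite (scale c c0) (normal_prob_sqr 0 ca) -(scale a a0).
have mF : measurable [set x : RB | B (a * x)%R].
  rewrite -(setTI [set w | _]).
  have mg : measurable_fun setT (fun w : RB => (a * w : RB)%R) by exact: measurable_funM.
  exact: (mg measurableT).
transitivity (\int[normal_prob 0 1]_x (\1_[set x : RB | B (a * x)%R] x)%:E);
  last by rewrite integral_indic// setIT.
apply: eq_integral => x _.
rewrite indicE; have [Bx|Bx] := pselect (B (a * x)%R).
  rewrite mem_set// (_ : [set y | _] = setT) ?probability_setT//.
  by apply/seteqP; split => // y _ /=; rewrite b0 mul0r addr0.
rewrite memNset// (_ : [set y | _] = set0) ?measure0//.
by apply/seteqP; split => // y /=; rewrite b0 mul0r addr0.
Qed.

(** Tilting the standard density by exp (s x^2) gives, up to the factor t = (1 - 2 s)^(-1/2), the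
    density of N(0, t^2). *)
Lemma integral_expR_sqr_normal (s : R) : (s < 2^-1)%R ->
  \int[normal_prob 0 1]_x (expR (s * x ^+ 2))%:E =
  ((Num.sqrt (1 - s *+ 2))^-1)%:E.
Proof.
move=> s12; have d0 : (0 < 1 - s *+ 2)%R by lra.
have q0 : (0 < Num.sqrt (1 - s *+ 2))%R by rewrite sqrtr_gt0.
rewrite ge0_integral_normal//; last first.
  apply/measurable_EFinP; apply: measurableT_comp => //.
  exact: measurable_funM.
pose t := ((Num.sqrt (1 - s *+ 2))^-1)%R.
have t0 : t != 0%R by rewrite invr_eq0 gt_eqF.
have t2 : (t ^+ 2 = (1 - s *+ 2)^-1)%R by rewrite exprVn sqr_sqrtr// ltW.
transitivity (\int[mu]_x (t%:E * (normal_pdf 0 t x)%:E)).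
  apply: eq_integral => x _; rewrite -!EFinM; congr (_%:E).
  rewrite !normal_pdfE ?oner_neq0// /normal_peak /normal_fun.
  rewrite mulrCA -expRD [RHS]mulrA; congr (_ * expR _)%R.
    rewrite -!mulrnAr expr1n mul1r (sqrtrM _ (sqr_ge0 t)) sqrtr_sqr invfM mulrA.
    by rewrite gtr0_norm ?invr_gt0// divff// mul1r.
  rewrite t2; field.
  by rewrite mulr_natr gt_eqF.
rewrite ge0_integralZl//=.
- by rewrite integral_normal_pdf mule1.
- by apply/measurable_EFinP; exact: measurable_normal_pdf.
- by move=> x _; rewrite lee_fin normal_pdf_ge0.
- by rewrite lee_fin invr_ge0 ltW.
Qed.

End normal_law.

(** * Chi-square laws: generating function, tails and mean absolute deviation *)

Section chi2.
Context {R : realType}.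
Local Notation RB := (measurableTypeR R).
Local Open Scope ereal_scope.

Lemma measure_le_integral d (T : measurableType d) (nu : {measure set T -> \bar R})
    (A : set T) (f : T -> \bar R) :
  measurable A -> measurable_fun setT f -> (forall x, 0 <= f x) ->
  (forall x, A x -> 1 <= f x) -> nu A <= \int[nu]_x f x.
Proof.
move=> mA mf f0 f1; rewrite -[A]setIT -integral_indic//.
apply: ge0_le_integral => //.
- by apply/measurable_EFinP; exact: measurable_indic.
- move=> x _; rewrite indicE; have [Ax|Ax] := pselect (A x).
    by rewrite mem_set//; exact: f1.
  by rewrite memNset.
Qed.

Lemma ge0_integral_chi2S (m : nat) (f : RB -> \bar R) :
  measurable_fun setT f -> (forall x, 0 <= f x) ->
  \int[chi2_prob m.+1]_x f x =
  \int[normal_prob 0 1]_x \int[chi2_prob m]_y f (x ^+ 2 + y)%R.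
Proof.
move=> mf f0 /=.
rewrite ge0_integral_distribution//.
rewrite (fubini_tonelli1 (f \o @sqr_add R))//.
  by apply: measurableT_comp => //; exact: measurable_sqr_add.
by move=> x; exact: f0.
Qed.

Lemma measurable_expR_affine (s c : R) :
  measurable_fun setT (fun x : RB => (expR (s * x + c))%:E).
Proof.
apply/measurable_EFinP; apply: measurableT_comp => //.
by apply: measurable_funD => //; exact: measurable_funM.
Qed.

Lemma chi2_mgf (s : R) (m : nat) : (s < 2^-1)%R ->
  \int[chi2_prob m]_x (expR (s * x))%:E =
  ((Num.sqrt (1 - s *+ 2))^-1 ^+ m)%:E.
Proof.
move=> s12; elim: m => [|m IH].
  rewrite integral_dirac//= ?diracT ?mul1e ?mulr0 ?expR0 ?expr0//.
  have := measurable_expR_affine s 0.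
  by apply: eq_measurable_fun => x _; rewrite addr0.
rewrite ge0_integral_chi2S//; last first.
  have := measurable_expR_affine s 0.
  by apply: eq_measurable_fun => x _; rewrite addr0.
transitivity (\int[normal_prob 0 1]_x ((expR (s * x ^+ 2))%:E *
    ((Num.sqrt (1 - s *+ 2))^-1 ^+ m)%:E)).
  apply: eq_integral => x _; rewrite -IH -ge0_integralZl//=.
  - by apply: eq_integral => y _; rewrite mulrDr expRD EFinM.
  - have := measurable_expR_affine s 0.
    by apply: eq_measurable_fun => z _; rewrite addr0.
rewrite ge0_integralZr//=.
- by rewrite integral_expR_sqr_normal// -EFinM exprS.
- apply/measurable_EFinP; apply: measurableT_comp => //.
  exact: measurable_funM.
Qed.

(** From exp y >= 1 + y, since (1 + u + 2 u^2) (1 - u) = 1 + u^2 (1 - 2 u). *)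
Lemma expR_mul1B_ge1 (u : R) : (`|u| <= 2^-1)%R ->
  (1 <= expR (u + 2 * u ^+ 2) * (1 - u))%R.
Proof.
rewrite ler_norml => /andP[u1 u2].
have e1 : (1 + (u + 2 * u ^+ 2) <= expR (u + 2 * u ^+ 2))%R by exact: expR_ge1Dx.
have u12 : (0 <= u ^+ 2 * (1 - 2 * u))%R by rewrite mulr_ge0 ?sqr_ge0//; lra.
apply: (@le_trans _ _ ((1 + (u + 2 * u ^+ 2)) * (1 - u))%R); first by nra.
by rewrite ler_wpM2r//; lra.
Qed.

(** The square root of [expR_mul1B_ge1] at u = 2 s. The linear term s is the mean of one squared
    normal, so centring will leave a purely quadratic exponent. *)
Lemma sqrtV_le_expR (s : R) : (`|s| <= 4^-1)%R ->
  ((Num.sqrt (1 - s *+ 2))^-1 <= expR (s + 4 * s ^+ 2))%R.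
Proof.
move=> s4; have := s4; rewrite ler_norml => /andP[s1 s2].
have d0 : (0 < 1 - s *+ 2)%R by lra.
rewrite -div1r ler_pdivrMr ?sqrtr_gt0// -[expR _]ger0_norm ?expR_ge0//.
rewrite -sqrtr_sqr -sqrtrM ?sqr_ge0// -[leLHS]sqrtr1 ler_wsqrtr//.
have u2 : (`|s *+ 2| <= 2^-1)%R by rewrite ler_norml; apply/andP; split; lra.
have := expR_mul1B_ge1 u2; congr (_ <= _ * _)%R.
by rewrite -expRM_natl; congr expR; ring.
Qed.

Lemma chi2_mgf_centered (s : R) (m : nat) : (`|s| <= 4^-1)%R ->
  \int[chi2_prob m]_x (expR (s * (x - m%:R)))%:E <=
  (expR (4 * s ^+ 2 * m%:R))%:E.
Proof.
move=> s4; have := s4; rewrite ler_norml => /andP[s1 s2].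
rewrite [leLHS](_ : _ =
    \int[chi2_prob m]_x ((expR (- (s * m%:R)))%:E * (expR (s * x))%:E)); last first.
  by apply: eq_integral => x _; rewrite -EFinM -expRD; congr (expR _)%:E; ring.
have ms : measurable_fun setT (fun x : RB => (expR (s * x))%:E).
  have := measurable_expR_affine s 0.
  by apply: eq_measurable_fun => z _; rewrite addr0.
rewrite ge0_integralZl//= ?lee_fin ?expR_ge0//.
rewrite chi2_mgf; last lra.
rewrite -EFinM lee_fin.
apply: (@le_trans _ _ (expR (- (s * m%:R)) * expR (s + 4 * s ^+ 2) ^+ m)%R).
  rewrite ler_wpM2l ?expR_ge0// lerXn2r ?nnegrE ?expR_ge0 ?invr_ge0 ?sqrtr_ge0//.
  exact: sqrtV_le_expR.
by rewrite -expRM_natl -expRD ler_expR; lra.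
Qed.

Lemma chi2_chernoff (s c : R) (m : nat) (A : set RB) : measurable A ->
  (`|s| <= 4^-1)%R -> (forall x, A x -> 0 <= s * (x - m%:R) - c)%R ->
  chi2_prob m A <= (expR (4 * s ^+ 2 * m%:R - c))%:E.
Proof.
move=> mA s4 hA.
have mE := measurable_expR_affine s (- (s * m%:R) - c).
apply: (le_trans (measure_le_integral _ mA mE _ _)) => //.
  move=> x /hA h; rewrite lee_fin -[leLHS]expR0 ler_expR.
  by rewrite (_ : s * x + _ = s * (x - m%:R) - c)%R//; ring.
rewrite [leLHS](_ : _ = \int[chi2_prob m]_x
    ((expR (- c))%:E * (expR (s * (x - m%:R)))%:E)); last first.
  by apply: eq_integral => x _; rewrite -EFinM -expRD; congr (expR _)%:E; ring.
rewrite ge0_integralZl//= ?lee_fin ?expR_ge0//; last first.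
  have := measurable_expR_affine s (- (s * m%:R)).
  by apply: eq_measurable_fun => z _; congr (expR _)%:E; ring.
rewrite addrC expRD EFinM lee_wpmul2l ?lee_fin ?expR_ge0//.
exact: chi2_mgf_centered.
Qed.

Lemma measurable_ge (a : R) : measurable [set x : RB | (a <= x)%R].
Proof.
rewrite (_ : [set _ | _] = [set` `[a, +oo[%R]); first exact: measurable_itv.
by apply/seteqP; split => x /=; rewrite in_itv/= andbT.
Qed.

Lemma measurable_le (a : R) : measurable [set x : RB | (x <= a)%R].
Proof.
rewrite (_ : [set _ | _] = [set` `]-oo, a]%R]); first exact: measurable_itv.
by apply/seteqP; split => x /=; rewrite in_itv/=.
Qed.

Lemma chi2_upper_tail (d : R) (m : nat) : (0 <= d <= 1)%R ->
  chi2_prob m [set x : RB | (1 + d) * m%:R <= x]%R <=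
  (expR (- (d ^+ 2 / 16 * m%:R)))%:E.
Proof.
move=> /andP[d0 d1].
(* The tilt s = d / 8 minimises 4 s^2 m - s d m, with value - d^2 m / 16. *)
apply: (le_trans (@chi2_chernoff (d / 8) (d ^+ 2 / 8 * m%:R) _ _ _ _ _)).
- exact: measurable_ge.
- by rewrite ler_norml; apply/andP; split; lra.
- by move=> x /= hx; nra.
- by rewrite lee_fin ler_expR; lra.
Qed.

Lemma chi2_lower_tail (d : R) (m : nat) : (0 <= d <= 1)%R ->
  chi2_prob m [set x : RB | x <= (1 - d) * m%:R]%R <=
  (expR (- (d ^+ 2 / 16 * m%:R)))%:E.
Proof.
move=> /andP[d0 d1].
apply: (le_trans (@chi2_chernoff (- (d / 8)) (d ^+ 2 / 8 * m%:R) _ _ _ _ _)).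
- exact: measurable_le.
- by rewrite ler_norml; apply/andP; split; lra.
- by move=> x /= hx; nra.
- by rewrite lee_fin ler_expR; lra.
Qed.

(** Chernoff with the exact generating function. It allows tilts beyond 1/4 in absolute value: very
    negative ones for small balls, and ones close to 1/2 for the sharp tail of a single squared
    normal. *)
Lemma chi2_mgf_tail (s t : R) (m : nat) (A : set RB) : measurable A ->
  (s < 2^-1)%R -> (forall x, A x -> s * t <= s * x)%R ->
  chi2_prob m A <=
  ((Num.sqrt (1 - s *+ 2))^-1 ^+ m * expR (- (s * t)))%:E.
Proof.
move=> mA s2 hA.
have mE := measurable_expR_affine s (- (s * t)).
apply: (le_trans (measure_le_integral _ mA mE _ _)) => //.
  by move=> x /hA h; rewrite lee_fin -[leLHS]expR0 ler_expR subr_ge0.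
have ms : measurable_fun setT (fun x : RB => (expR (s * x))%:E).
  have := measurable_expR_affine s 0.
  by apply: eq_measurable_fun => z _; rewrite addr0.
rewrite EFinM muleC -chi2_mgf// -ge0_integralZl//= ?lee_fin ?expR_ge0//.
rewrite le_eqVlt; apply/orP; left; apply/eqP; apply: eq_integral => x _.
by rewrite -EFinM -expRD addrC.
Qed.

(** The inequality |y| <= exp y + exp (- y), at y proportional to (x - m) / sqrt m, reduces the
    first moment to the generating function already bounded. *)
Lemma chi2_abs_dev (m : nat) :
  \int[@chi2_prob R m]_x (`|x - m%:R|)%:E <=
  (8 * expR 4^-1 * Num.sqrt m%:R)%:E.
Proof.
have [->|m0] := eqVneq m 0%N.
  rewrite integral_dirac//= ?diracT ?mul1e ?subrr ?normr0 ?sqrtr0 ?mulr0//.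
  apply/measurable_EFinP; apply: measurableT_comp => //.
  exact: measurable_funB.
have m1 : (1 <= m%:R :> R)%R by rewrite ler1n lt0n.
set r := Num.sqrt m%:R.
have r1 : (1 <= r)%R by rewrite -[leLHS]sqrtr1 ler_wsqrtr.
have r2 : (r ^+ 2 = m%:R)%R by rewrite sqr_sqrtr.
have r0 : r != 0%R by rewrite gt_eqF// (lt_le_trans _ r1).
(* This scale makes the exponent 4 s^2 m equal to 1/4, and s <= 1/4 because m >= 1. *)
pose s := ((4 * r)^-1)%R.
have s0 : (0 <= s)%R by rewrite invr_ge0 mulr_ge0// (le_trans _ r1).
have s4 : (`|s| <= 4^-1)%R.
  rewrite ger0_norm// /s invfM ler_piMr// ?invr_ge0// invf_le1//.
  exact: lt_le_trans r1.
have mC t : measurable_fun setT (fun x : RB => (expR (t * (x - m%:R)))%:E).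
  have := measurable_expR_affine t (- (t * m%:R)).
  by apply: eq_measurable_fun => z _; congr (expR _)%:E; ring.
have bnd t : (t ^+ 2 = s ^+ 2)%R -> (`|t| <= 4^-1)%R ->
    \int[chi2_prob m]_x (expR (t * (x - m%:R)))%:E <= (expR 4^-1)%:E.
  move=> ts t4; apply: (le_trans (chi2_mgf_centered _ t4)).
  rewrite ts -r2 lee_fin ler_expR le_eqVlt; apply/orP; left; apply/eqP.
  by rewrite /s; field.
apply: (@le_trans _ _ (\int[chi2_prob m]_x ((4 * r)%:E *
    ((expR (s * (x - m%:R)))%:E + (expR (- s * (x - m%:R)))%:E)))).
  apply: ge0_le_integral => //.
  - apply/measurable_EFinP; apply: measurableT_comp => //.
    exact: measurable_funB.
  - by apply: measurable_funeM; exact: emeasurable_funD.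
  - move=> x _; rewrite -EFinD -EFinM lee_fin.
    have h (y : R) : (`|y| <= expR y + expR (- y))%R.
      have h1 := expR_ge1Dx y; have h2 := expR_ge1Dx (- y).
      have h3 := expR_ge0 y; have h4 := expR_ge0 (- y).
      by rewrite ler_norml; apply/andP; split; lra.
    have := h (s * (x - m%:R))%R.
    rewrite normrM (ger0_norm s0) mulNr /s ler_pdivrMl//.
    by rewrite mulr_gt0// (lt_le_trans _ r1).
rewrite ge0_integralZl//=; last 3 first.
- exact: emeasurable_funD.
- by move=> x _; rewrite adde_ge0// lee_fin expR_ge0.
- by rewrite lee_fin mulr_ge0// (le_trans _ r1).
rewrite ge0_integralD//.
apply: (@le_trans _ _ ((4 * r)%:E * ((expR 4^-1)%:E + (expR 4^-1)%:E))).
  rewrite lee_wpmul2l ?lee_fin ?mulr_ge0 ?(le_trans _ r1)//.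
  by rewrite leeD// bnd ?normrN// sqrrN.
rewrite -EFinD -EFinM lee_fin le_eqVlt; apply/orP; left; apply/eqP; ring.
Qed.

(** The tilt - s with 1 + 2 s = u bounds the probability by (exp 1 / sqrt u)^m. Taking u so large
    that the base is at most 1 and at most [e] makes the bound uniform in m >= 1. *)
Lemma chi2_small_ball (e : R) : (0 < e)%R -> exists2 d : R, (0 < d)%R &
  forall m, (0 < m)%N ->
    chi2_prob m [set x : RB | x <= d * m%:R]%R <= e%:E.
Proof.
move=> e0; pose u := (1 + (expR 1 / e) ^+ 2 + expR 1 ^+ 2)%R.
have u1 : (1 < u)%R.
  by rewrite /u -addrA ltrDl addr_gt0 ?exprn_gt0 ?divr_gt0 ?expR_gt0.
(* [s] is such that [1 + 2 s = u] *)
pose s := ((u - 1) / 2)%R.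
have s0 : (0 < s)%R by rewrite divr_gt0// subr_gt0.
exists (s^-1)%R; first by rewrite invr_gt0.
move=> m m0.
apply: (le_trans (@chi2_mgf_tail (- s) (s^-1 * m%:R) _ _ _ _ _)).
- exact: measurable_le.
- by rewrite (lt_trans _ (_ : 0 < 2^-1)%R)// oppr_lt0.
- by move=> x /= hx; rewrite ler_nM2l// oppr_lt0.
rewrite lee_fin mulNr opprK mulVKf ?gt_eqF//.
have -> : (1 - - s *+ 2 = u)%R by rewrite /s; field.
rewrite -[X in expR X]mul1r expRM_natr -exprMn.
have le_sqrtu y : (0 <= y)%R -> (y ^+ 2 <= u)%R -> (y <= Num.sqrt u)%R.
  by move=> y0 yu; rewrite -[leLHS]ger0_norm// -sqrtr_sqr ler_wsqrtr.
have su0 : (0 < Num.sqrt u)%R by rewrite sqrtr_gt0 (lt_trans _ u1).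
have y1 : ((Num.sqrt u)^-1 * expR 1 <= 1)%R.
  rewrite mulrC ler_pdivrMr// mul1r le_sqrtu ?expR_ge0// lerDr.
  by rewrite addr_ge0 ?sqr_ge0.
have ye : ((Num.sqrt u)^-1 * expR 1 <= e)%R.
  rewrite mulrC ler_pdivrMr// -ler_pdivrMl// mulrC.
  rewrite le_sqrtu ?divr_ge0 ?expR_ge0 ?(ltW e0)//.
  by rewrite /u addrAC lerDr addr_ge0 ?sqr_ge0.
rewrite -(prednK m0) exprS (le_trans _ ye)// ler_piMr ?mulr_ge0 ?invr_ge0 ?expR_ge0 ?(ltW su0)//.
by rewrite exprn_ile1// mulr_ge0 ?invr_ge0 ?expR_ge0 ?(ltW su0).
Qed.

Lemma chi2_dev_tail (a : R) (m : nat) (A : set RB) : measurable A ->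
  (0 < a)%R -> (forall x, A x -> a <= `|x - m%:R|)%R ->
  chi2_prob m A <= (8 * expR 4^-1 * Num.sqrt m%:R / a)%:E.
Proof.
move=> mA a0 hA.
have mf : measurable_fun setT (fun x : RB => (`|x - m%:R|)%:E).
  apply/measurable_EFinP; apply: measurableT_comp => //.
  exact: measurable_funB.
apply: (@le_trans _ _ (\int[@chi2_prob R m]_x ((a^-1)%:E * (`|x - m%:R|)%:E))).
  apply: measure_le_integral => //.
  - exact: measurable_funeM.
  - by move=> x; rewrite -EFinM lee_fin mulr_ge0// invr_ge0 ltW.
  - by move=> x /hA h; rewrite -EFinM lee_fin mulrC ler_pdivlMr// mul1r.
rewrite ge0_integralZl//=; last by rewrite lee_fin invr_ge0 ltW.
rewrite [in leRHS]mulrC EFinM lee_wpmul2l ?lee_fin ?invr_ge0 ?(ltW a0)//.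
exact: chi2_abs_dev.
Qed.

(** * Quantiles of the chi-square law *)

Section quantile.
Variable tau : R.
Hypothesis tau01 : (0 < tau < 1)%R.

Let S m := [set x : R | tau%:E <= chi2_prob m [set` `]-oo, x]]].

Let le_chi2 m (A B : set RB) : measurable A -> measurable B -> A `<=` B ->
  chi2_prob m A <= chi2_prob m B.
Proof. by move=> mA mB AB; apply: le_measure; rewrite ?inE. Qed.

Let S_up m (x y : R) : (x <= y)%R -> S m x -> S m y.
Proof.
move=> xy /le_trans; apply; apply: le_chi2 => //.
by move=> z /=; rewrite !in_itv/= => /le_trans; apply.
Qed.

Let measurable_gt (a : R) : measurable [set x : RB | (a < x)%R].
Proof.
rewrite (_ : [set _ | _] = [set` `]a, +oo[%R]); first exact: measurable_itv.
by apply/seteqP; split => x /=; rewrite in_itv/= andbT.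
Qed.

Let measurable_lt (a : R) : measurable [set x : RB | (x < a)%R].
Proof.
rewrite (_ : [set _ | _] = [set` `]-oo, a[%R]); first exact: measurable_itv.
by apply/seteqP; split => x /=; rewrite in_itv/=.
Qed.

Let chi2_gtE m (x : R) : chi2_prob m [set y : RB | x < y]%R =
  1 - chi2_prob m [set` `]-oo, x]].
Proof.
rewrite -probability_setC//; congr (chi2_prob m _).
by rewrite setCitvl; apply/seteqP; split => y /=; rewrite in_itv/= andbT.
Qed.

Let SP m (x : R) : S m x <-> chi2_prob m [set y : RB | x < y]%R <= (1 - tau)%:E.
Proof.
rewrite chi2_gtE /S/= EFinB leeBrDr// addeC.
have /fineK <- : chi2_prob m [set` `]-oo, x]] \is a fin_num by exact: fin_num_measure.
by rewrite -EFinB -EFinD !lee_fin; split => ?; lra.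
Qed.

Let S_bounds : exists2 K : R, (0 < K)%R & forall m, (0 < m)%N ->
  S m (m%:R + K * Num.sqrt m%:R)%R /\ lbound (S m) (m%:R - K * Num.sqrt m%:R)%R.
Proof.
have /andP[t0 t1] := tau01.
(* Deviations of size a will have probability at most k / 2, which is below both tau and 1 - tau. *)
pose k := (tau * (1 - tau))%R; have k0 : (0 < k)%R by rewrite mulr_gt0// subr_gt0.
pose C : R := (8 * expR 4^-1)%R.
have C0 : (0 < C)%R by rewrite mulr_gt0// expR_gt0.
exists (2 * C / k)%R; first by rewrite divr_gt0// mulr_gt0.
move=> m m0; set a := (_ * Num.sqrt _)%R.
have s0 : (0 < Num.sqrt (m%:R : R))%R by rewrite sqrtr_gt0 ltr0n.
have a0 : (0 < a)%R by rewrite mulr_gt0// divr_gt0// mulr_gt0.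
have tail (A : set RB) : measurable A -> (forall x : R, A x -> a <= `|x - m%:R|)%R ->
    chi2_prob m A <= (k / 2)%:E.
  move=> mA hA; apply: (le_trans (chi2_dev_tail mA a0 hA)).
  rewrite lee_fin le_eqVlt; apply/orP; left; apply/eqP.
  by rewrite -/C /a; field; rewrite !gt_eqF.
have Sm : S m (m%:R + a)%R.
  apply/SP; apply: (le_trans (tail _ _ _)) => //.
    move=> x /= hx; rewrite ger0_norm; last by rewrite subr_ge0; lra.
    by rewrite lerBrDl ltW.
  by rewrite lee_fin /k; nra.
split=> // x Sx; rewrite leNgt; apply/negP => xa.
have : chi2_prob m [set` `]-oo, x]] <= (k / 2)%:E.
  apply: tail => // y /=; rewrite in_itv/= => yx.
  by rewrite distrC ger0_norm; lra.
by move=> /(le_trans Sx); rewrite lee_fin /k; nra.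
Qed.

Let S_has_inf m : (0 < m)%N -> has_inf (S m).
Proof.
by have [K _ hK] := S_bounds => /hK[? ?]; split; eexists; eassumption.
Qed.

Lemma chi2_quantile_dev : exists2 K : R, (0 < K)%R & forall m, (0 < m)%N ->
  (`|chi2_quantile tau m - m%:R| <= K * Num.sqrt m%:R)%R.
Proof.
have [K K0 hK] := S_bounds; exists K => // m m0; have [Sm lbS] := hK m m0.
rewrite ler_distl; apply/andP; split.
  by apply: lb_le_inf => //; have [] := S_has_inf m0.
by apply: ge_inf => //; have [] := S_has_inf m0.
Qed.

(** The lower bound m - K sqrt m is void for small m; the small-ball estimate gives a linear bound
    from m = 1 on, so that division by the quantile is under control at every sample size. *)
Lemma chi2_quantile_ge : exists2 d : R, (0 < d)%R & forall m, (0 < m)%N ->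
  (d * m%:R <= chi2_quantile tau m)%R.
Proof.
have /andP[t0 t1] := tau01.
have [d d0 hd] := @chi2_small_ball (tau / 2) (divr_gt0 t0 (ltr0Sn R 1)).
exists d => // m m0; apply: lb_le_inf; first by have [] := S_has_inf m0.
move=> x Sx; rewrite leNgt; apply/negP => xd.
have : chi2_prob m [set` `]-oo, x]] <= (tau / 2)%:E.
  apply: le_trans (hd m m0); apply: le_chi2 => //; first exact: measurable_le.
  by move=> y /=; rewrite in_itv/= => /le_trans; apply; exact: ltW.
by move=> /(le_trans Sx); rewrite lee_fin; lra.
Qed.

(** The sets {x > q + 1 / (k + 1)} increase to {x > q}; each threshold exceeds the infimum, hence
    lies in the upward closed set that defines the quantile. *)
Lemma chi2_gt_quantile m : (0 < m)%N ->
  chi2_prob m [set x : RB | chi2_quantile tau m < x]%R <= (1 - tau)%:E.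
Proof.
move=> m0; set q := chi2_quantile tau m.
pose F k := [set x : RB | q + k.+1%:R^-1 < x]%R.
have UF : \bigcup_k F k = [set x : RB | q < x]%R.
  apply/seteqP; split => [x [k _ /=]|x /= /ltr_add_invr[k qk]].
    by apply: lt_trans; rewrite ltrDl invr_gt0.
  by exists k.
have mF k : measurable (F k) by exact: measurable_gt.
have ndF : nondecreasing_seq F.
  move=> i j ij; apply/subsetPset => x /=; apply: le_lt_trans.
  by rewrite lerD2l lef_pV2 ?posrE// ler_nat.
have cF : chi2_prob m \o F @ \oo --> chi2_prob m [set x : RB | q < x]%R.
  by rewrite -UF; apply: nondecreasing_cvg_mu => //; rewrite UF.
rewrite -(cvg_lim _ cF)//; apply: lime_le; first by apply/cvg_ex; eexists; exact: cF.
near=> k; apply/SP.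
have k0 : (0 < k.+1%:R^-1 :> R)%R by rewrite invr_gt0.
have [x Sx xq] := inf_adherent k0 (S_has_inf m0).
by apply: S_up Sx; exact: ltW.
Unshelve. all: by end_near. Qed.

(** The thresholds q - 1 / (k + 1) lie strictly below the infimum, hence outside the defining set,
    and the sets below them increase to {x < q}. *)
Lemma chi2_lt_quantile m : (0 < m)%N ->
  chi2_prob m [set x : RB | x < chi2_quantile tau m]%R <= tau%:E.
Proof.
move=> m0; set q := chi2_quantile tau m.
pose F k := [set x : RB | x <= q - k.+1%:R^-1]%R.
have UF : \bigcup_k F k = [set x : RB | x < q]%R.
  apply/seteqP; split => [x [k _ /=]|x /= /ltr_add_invr[k qk]].
    by move=> /le_lt_trans; apply; rewrite ltrBlDr ltrDl invr_gt0.
  by exists k => //; rewrite /F/= lerBrDr ltW.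
have mF k : measurable (F k) by exact: measurable_le.
have ndF : nondecreasing_seq F.
  move=> i j ij; apply/subsetPset => x /= /le_trans; apply.
  by rewrite lerB// lef_pV2 ?posrE// ler_nat.
have cF : chi2_prob m \o F @ \oo --> chi2_prob m [set x : RB | x < q]%R.
  by rewrite -UF; apply: nondecreasing_cvg_mu => //; rewrite UF.
rewrite -(cvg_lim _ cF)//; apply: lime_le; first by apply/cvg_ex; eexists; exact: cF.
near=> k; rewrite leNgt; apply/negP => tF.
have Sq : S m (q - k.+1%:R^-1)%R.
  have E : [set` `]-oo, (q - k.+1%:R^-1)%R]%R] = F k.
    by apply/seteqP; split => x /=; rewrite in_itv/=.
  by rewrite /S/= E ltW.
have : (q <= q - k.+1%:R^-1)%R := ge_inf (proj2 (S_has_inf m0)) Sq.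
by rewrite lerDl oppr_ge0 leNgt invr_gt0 ltr0Sn.
Unshelve. all: by end_near. Qed.

End quantile.

End chi2.

(** * Independent standard normal families *)

Section measurable_mx.
Context {R : realType}.
Local Notation RB := (measurableTypeR R).

Lemma measurable_entry m n (i : 'I_m) (j : 'I_n) :
  measurable_fun setT (fun M : 'M[R]_(m, n) => M i j).
Proof.
move=> _ Y mY; rewrite setTI; apply: sub_sigma_algebra.
by exists (i, j, Y).
Qed.

Lemma measurable_mx d (T : measurableType d) m n (f : T -> 'M[R]_(m, n)) :
  (forall i j, measurable_fun setT (fun w => f w i j)) -> measurable_fun setT f.
Proof.
move=> mf; apply: (measurability (@entry_cylinders R m n)) => //.
move=> _ [_ [[[i j] B] /= mB <-] <-].
exact: (mf i j measurableT B mB).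
Qed.

Lemma measurable_mxE d (T : measurableType d) m n (f : T -> 'M[R]_(m, n)) i j :
  measurable_fun setT f -> measurable_fun setT (fun w => f w i j).
Proof. exact: (measurableT_comp (@measurable_entry _ _ i j)). Qed.

(** A generating family stable under intersection, as uniqueness of measures requires; the one-entry
    cylinders that define the sigma-algebra are not stable. *)
Definition mx_boxes m n : set (set 'M[R]_(m, n)) :=
  [set [set M : 'M[R]_(m, n) | forall i j, B i j (M i j)] |
     B in [set B : 'I_m -> 'I_n -> set R | forall i j, measurable (B i j)]].

Lemma measurable_mx_box m n (B : 'I_m -> 'I_n -> set R) :
  (forall i j, measurable (B i j)) ->
  measurable [set M : 'M[R]_(m, n) | forall i j, B i j (M i j)].
Proof.
move=> mB; rewrite (_ : mkset _ = \bigcap_(i in [set: 'I_m])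
    \bigcap_(j in [set: 'I_n]) ((fun M : 'M[R]_(m, n) => M i j) @^-1` B i j)).
  apply: fin_bigcap_measurable; first exact: finite_finset.
  move=> i _; apply: fin_bigcap_measurable; first exact: finite_finset.
  by move=> j _; rewrite -[_ @^-1` _]setTI; exact: measurable_entry.
apply/seteqP; split => M /=; first by move=> h i _ j _; exact: h.
by move=> h i j; exact: h.
Qed.

Lemma mx_boxes_generate m n : @measurable _ 'M[R]_(m, n) = <<s @mx_boxes m n >>.
Proof.
apply/seteqP; split.
  apply: smallest_sub; first exact: smallest_sigma_algebra.
  move=> _ [[[i j] B] /= mB <-]; apply: sub_sigma_algebra.
  exists (fun i' j' => if (i' == i) && (j' == j) then B else setT).
    by move=> i' j' /=; case: ifP.
  apply/seteqP; split => M /=; first by move=> /(_ i j); rewrite !eqxx.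
  by move=> BM i' j'; case: ifP => // /andP[/eqP-> /eqP->].
apply: smallest_sub; first exact: sigma_algebra_measurable.
by move=> _ [B mB <-]; exact: measurable_mx_box.
Qed.

Lemma mx_boxesI m n : setI_closed (@mx_boxes m n).
Proof.
move=> _ _ [B mB <-] [C mC <-]; exists (fun i j => B i j `&` C i j).
  by move=> i j; exact: measurableI.
apply/seteqP; split => M /= h; first by split => i j; have [] := h i j.
by move=> i j; split; [exact: h.1|exact: h.2].
Qed.

Lemma mx_measure_unique m n (m1 m2 : {measure set 'M[R]_(m, n) -> \bar R}) :
  (m1 setT < +oo)%E ->
  (forall A, @mx_boxes m n A -> m1 A = m2 A) ->
  forall A, measurable A -> m1 A = m2 A.
Proof.
move=> m1T m12 A mA.
have GT : @mx_boxes m n setT by exists (fun _ _ => setT) => //; apply/seteqP; split.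
apply: (measure_unique (@mx_boxes m n) (fun _ => setT)) => //.
- exact: mx_boxes_generate.
- exact: mx_boxesI.
- by apply/seteqP; split => // x _; exists 0%N.
Qed.

End measurable_mx.

Section independence.
Context {R : realType} {d : measure_display} {T : measurableType d}.
Variable P : probability T R.
Local Notation RB := (measurableTypeR R).

(** With [D] fixed, both sides are finite measures in [A] that agree on boxes. *)
Lemma mx_event_indep m n (U : {mfun T >-> 'M[R]_(m, n)}) (D : set T) :
  measurable D ->
  (forall A, @mx_boxes R m n A -> P ((U @^-1` A) `&` D) = (P (U @^-1` A) * P D)%E) ->
  forall A, measurable A -> P ((U @^-1` A) `&` D) = (P (U @^-1` A) * P D)%E.
Proof.
move=> mD box A mA.
have PD0 : 0 <= fine (P D) by rewrite fine_ge0.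
have PDE : (fine (P D))%:E = P D by rewrite fineK ?fin_num_measure.
pose m1 := pushforward (mrestr P mD) U.
pose m2 := mscale (NngNum PD0) (distribution P U).
have m2E B : m2 B = (P (U @^-1` B) * P D)%E by rewrite /m2 /mscale/= PDE muleC.
rewrite -m2E; apply: (@mx_measure_unique R m n m1 m2) => //.
- change (m1 setT < +oo)%E.
  have -> : m1 setT = P D by congr (P _); apply/seteqP; split => w // [].
  by rewrite (le_lt_trans (probability_le1 _ _))// ltry.
- by move=> B bB; change (m1 B = m2 B); rewrite m2E -box.
Qed.

(** The extension from boxes is applied twice: first to the event of [U] against a box of [V], then
    to the event of [V] against an arbitrary event of [U]. *)
Lemma boxes_indep m n k l (U : {mfun T >-> 'M[R]_(m, n)})
    (V : {mfun T >-> 'M[R]_(k, l)}) :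
  (forall A B, @mx_boxes R m n A -> @mx_boxes R k l B ->
    P ((U @^-1` A) `&` (V @^-1` B)) = (P (U @^-1` A) * P (V @^-1` B))%E) ->
  independent_matrices P U V.
Proof.
move=> h A B mA mB.
have mbox p q (C : set 'M[R]_(p, q)) : @mx_boxes R p q C -> measurable C.
  by move=> [F mF <-]; exact: measurable_mx_box.
have mpre p q (W : {mfun T >-> 'M[R]_(p, q)}) C : measurable C -> measurable (W @^-1` C).
  by move=> mC; exact: measurable_funPTI.
have h1 C : @mx_boxes R k l C ->
    P ((U @^-1` A) `&` (V @^-1` C)) = (P (U @^-1` A) * P (V @^-1` C))%E.
  move=> bC; apply: mx_event_indep => //; first exact: (mpre _ _ _ _ (mbox _ _ _ bC)).
  by move=> D bD; exact: h.
have := @mx_event_indep _ _ V (U @^-1` A) (mpre _ _ _ _ mA).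
move=> /(_ _ B mB); rewrite setIC muleC; apply.
by move=> C bC; rewrite setIC muleC h1.
Qed.

Section fubini.
Context d1 d2 (T1 : measurableType d1) (T2 : measurableType d2).
Variables (U : {mfun T >-> T1}) (V : {mfun T >-> T2}).
Hypothesis UV : forall A B, measurable A -> measurable B ->
  P ((U @^-1` A) `&` (V @^-1` B)) = (P (U @^-1` A) * P (V @^-1` B))%E.

Lemma indep_fubini (f : T1 * T2 -> \bar R) :
  measurable_fun setT f -> (forall z, 0 <= f z)%E ->
  (\int[P]_w f (U w, V w) = \int[P]_w \int[P]_w' f (U w, V w'))%E.
Proof.
move=> mf f0.
pose W0 w := (U w, V w).
have mW : measurable_fun setT W0 by apply: measurable_fun_pair; exact: measurable_funP.
pose W : {mfun T >-> (T1 * T2)%type} := HB.pack W0 (isMeasurableFun.Build _ _ _ _ W0 mW).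
rewrite -[LHS](@ge0_integral_distribution _ _ _ _ _ P W f mf f0).
rewrite (eq_measure_integral (distribution P U \x distribution P V)%E); last first.
  by move=> A mA _; apply/esym; apply: product_measure_unique.
rewrite fubini_tonelli1// ge0_integral_distribution//.
- by apply: eq_integral => w _; rewrite /fubini_F/= ge0_integral_distribution//;
    exact: measurableT_comp.
- exact: measurable_fun_fubini_tonelli_F.
- by move=> x; apply: integral_ge0.
Qed.

Lemma indep_prob (E : T1 -> T2 -> Prop) :
  measurable [set z : T1 * T2 | E z.1 z.2] ->
  (P [set w | E (U w) (V w)] = \int[P]_w P [set w' | E (U w) (V w')])%E.
Proof.
move=> mE; set F := [set z : T1 * T2 | _] in mE.
have mI : measurable_fun setT (fun z => (\1_F z)%:E : \bar R).
  by apply/measurable_EFinP; exact: measurable_indic.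
have intE (g : T -> T1 * T2) : measurable_fun setT g ->
    (\int[P]_w (\1_F (g w))%:E = P (g @^-1` F))%E.
  move=> mg; transitivity (\int[P]_w (\1_(g @^-1` F) w)%:E)%E; first by [].
  by rewrite integral_indic ?setIT// -[_ @^-1` _]setTI; exact: mg.
have mU x : measurable_fun setT (fun w' => (x, V w') : T1 * T2).
  by apply: measurable_fun_pair => //; exact: measurable_funP.
have mW : measurable_fun setT (fun w' => (U w', V w') : T1 * T2).
  by apply: measurable_fun_pair => //; exact: measurable_funP.
transitivity (\int[P]_w (\1_F (U w, V w))%:E)%E; first by rewrite intE.
rewrite (@indep_fubini (fun z => (\1_F z)%:E)) => [|//|z]; last by rewrite lee_fin.
by apply: eq_integral => w _; rewrite intE.
Qed.

End fubini.

Section iid.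

Definition iid_normal (I : finType) (g : I -> T -> R) :=
  (forall i, measurable_fun setT (g i)) /\
  forall B : I -> set R, (forall i, measurable (B i)) ->
    P [set w | forall i, B i (g i w)] = (\prod_i normal_prob 0 1 (B i))%E.

Lemma iid_normal_inj (I J : finType) (g : I -> T -> R) (h : J -> I) :
  injective h -> iid_normal g -> iid_normal (fun j => g (h j)).
Proof.
move=> hI [mg gE]; split=> [j|B mB]; first exact: mg.
(* Indices outside the range of [h] are left unconstrained, and [setT] contributes the factor 1. *)
pose B' i := if [pick j | h j == i] is Some j then B j else setT.
have B'h j : B' (h j) = B j.
  rewrite /B'; case: pickP => [k /eqP/hI ->//|/(_ j)]; by rewrite eqxx.
have mB' i : measurable (B' i) by rewrite /B'; case: pickP.
rewrite (_ : [set w | _] = [set w | forall i, B' i (g i w)]); last first.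
  apply/seteqP; split => w /= hw.
    by move=> i; rewrite /B'; case: pickP => // j /eqP <-.
  by move=> j; have := hw (h j); rewrite B'h.
rewrite gE// (bigID (fun i => i \in h @: J))/= [X in (_ * X)%E]big1.
  rewrite mule1 big_imset/=; last by move=> x y _ _; exact: hI.
  by apply: eq_big => [j|j _]; rewrite ?B'h.
move=> i /imsetP hi; rewrite /B'; case: pickP => [j /eqP ji|_].
  by case: hi; exists j.
by rewrite probability_setT.
Qed.

Lemma iid_normal_marginal (I : finType) (g : I -> T -> R) (i : I) (B : set R) :
  iid_normal g -> measurable B -> P [set w | B (g i w)] = normal_prob 0 1 B.
Proof.
move=> ig mB.
have := ig.2 (fun i' => if i' == i then B else setT).
rewrite (bigD1 i)//= eqxx big1 ?mule1; last first.
  by move=> k /negbTE ->; rewrite probability_setT.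
move=> <-; last by move=> k; case: ifP.
congr (P _); apply/seteqP; split => w /=; last by move=> /(_ i); rewrite eqxx.
by move=> Bw k; case: eqP => // ->.
Qed.

Definition mx_of (I : finType) (g : I -> T -> R) m n (h : 'I_m * 'I_n -> I) (w : T) :
  'M[R]_(m, n) := \matrix_(i, j) g (h (i, j)) w.

Lemma measurable_mx_of (I : finType) (g : I -> T -> R) m n (h : 'I_m * 'I_n -> I) :
  (forall i, measurable_fun setT (g i)) -> measurable_fun setT (mx_of g h).
Proof.
move=> mg; apply: measurable_mx => i j.
by under eq_fun do rewrite mxE; exact: mg.
Qed.

(** Disjoint injective index maps glue into one injection on the sum type, over which the product of
    marginals splits into the two block products. *)
Lemma iid_mx_indep (I : finType) (g : I -> T -> R) m n k l
    (h1 : 'I_m * 'I_n -> I) (h2 : 'I_k * 'I_l -> I) :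
  iid_normal g -> injective h1 -> injective h2 -> (forall x y, h1 x != h2 y) ->
  independent_matrices P (mx_of g h1) (mx_of g h2).
Proof.
move=> ig I1 I2 I12; have mg := ig.1.
pose U : {mfun T >-> 'M[R]_(m, n)} :=
  HB.pack (mx_of g h1) (isMeasurableFun.Build _ _ _ _ _ (measurable_mx_of h1 mg)).
pose V : {mfun T >-> 'M[R]_(k, l)} :=
  HB.pack (mx_of g h2) (isMeasurableFun.Build _ _ _ _ _ (measurable_mx_of h2 mg)).
apply: (@boxes_indep _ _ _ _ U V) => _ _ [B mB <-] [C mC <-].
pose h (x : 'I_m * 'I_n + 'I_k * 'I_l) := match x with inl x => h1 x | inr y => h2 y end.
have hI : injective h.
  move=> [x|x] [y|y] /= e; first by rewrite (I1 _ _ e).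
  - by have := I12 x y; rewrite e eqxx.
  - by have := I12 y x; rewrite e eqxx.
  - by rewrite (I2 _ _ e).
have [_ hE] := iid_normal_inj hI ig.
have [_ h1E] := iid_normal_inj I1 ig.
have [_ h2E] := iid_normal_inj I2 ig.
pose D x := match x with inl x => B x.1 x.2 | inr y => C y.1 y.2 end.
have mD x : measurable (D x) by case: x => -[? ?]; [exact: mB|exact: mC].
have := hE D mD; rewrite big_sumType/=.
rewrite -(h1E (fun x => B x.1 x.2)); last by move=> [? ?]; exact: mB.
rewrite -(h2E (fun x => C x.1 x.2)); last by move=> [? ?]; exact: mC.
move=> hP; transitivity (P [set w | forall x, D x (g (h x) w)]).
  congr (P _); apply/seteqP; split => w /=.
    by move=> [hB hC] [[i j]|[i j]] /=; [have := hB i j|have := hC i j]; rewrite mxE.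
  by move=> hw; split => i j; [have := hw (inl (i, j))|have := hw (inr (i, j))]; rewrite mxE.
rewrite hP; congr (P _ * P _)%E; apply/seteqP; split => w /= hw.
- by move=> i j; have := hw (i, j); rewrite mxE.
- by move=> [i j]; have := hw i j; rewrite mxE.
- by move=> i j; have := hw (i, j); rewrite mxE.
- by move=> [i j]; have := hw i j; rewrite mxE.
Qed.

End iid.

End independence.

(** * Linear forms and sums of squares of independent normals *)

Section linear_images.
Context {R : realType} {d : measure_display} {T : measurableType d}.
Variable P : probability T R.
Local Notation RB := (measurableTypeR R).

Lemma integral_law (X : T -> RB) (nu : {measure set RB -> \bar R}) (f : RB -> \bar R) :
  measurable_fun setT X ->
  (forall B, measurable B -> P [set w | B (X w)] = nu B) ->
  measurable_fun setT f -> (forall x, 0 <= f x)%E ->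
  (\int[P]_w f (X w) = \int[nu]_x f x)%E.
Proof.
move=> mX law mf f0.
pose Y : {mfun T >-> RB} := HB.pack X (isMeasurableFun.Build _ _ _ _ X mX).
rewrite -[LHS](@ge0_integral_distribution _ _ _ _ _ P Y f mf f0).
by apply: eq_measure_integral => B mB _; exact: law.
Qed.

Let mmx (I : finType) (g : I -> T -> R) m n (h : 'I_m * 'I_n -> I) :
  iid_normal P g -> {mfun T >-> 'M[R]_(m, n)}.
Proof.
move=> ig.
exact: (HB.pack (mx_of g h) (isMeasurableFun.Build _ _ _ _ _ (measurable_mx_of h ig.1))).
Defined.

Lemma mx_ofE (I : finType) (g : I -> T -> R) m n (h : 'I_m * 'I_n -> I) w i j :
  mx_of g h w i j = g (h (i, j)) w.
Proof. by rewrite mxE. Qed.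

Lemma iid_mx_prob (I : finType) (g : I -> T -> R) m n k l
    (h1 : 'I_m * 'I_n -> I) (h2 : 'I_k * 'I_l -> I)
    (E : 'M[R]_(m, n) -> 'M[R]_(k, l) -> Prop) :
  iid_normal P g -> injective h1 -> injective h2 -> (forall x y, h1 x != h2 y) ->
  measurable [set z : 'M[R]_(m, n) * 'M[R]_(k, l) | E z.1 z.2] ->
  (P [set w | E (mx_of g h1 w) (mx_of g h2 w)] =
   \int[P]_w P [set w' | E (mx_of g h1 w) (mx_of g h2 w')])%E.
Proof.
move=> ig I1 I2 I12 mE.
have UV := iid_mx_indep ig I1 I2 I12.
exact: (@indep_prob _ _ _ P _ _ _ _ (mmx h1 ig) (mmx h2 ig) UV E mE).
Qed.

(** Induction on n by freezing the first coordinate: the remaining sum is a scaled normal by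
    induction, and [normal_lin2] adds the two. The image form covers a = 0. *)
Lemma iid_lin n (g : 'I_n -> T -> R) (a : 'I_n -> R) (B : set RB) :
  iid_normal P g -> measurable B ->
  P [set w | B (\sum_j a j * g j w)] =
  normal_prob 0 1 [set z | B (Num.sqrt (\sum_j a j ^+ 2) * z)].
Proof.
elim: n g a B => [|n IH] g a B ig mB.
  rewrite (_ : mkset _ = [set _ : T | B 0]); last first.
    by apply/seteqP; split => w /=; rewrite big_ord0.
  rewrite (_ : [set z | B _] = [set _ : RB | B 0]); last first.
    by apply/seteqP; split => w /=; rewrite big_ord0 sqrtr0 mul0r.
  have [B0|B0] := pselect (B 0).
    have -> : [set _ : T | B 0] = setT by apply/seteqP; split.
    have -> : [set _ : RB | B 0] = setT by apply/seteqP; split.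
    by rewrite !probability_setT.
  have -> : [set _ : T | B 0] = set0 by apply/seteqP; split.
  have -> : [set _ : RB | B 0] = set0 by apply/seteqP; split.
  by rewrite !measure0.
pose h1 (x : 'I_1 * 'I_1) : 'I_n.+1 := ord0.
pose h2 (x : 'I_1 * 'I_n) : 'I_n.+1 := lift ord0 x.2.
have I1 : injective h1 by move=> [x1 x2] [y1 y2] _; rewrite !ord1.
have I2 : injective h2.
  by move=> [x1 x2] [y1 y2] /lift_inj /= ->; rewrite !ord1.
have I12 x y : h1 x != h2 y by rewrite /h1 /h2 neq_lift.
pose f (M : 'M[R]_(1, 1)) (N : 'M[R]_(1, n)) : RB :=
  a ord0 * M 0 0 + \sum_(j < n) a (lift ord0 j) * N 0 j.
have fE w w' : f (mx_of g h1 w) (mx_of g h2 w') =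
    a ord0 * g ord0 w + \sum_(j < n) a (lift ord0 j) * g (lift ord0 j) w'.
  by rewrite /f mx_ofE; congr (_ + _); apply: eq_bigr => j _; rewrite mx_ofE.
have mf : measurable_fun setT (fun z => f z.1 z.2).
  apply: measurable_funD.
    by apply: measurable_funM => //; apply: measurable_mxE; exact: measurable_fst.
  apply: measurable_sum => j; apply: measurable_funM => //.
  by apply: measurable_mxE; exact: measurable_snd.
have mE : measurable [set z | B (f z.1 z.2)].
  by rewrite -[mkset _]setTI; exact: mf.
have := iid_mx_prob (E := fun M N => B (f M N)) ig I1 I2 I12 mE.
rewrite (_ : mkset _ = [set w | B (\sum_j a j * g j w)]); last first.
  by apply/seteqP; split => w /=; rewrite fE big_ord_recl.
move=> ->.
pose c := Num.sqrt (\sum_(j < n) a (lift ord0 j) ^+ 2).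
have cE : c ^+ 2 = \sum_(j < n) a (lift ord0 j) ^+ 2.
  by rewrite sqr_sqrtr//; apply: sumr_ge0 => j _; exact: sqr_ge0.
transitivity (\int[P]_w normal_prob 0 1 [set z | B (a ord0 * g ord0 w + c * z)%R])%E.
  apply: eq_integral => w _.
  pose B' := [set y : RB | B (a ord0 * g ord0 w + y)].
  have mB' : measurable B'.
    rewrite /B' -[mkset _]setTI.
    have mg : measurable_fun setT (fun y : RB => a ord0 * g ord0 w + y : RB).
      exact: measurable_funD.
    exact: mg.
  have := IH (fun j => g (lift ord0 j)) (fun j => a (lift ord0 j)) B'
    (iid_normal_inj lift_inj ig) mB'.
  move=> e; rewrite -[RHS]e; congr (P _).
  by apply/seteqP; split => w' /=; rewrite fE.
rewrite (@integral_law (g ord0) (normal_prob 0 1)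
  (fun x => normal_prob 0 1 [set z | B (a ord0 * x + c * z)])).
- rewrite big_ord_recl -cE; exact: normal_lin2.
- exact: ig.1.
- by move=> C mC; exact: iid_normal_marginal.
- exact: measurable_normal_affine2.
- by move=> x; exact: measure_ge0.
Qed.

(** The rows are peeled off one at a time, each giving the square of a standard normal since [a] is
    a unit vector; this is the recursion that defines [chi2_prob]. *)
Lemma iid_chi2 m n (g : 'I_m * 'I_n -> T -> R) (a : 'I_n -> R) (B : set RB) :
  iid_normal P g -> \sum_j a j ^+ 2 = 1 -> measurable B ->
  P [set w | B (\sum_i (\sum_j a j * g (i, j) w) ^+ 2)] = chi2_prob m B.
Proof.
move=> + a1; elim: m g B => [|m IH] g B ig mB.
  rewrite /= diracE.
  have [B0|B0] := pselect (B 0).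
    rewrite mem_set// (_ : mkset _ = setT) ?probability_setT//.
    by apply/seteqP; split => // w _ /=; rewrite big_ord0.
  rewrite memNset// (_ : mkset _ = set0) ?measure0//.
  by apply/seteqP; split => // w /=; rewrite big_ord0.
pose h1 (x : 'I_1 * 'I_n) : 'I_m.+1 * 'I_n := (ord0, x.2).
pose h2 (x : 'I_m * 'I_n) : 'I_m.+1 * 'I_n := (lift ord0 x.1, x.2).
have I1 : injective h1 by move=> [x1 x2] [y1 y2] /= [] ->; rewrite !ord1.
have I2 : injective h2.
  move=> [x1 x2] [y1 y2] /eqP; rewrite xpair_eqE/= => /andP[/eqP/lift_inj-> /eqP->].
  by [].
have I12 x y : h1 x != h2 y by rewrite xpair_eqE negb_and neq_lift.
pose f (M : 'M[R]_(1, n)) (N : 'M[R]_(m, n)) : RB :=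
  (\sum_j a j * M 0 j) ^+ 2 + \sum_i (\sum_j a j * N i j) ^+ 2.
have fE w w' : f (mx_of g h1 w) (mx_of g h2 w') =
    (\sum_j a j * g (ord0, j) w) ^+ 2 +
    \sum_(i < m) (\sum_j a j * g (lift ord0 i, j) w') ^+ 2.
  rewrite /f; congr (_ ^+ 2 + _); last apply: eq_bigr => i _; last congr (_ ^+ 2);
  by apply: eq_bigr => j _; rewrite mx_ofE.
have mf : measurable_fun setT (fun z => f z.1 z.2).
  apply: measurable_funD.
    apply: measurable_funX; apply: measurable_sum => j; apply: measurable_funM => //.
    by apply: measurable_mxE; exact: measurable_fst.
  apply: measurable_sum => i; apply: measurable_funX; apply: measurable_sum => j.
  by apply: measurable_funM => //; apply: measurable_mxE; exact: measurable_snd.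
have mE : measurable [set z | B (f z.1 z.2)].
  by rewrite -[mkset _]setTI; exact: mf.
have := iid_mx_prob (E := fun M N => B (f M N)) ig I1 I2 I12 mE.
rewrite (_ : mkset _ =
    [set w | B (\sum_i (\sum_j a j * g (i, j) w) ^+ 2)]); last first.
  by apply/seteqP; split => w /=; rewrite fE big_ord_recl.
move=> ->.
pose X w : RB := \sum_j a j * g (ord0, j) w.
have mX : measurable_fun setT X.
  apply: measurable_sum => j; apply: measurable_funM => //; exact: ig.1.
pose F (x : RB) : \bar R := chi2_prob m [set y : RB | B (x ^+ 2 + y)].
have mBx x : measurable [set y : RB | B (x ^+ 2 + y)].
  rewrite -[mkset _]setTI.
  have mg : measurable_fun setT (fun y : RB => x ^+ 2 + y : RB).
    exact: measurable_funD.
  exact: mg.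
have mF : measurable_fun setT F.
  have mS : measurable [set z : RB * RB | B (sqr_add z)].
    by rewrite -[mkset _]setTI; exact: measurable_sqr_add.
  have := @measurable_fun_xsection _ _ RB RB R (chi2_prob m) _ mS.
  apply: eq_measurable_fun => x _ /=; congr (chi2_prob m _).
  by apply/seteqP; split => y /=; rewrite /xsection/= inE.
transitivity (\int[P]_w F (X w))%E.
  apply: eq_integral => w _.
  have := IH _ _ (iid_normal_inj (I2) ig) (mBx (X w)).
  move=> e; rewrite /F -[RHS]e; congr (P _).
  by apply/seteqP; split => w' /=; rewrite fE.
rewrite (@integral_law X (normal_prob 0 1) F)//.
- transitivity (\int[chi2_prob m.+1]_x (\1_B x)%:E)%E; last first.
    by rewrite integral_indic// setIT.
  rewrite ge0_integral_chi2S//; last first.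
    by apply/measurable_EFinP; exact: measurable_indic.
  apply: eq_integral => x _.
  transitivity (\int[chi2_prob m]_y (\1_[set y : RB | B (x ^+ 2 + y)] y)%:E)%E => //.
  by rewrite integral_indic// setIT.
- move=> C mC.
  have I0 : injective (fun j : 'I_n => (@ord0 m, j)) by move=> i j [].
  have := iid_lin a (iid_normal_inj I0 ig) mC.
  move=> /= ->; rewrite a1 sqrtr1; congr (normal_prob 0 1 _).
  by apply/seteqP; split => z /=; rewrite mul1r.
Qed.

End linear_images.

(** * From the linear model to one array of independent normals *)

Section model.
Context {R : realType} {d : measure_display} {T : measurableType d}.
Variable P : probability T R.
Local Notation RB := (measurableTypeR R).

(** Induction on rows: when the earlier rows are s times unit vectors, orthogonality to them kills
    the entries left of the diagonal, and the row length then fixes the positive diagonal entry.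
    This identifies the factor that [normal_vector] only asserts to exist. *)
Lemma cholesky_scalar n (s : R) (L : 'M[R]_n) : 0 < s ->
  is_trig_mx L -> (forall i, 0 < L i i) -> L *m L^T = (s ^+ 2)%:M -> L = s%:M.
Proof.
move=> s0 /is_trig_mxP tL dL LL.
have LLE i j : \sum_k L i k * L j k = s ^+ 2 *+ (i == j).
  have := congr1 (fun M : 'M[R]_n => M i j) LL; rewrite !mxE => <-.
  by apply: eq_bigr => k _; rewrite mxE.
suff rowE k : forall i : 'I_n, (i < k)%N -> forall j, L i j = s *+ (i == j).
  by apply/matrixP => i j; rewrite mxE (rowE i.+1).
elim: k => [//|k IH] i; rewrite ltnS leq_eqVlt => /predU1P[ik|/IH//].
have off (j : 'I_n) : j != i -> L i j = 0.
  have [ij|ji _|ij] := ltgtP i j; first by rewrite (tL _ _ ij).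
    have := LLE i j; rewrite -val_eqE/= gtn_eqF// mulr0n (bigD1 j)//= big1.
      rewrite addr0 (IH j) -?ik// eqxx mulr1n => /eqP.
      by rewrite mulf_eq0 (gt_eqF s0) orbF => /eqP.
    by move=> l lj; rewrite (IH j) -?ik// eq_sym (negbTE lj) mulr0.
  by [].

move=> j; have [<-|ij] := eqVneq i j; last by rewrite mulr0n off// eq_sym.
have := LLE i i; rewrite eqxx mulr1n (bigD1 i)//= big1 ?addr0; last first.
  by move=> l li; rewrite off// mulr0.
move=> /eqP; rewrite -expr2 eqrXn2 ?ltW//; first by move=> /eqP.
Qed.

Lemma normal_vector_scalar n (s : R) (V : T -> 'cV[R]_n) : 0 < s ->
  normal_vector P (s ^+ 2)%:M V -> std_normal_vector P (fun w => s^-1 *: V w).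
Proof.
move=> s0 [L [tL dL LL]]; rewrite (cholesky_scalar s0 tL dL LL).
congr (std_normal_vector P); apply/funext => w.
by rewrite invmx_scalar mul_scalar_mx.
Qed.

(** Column 0 is the standardised noise and the other columns are the design. The residual at an
    estimate b is then, row by row, a linear form with coefficients (sigma0, beta - b). *)
Definition data_entry n p (theta : param R p) (X : T -> 'M[R]_(n, p))
    (y : T -> 'cV[R]_n) (ik : 'I_n * 'I_p.+1) (w : T) : R :=
  if unlift ord0 ik.2 is Some j then X w ik.1 j
  else (noise_sd theta)^-1 * (y w - X w *m coef theta) ik.1 0.

Lemma measurable_mxM dd (S : measurableType dd) m n p (A : S -> 'M[R]_(m, n))
    (B : S -> 'M[R]_(n, p)) :
  measurable_fun setT A -> measurable_fun setT B ->
  measurable_fun setT (fun w => A w *m B w).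
Proof.
move=> mA mB; apply: measurable_mx => i j; under eq_fun do rewrite mxE.
by apply: measurable_sum => k; apply: measurable_funM; exact: measurable_mxE.
Qed.

Lemma measurable_mxB dd (S : measurableType dd) m n (A B : S -> 'M[R]_(m, n)) :
  measurable_fun setT A -> measurable_fun setT B ->
  measurable_fun setT (fun w => A w - B w).
Proof.
move=> mA mB; apply: measurable_mx => i j; under eq_fun do rewrite !mxE.
by apply: measurable_funB; exact: measurable_mxE.
Qed.

Lemma data_entry_iid n p (sigma0 : R) k (theta : param R p)
    (X : {mfun T >-> 'M[R]_(n, p)}) (y : {mfun T >-> 'cV[R]_n}) :
  0 < sigma0 -> Theta0 sigma0 k theta -> linear_model P theta X y ->
  iid_normal P (data_entry theta X y).
Proof.
move=> s0 [_ cov sd] [rowsI rowsN noiseN XeI].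
have mX : measurable_fun setT X by exact: measurable_funP.
have my : measurable_fun setT y by exact: measurable_funP.
have me : measurable_fun setT (fun w => y w - X w *m coef theta).
  by apply: measurable_mxB => //; exact: measurable_mxM.
split=> [[i k0]|B mB].
  rewrite /data_entry/=; case: (unlift ord0 k0) => [j|]; first exact: measurable_mxE.
  by apply: measurable_funM => //; exact: measurable_mxE.
pose C (i : 'I_n) := [set r : 'rV[R]_p | forall j, B (i, lift ord0 j) (r 0 j)].
have mC i : measurable (C i).
  rewrite (_ : C i = [set M | forall i' j, B (i, lift ord0 j) (M i' j)]); last first.
    by apply/seteqP; split => M h; [move=> i'; rewrite ord1|move=> j]; exact: h.
  exact: (@measurable_mx_box R 1 p (fun _ j => B (i, lift ord0 j))).
pose CX := [set M : 'M[R]_(n, p) | forall i, C i (row i M)].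
pose Ce := [set e : 'cV[R]_n | forall i, B (i, ord0) ((noise_sd theta)^-1 * e i 0)].
have mCX : measurable CX.
  rewrite (_ : CX = [set M | forall i j, B (i, lift ord0 j) (M i j)]); last first.
    by apply/seteqP; split => M h i j; have := h i j; rewrite mxE.
  exact: (@measurable_mx_box R n p (fun i j => B (i, lift ord0 j))).
have mCe : measurable Ce.
  rewrite (_ : Ce = [set M | forall i j, [set x | B (i, ord0)
      ((noise_sd theta)^-1 * x)] (M i j)]); last first.
    by apply/seteqP; split => M h i; [move=> j; rewrite ord1|]; exact: h.
  apply: (@measurable_mx_box R n 1
    (fun i _ => [set x | B (i, ord0) ((noise_sd theta)^-1 * x)])) => i _; rewrite -[mkset _]setTI.
  have mg : measurable_fun setT (fun x : RB => (noise_sd theta)^-1 * x : RB).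
    exact: measurable_funM.
  exact: (mg measurableT _ (mB (i, ord0))).
transitivity (P [set w | CX (X w) /\ Ce (y w - X w *m coef theta)]).
  congr (P _); apply/seteqP; split => w /=.
    move=> h; split=> i.
      by move=> j; have := h (i, lift ord0 j); rewrite /data_entry/= liftK mxE.
    by have := h (i, ord0); rewrite /data_entry/= unlift_none.
  move=> [hX he] [i k0]; rewrite /data_entry/=.
  case: unliftP => [j ->|->]; last exact: he.
  by have := hX i j; rewrite mxE.
rewrite XeI// [P [set w | CX _]](rowsI C mC).
have -> : (\prod_i normal_prob 0 1 (B i) =
    \prod_i (normal_prob 0 1 (B (i, ord0)) *
             \prod_j normal_prob 0 1 (B (i, lift ord0 j))))%E.
  rewrite (eq_bigr (fun x => normal_prob 0 1 (B (x.1, x.2)))); last by move=> [].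
  rewrite -(pair_bigA _ (fun i k => normal_prob 0 1 (B (i, k))))/=.
  by apply: eq_bigr => i _; rewrite big_ord_recl.
rewrite big_split/= muleC; congr (_ * _)%E.
  rewrite sd in noiseN.
  have [_ nE] := normal_vector_scalar s0 noiseN.
  rewrite -(nE (fun i => B (i, ord0)))//; congr (P _).
  by apply/seteqP; split => w /= h i; have := h i; rewrite sd !mxE.
apply: eq_bigr => i _.
have : normal_vector P (1 ^+ 2)%:M (fun w => (row i (X w))^T).
  by rewrite expr1n -cov; exact: rowsN.
move=> /(normal_vector_scalar ltr01)[_ nE]; rewrite -(nE (fun j => B (i, lift ord0 j)))//; congr (P _).
by apply/seteqP; split => w /= h j; have := h j; rewrite !mxE invr1 mul1r.
Qed.

End model.

(** * Maurey approximation and restricted eigenvalues *)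

Section deterministic.
Context {R : realType}.

Definition sqnorm n (v : 'cV[R]_n) : R := \sum_i v i 0 ^+ 2.
Definition l1norm n (v : 'cV[R]_n) : R := \sum_i `|v i 0|.

Lemma sqnorm_ge0 n (v : 'cV[R]_n) : 0 <= sqnorm v.
Proof. by apply: sumr_ge0 => i _; exact: sqr_ge0. Qed.

Lemma l1norm_ge0 n (v : 'cV[R]_n) : 0 <= l1norm v.
Proof. exact: sumr_ge0. Qed.

Lemma l2norm_sqr n (v : 'cV[R]_n) : l2norm v ^+ 2 = sqnorm v.
Proof. by rewrite sqr_sqrtr// sqnorm_ge0. Qed.

Lemma sqnormZ n (a : R) (v : 'cV[R]_n) : sqnorm (a *: v) = a ^+ 2 * sqnorm v.
Proof. by rewrite mulr_sumr; apply: eq_bigr => i _; rewrite mxE exprMn. Qed.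

Lemma sqnorm_ge_half n (u v : 'cV[R]_n) :
  sqnorm v / 2 - sqnorm (u - v) <= sqnorm u.
Proof.
rewrite lerBlDr mulr_suml -big_split/=; apply: ler_sum => i _; rewrite !mxE.
set x := u i 0; set y := v i 0.
have := sqr_ge0 (2 * x - y); nra.
Qed.

Lemma sqnorm_col_mx m n (u : 'cV[R]_m) (v : 'cV[R]_n) :
  sqnorm (col_mx u v) = sqnorm u + sqnorm v.
Proof.
rewrite /sqnorm big_split_ord/=; congr (_ + _); apply: eq_bigr => i _.
  by rewrite col_mxEu.
by rewrite col_mxEd.
Qed.

Section maurey.
Variables (N p : nat) (w : 'I_p -> R) (z : 'I_p -> 'cV[R]_N) (B : R).
Hypotheses (w_ge0 : forall j, 0 <= w j) (w1 : \sum_j w j = 1).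
Hypothesis zB : forall j, sqnorm (z j) <= B.

(* Averaging [|D + z j - v|^2] over the weights [w] gives
   [|D|^2 + sum_j w j |z j|^2 - |v|^2]. *)
Lemma maurey_step (D : 'cV[R]_N) (v := \sum_j w j *: z j) :
  exists j, sqnorm (D + (z j - v)) <= sqnorm D + B.
Proof.
apply/not_existsP => h.
have {}h j : sqnorm D + B < sqnorm (D + (z j - v)).
  by rewrite ltNge; apply/negP; exact: h.
have vE k : v k 0 = \sum_j w j * z j k 0.
  by rewrite summxE; apply: eq_bigr => j _; rewrite mxE.
have E : \sum_j w j * sqnorm (D + (z j - v)) =
    sqnorm D + \sum_j w j * sqnorm (z j) - sqnorm v.
  have swap (f : 'I_p -> 'I_N -> R) :
      \sum_j w j * \sum_k f j k = \sum_k \sum_j w j * f j k.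
    by under eq_bigr do rewrite mulr_sumr; rewrite exchange_big.
  rewrite /sqnorm !swap -big_split/= -sumrB.
  apply: eq_bigr => k _.
  transitivity (\sum_j (w j * (D k 0 - v k 0) ^+ 2 +
      (2 * (D k 0 - v k 0)) * (w j * z j k 0) + w j * z j k 0 ^+ 2)).
    by apply: eq_bigr => j _; rewrite !mxE; ring.
  rewrite !big_split/= -mulr_suml w1 -mulr_sumr -vE; ring.
have lt : \sum_j w j * (sqnorm D + B) < \sum_j w j * sqnorm (D + (z j - v)).
  have [j wj] : exists j, 0 < w j.
    apply/not_existsP => h0; have := w1; rewrite big1 => [/esym/eqP|j _].
      by rewrite oner_eq0.
    by apply/eqP; rewrite eq_le w_ge0 andbT leNgt; apply/negP; exact: h0.
  rewrite (bigD1 j)//= [ltRHS](bigD1 j)//=.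
  rewrite ltr_leD ?ltr_pM2l//; apply: ler_sum => l _.
  by rewrite ler_wpM2l// ltW.
move: lt; rewrite E -mulr_suml w1 mul1r.
have : \sum_j w j * sqnorm (z j) <= B.
  rewrite -[leRHS]mul1r -w1 mulr_suml; apply: ler_sum => j _.
  by rewrite ler_wpM2l.
have := sqnorm_ge0 v; lra.
Qed.

(** Greedy form of the averaging argument: each new index adds at most [B] to the squared error,
    while the squared target grows like m^2, so the relative squared error is of order 1 / m. *)
Lemma maurey m : exists J : m.-tuple 'I_p,
  sqnorm (\sum_(j <- J) z j - m%:R *: \sum_j w j *: z j) <= m%:R * B.
Proof.
elim: m => [|m [J IH]].
  exists [tuple]; rewrite big_nil scale0r subrr mul0r /sqnorm big1// => i _.
  by rewrite mxE expr0n.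
have [j hj] := maurey_step (\sum_(j <- J) z j - m%:R *: \sum_j w j *: z j).
exists [tuple of j :: J]; rewrite /= big_cons.
have -> : z j + \sum_(i <- J) z i - m.+1%:R *: \sum_i w i *: z i =
   \sum_(j <- J) z j - m%:R *: (\sum_j w j *: z j) + (z j - \sum_i w i *: z i).
  rewrite -natr1 scalerDl scale1r opprD !addrA; congr (_ - _).
  by rewrite -addrA addrC.
by apply: (le_trans hj); rewrite -natr1 mulrDl mul1r lerD2r.
Qed.

End maurey.

Definition signed_sum m p (t : m.-tuple (bool * 'I_p)) : 'cV[R]_p :=
  \sum_(x <- t) (-1) ^+ x.1 *: delta_mx x.2 0.

Lemma sqnorm_delta p (j : 'I_p) : sqnorm (delta_mx j 0 : 'cV[R]_p) = 1.
Proof.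
rewrite /sqnorm (bigD1 j)//= mxE !eqxx expr1n big1 ?addr0// => i ij.
by rewrite mxE (negbTE ij) expr0n.
Qed.

(* Maurey's lemma is applied to the columns of [X / sqrt n] stacked over the
   identity, so that one integer vector approximates [v] both in the Euclidean
   norm and in the prediction norm. *)
Lemma restricted_eigenvalue n p (X : 'M[R]_(n, p)) m (H : R) (v : 'cV[R]_p) :
  (0 < n)%N -> 0 < H ->
  (forall j, sqnorm (col j X) <= 2 * n%:R) ->
  (forall t : m.-tuple (bool * 'I_p),
    n%:R / 2 * sqnorm (signed_sum t) <= sqnorm (X *m signed_sum t)) ->
  60 * H <= m%:R -> l1norm v ^+ 2 <= H * sqnorm v ->
  n%:R * sqnorm v <= 16 * sqnorm (X *m v).
Proof.
move=> n0 H0 hcol ht Hm hv; set a := l1norm v in hv.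
have n0' : 0 < n%:R :> R by rewrite ltr0n.
have m0 : 0 < m%:R :> R by apply: lt_le_trans Hm; lra.
have [v0|v0] := eqVneq a 0.
  suff -> : v = 0 by rewrite mulmx0 /sqnorm !big1 ?mulr0// => i _; rewrite mxE expr0n.
  apply/matrixP => i j; rewrite ord1 mxE; apply/eqP; rewrite -normr_eq0.
  move: v0 => /eqP; rewrite psumr_eq0// => /allP /(_ i); rewrite mem_index_enum.
  by move=> /(_ isT).
have a0 : 0 < a by rewrite lt_neqAle eq_sym v0 l1norm_ge0.
pose M : 'M[R]_(n + p, p) := col_mx ((Num.sqrt n%:R)^-1 *: X) 1%:M.
have ME u : sqnorm (M *m u) = sqnorm (X *m u) / n%:R + sqnorm u.
  rewrite mul_col_mx sqnorm_col_mx mul1mx -scalemxAl sqnormZ exprVn sqr_sqrtr//.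
  by rewrite mulrC.
pose w j := `|v j 0| / a.
pose s j := (-1) ^+ (v j 0 < 0)%R : R.
pose e j : 'cV[R]_p := s j *: delta_mx j 0.
have w_ge0 j : 0 <= w j by rewrite divr_ge0// ltW.
have w1 : \sum_j w j = 1 by rewrite -mulr_suml divff.
have s2 j : s j ^+ 2 = 1 by rewrite -exprM mulnC exprM sqrrN !expr1n.
(* The column of X / sqrt n contributes at most 2 and the identity block 1. *)
have zB j : sqnorm (M *m e j) <= 3.
  rewrite ME -scalemxAr !sqnormZ s2 !mul1r sqnorm_delta.
  rewrite -colE; have := hcol j; rewrite -ler_pdivrMr// => ?; lra.
have [J hJ] := maurey w_ge0 w1 zB m.
pose t : m.-tuple (bool * 'I_p) := [tuple of [seq ((v j 0 < 0)%R, j) | j <- J]].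
have utE : \sum_(j <- J) M *m e j = M *m signed_sum t.
  by rewrite /signed_sum big_map mulmx_sumr.
have vE : \sum_j w j *: (M *m e j) = M *m (a^-1 *: v).
  rewrite (_ : a^-1 *: v = \sum_j w j *: e j).
    by rewrite mulmx_sumr; apply: eq_bigr => j _; rewrite scalemxAr.
  apply/matrixP => i j; rewrite ord1 mxE summxE (bigD1 i)//= big1.
    rewrite addr0 !mxE !eqxx/= mulr1 /w /s -[v i 0 in LHS]mulr_sign_norm.
    by rewrite mulrCA mulrC [a^-1 * _]mulrC.
  by move=> k ki; rewrite !mxE eq_sym (negbTE ki) !mulr0.
move: hJ; rewrite utE vE scalemxAr scalerA -mulmxBr ME.
set u := signed_sum t; set c := m%:R / a => hJ.
have hu := ht t; rewrite -/u in hu.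
have c0 : 0 < c by rewrite divr_gt0.
have h1 := sqnorm_ge_half u (c *: v).
have h2 := sqnorm_ge_half (X *m (c *: v)) (X *m u).
have h3 : sqnorm (X *m (c *: v) - X *m u) = sqnorm (X *m (u - c *: v)).
  by rewrite -mulmxBr -opprB mulmxN -scaleN1r sqnormZ sqrrN expr1n mul1r.
rewrite h3 -scalemxAr sqnormZ in h2; rewrite sqnormZ in h1.
(* Since m >= 60 H, the signal c^2 |v|^2 is at least 20 times the Maurey error 3 m. *)
have h4 : 20 * (3 * m%:R) <= c ^+ 2 * sqnorm v.
  have -> : c ^+ 2 * sqnorm v = m%:R ^+ 2 * sqnorm v / a ^+ 2 by rewrite /c; field.
  rewrite ler_pdivlMr ?exprn_gt0//.
  have e1 : 60 * H * sqnorm v <= m%:R * sqnorm v by rewrite ler_wpM2r ?sqnorm_ge0.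
  have e2 : m%:R * (60 * a ^+ 2) <= m%:R * (m%:R * sqnorm v) by rewrite ler_pM2l//; lra.
  lra.
set xv := sqnorm (X *m v) in h2 *; set sv := sqnorm v in h1 h4 *.
set xu := sqnorm (X *m u) in hu h2; set su := sqnorm u in hu h1.
set xd := sqnorm (X *m (u - c *: v)) in hJ h2; set sd := sqnorm (u - c *: v) in hJ h1.
have hJ' : xd + n%:R * sd <= n%:R * (m%:R * 3).
  by rewrite -ler_pdivrMl// mulrDr mulKf ?gt_eqF// mulrC.
have xd0 : 0 <= xd := sqnorm_ge0 _; have sd0 : 0 <= sd := sqnorm_ge0 _.
have c2 : 0 < c ^+ 2 by rewrite exprn_gt0.
rewrite -(ler_pM2l c2).
have h5 : n%:R * (c ^+ 2 * sv / 2 - sd) <= n%:R * su by rewrite ler_pM2l.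
have h6 : n%:R * (20 * (3 * m%:R)) <= n%:R * (c ^+ 2 * sv) by rewrite ler_pM2l.
have nsd : 0 <= n%:R * sd by rewrite mulr_ge0// ltW.
have q : n%:R * (c ^+ 2 * sv) = c ^+ 2 * (n%:R * sv) by ring.
(* Two uses of [sqnorm_ge_half] and the factor 1/2 for integer vectors leave 1/8 of n c^2 |v|^2; the
   approximation errors cost at most 1/20 of it, and 1/8 - 1/20 exceeds 1/16. *)
rewrite -q; nra.
Qed.

End deterministic.

(** * Deterministic analysis of the Lasso *)

Section lasso.
Context {R : realType}.

Lemma ln_nat_ge0 p : 0 <= ln (p%:R : R).
Proof. by case: p => [|p]; [rewrite ln0|rewrite ln_ge0// ler1n]. Qed.

Section basic.
Variables (n p : nat) (sigma0 A tau : R) (X : 'M[R]_(n, p)) (e : 'cV[R]_n).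
Variables (beta b : 'cV[R]_p).
Hypotheses (n0 : (0 < n)%N) (A0 : 0 < A).
Let y := X *m beta + e.
Hypothesis b_min : lasso_objective sigma0 A (X, y) b <= lasso_objective sigma0 A (X, y) beta.
Hypothesis noise : forall j, `|\sum_i X i j * e i 0| <=
  tau * sigma0 * Num.sqrt (ln p%:R) * l2norm (col j X).
Let v := b - beta.
Let d j := l2norm (col j X) / Num.sqrt n%:R.
Let lam := lasso_penalty sigma0 n p A.
(** The fraction of the penalty used up in dominating the noise. *)
Let rho := 2 * tau / A.
Let Xe j := \sum_i X i j * e i 0.

Let n_gt0 : 0 < n%:R :> R. Proof. by rewrite ltr0n. Qed.

Let sqnorm_residual : sqnorm (e - X *m v) =
  sqnorm e - 2 * (\sum_j v j 0 * Xe j) + sqnorm (X *m v).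
Proof.
have -> : \sum_j v j 0 * Xe j = \sum_i e i 0 * (X *m v) i 0.
  transitivity (\sum_j \sum_i v j 0 * (X i j * e i 0)).
    by apply: eq_bigr => j _; rewrite mulr_sumr.
  rewrite exchange_big/=; apply: eq_bigr => i _; rewrite mxE mulr_sumr.
  by apply: eq_bigr => j _; ring.
rewrite mulr_sumr -sumrB -big_split/=; apply: eq_bigr => i _.
by rewrite !mxE; ring.
Qed.

Let noise_lam j : 2 * `|Xe j| / n%:R <= rho * (lam * d j).
Proof.
have := noise j; rewrite -/(Xe j) => h.
rewrite ler_pdivrMr// (le_trans (ler_wpM2l _ h))//.
rewrite /rho /lam /lasso_penalty /d le_eqVlt; apply/orP; left; apply/eqP.
have sn : Num.sqrt (n%:R : R) ^+ 2 = n%:R by rewrite sqr_sqrtr// ltW.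
have sn0 : Num.sqrt (n%:R : R) != 0 by rewrite gt_eqF// sqrtr_gt0.
rewrite sqrtrM ?ln_nat_ge0// sqrtrV ?(ltW n_gt0)//.
by rewrite -[X in _ = _ * X]sn; field; rewrite sn0 gt_eqF.
Qed.

(** Optimality against [beta], with the cross term between noise and error absorbed column by column
    into the penalty weights. *)
Lemma lasso_basic :
  sqnorm (X *m v) / n%:R + lam * \sum_j d j * `|b j 0| <=
  rho * (lam * \sum_j d j * `|v j 0|) + lam * \sum_j d j * `|beta j 0|.
Proof.
move: b_min; rewrite /lasso_objective/= !l2norm_sqr.
have -> : y - X *m b = e - X *m v.
  by rewrite /y /v mulmxBr opprB addrCA addrA [X in X - _]addrC.
have -> : y - X *m beta = e by rewrite /y addrAC subrr add0r.
rewrite sqnorm_residual -/lam.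
have : (2 * \sum_j v j 0 * Xe j) / n%:R <= rho * (lam * \sum_j d j * `|v j 0|).
  rewrite !mulr_sumr mulr_suml; apply: ler_sum => j _.
  apply: (@le_trans _ _ (`|v j 0| * (2 * `|Xe j| / n%:R))).
    apply: (le_trans (ler_norm _)); rewrite !normrM ger0_norm// [`|n%:R^-1|]ger0_norm ?invr_ge0//.
    by rewrite le_eqVlt; apply/orP; left; apply/eqP; ring.
  apply: (le_trans (ler_wpM2l (normr_ge0 _) (noise_lam j))).
  by rewrite le_eqVlt; apply/orP; left; apply/eqP; ring.
rewrite -/d; set a := \sum_j v j 0 * Xe j; set s1 := \sum_j _; set s2 := \sum_j _.
set s3 := \sum_j _ ; move=> h1; rewrite !mulrDl mulNr => h2; lra.
Qed.

(** Off the support of [beta] the error is [b] itself, so a share 1 - rho of its penalty survives on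
    the left; on the support the triangle inequality costs 1 + rho. *)
Lemma lasso_ineq : 0 <= lam -> (forall j, 0 <= d j) ->
  sqnorm (X *m v) / n%:R +
    lam * (1 - rho) * \sum_(j | beta j 0 == 0) d j * `|v j 0| <=
  lam * (1 + rho) * \sum_(j | beta j 0 != 0) d j * `|v j 0|.
Proof.
move=> lam0 d0; have := lasso_basic.
have split_sum (F : 'I_p -> R) : \sum_j F j =
    \sum_(j | beta j 0 == 0) F j + \sum_(j | beta j 0 != 0) F j.
  exact: bigID.
rewrite (split_sum (fun j => d j * `|b j 0|)) (split_sum (fun j => d j * `|v j 0|)).
rewrite (split_sum (fun j => d j * `|beta j 0|)).
have -> : \sum_(j | beta j 0 == 0) d j * `|beta j 0| = 0.
  by apply: big1 => j /eqP->; rewrite normr0 mulr0.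
have -> : \sum_(j | beta j 0 == 0) d j * `|b j 0| =
    \sum_(j | beta j 0 == 0) d j * `|v j 0|.
  by apply: eq_bigr => j /eqP bj; rewrite /v !mxE bj subr0.
set s0' := \sum_(j | beta j 0 == 0) _.
set sb := \sum_(j | _) _; set sv := \sum_(j | _) d j * `|v j 0|; set sB := \sum_(j | _) _.
rewrite add0r.
have : sB - sb <= sv.
  rewrite -sumrB; apply: ler_sum => j _; rewrite -mulrBr ler_wpM2l//.
  by rewrite /v !mxE distrC lerB_dist.
move=> h; have := ler_wpM2l lam0 h; lra.
Qed.

End basic.

Section cone.
Variables (n p : nat) (sigma0 A tau delta : R) (X : 'M[R]_(n, p)) (e : 'cV[R]_n).
Variables (beta b : 'cV[R]_p).
Hypotheses (n0 : (0 < n)%N) (p1 : (1 < p)%N) (s0 : 0 < sigma0) (A0 : 0 < A).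
Hypothesis b_min : lasso_objective sigma0 A (X, X *m beta + e) b <=
  lasso_objective sigma0 A (X, X *m beta + e) beta.
Hypothesis noise : forall j, `|\sum_i X i j * e i 0| <=
  tau * sigma0 * Num.sqrt (ln p%:R) * l2norm (col j X).
Hypotheses (tau_ge0 : 0 <= tau) (tauA : 2 * tau < A).
Let v := b - beta.
Let d j := l2norm (col j X) / Num.sqrt n%:R.
Let lam := lasso_penalty sigma0 n p A.
Let rho := 2 * tau / A.

Let n_gt0 : 0 < n%:R :> R. Proof. by rewrite ltr0n. Qed.

Let lnp_gt0 : 0 < ln (p%:R : R). Proof. by rewrite ln_gt0// ltr1n. Qed.

Let lam_gt0 : 0 < lam.
Proof. by rewrite !mulr_gt0// sqrtr_gt0 divr_gt0. Qed.

Let d_ge0 j : 0 <= d j.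
Proof. by rewrite divr_ge0 ?sqrtr_ge0. Qed.

Let rho_ge0 : 0 <= rho. Proof. by rewrite divr_ge0 ?mulr_ge0// ltW. Qed.

Let rho_lt1 : rho < 1. Proof. by rewrite ltr_pdivrMr// mul1r. Qed.

Let ineq := lasso_ineq n0 A0 b_min noise (ltW lam_gt0) d_ge0.

(** With an empty support the right side of [lasso_ineq] vanishes, which forces every weighted
    coordinate of the error to be 0. Asking only for nonzero columns keeps this usable when ln p / n
    is unbounded. *)
Lemma lasso_null : l0norm beta = 0%N -> (forall j, 0 < sqnorm (col j X)) -> v = 0.
Proof.
move=> /card0_eq beta0 hcol.
have b0 j : beta j 0 == 0 by have := beta0 j; rewrite !inE => /negbFE.
have d0 j : 0 < d j by rewrite divr_gt0 ?sqrtr_gt0// -/(sqnorm _).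
have := ineq; rewrite -/d -/lam -/rho -/v.
rewrite [X in _ <= _ * X]big1 ?mulr0; last by move=> j; rewrite b0.
rewrite (eq_bigl xpredT)//.
have xv : 0 <= sqnorm (X *m v) / n%:R by rewrite divr_ge0 ?sqnorm_ge0// ltW.
have c0 : 0 < lam * (1 - rho) by rewrite mulr_gt0// subr_gt0.
have S0 : 0 <= \sum_j d j * `|v j 0| by apply: sumr_ge0 => j _; rewrite mulr_ge0.
move=> h; have : \sum_j d j * `|v j 0| == 0.
  rewrite eq_le S0 andbT -(pmulr_rle0 _ c0); lra.
rewrite psumr_eq0; last by move=> j _; rewrite mulr_ge0.
move=> /allP h0; apply/matrixP => j i; rewrite ord1 [RHS]mxE; apply/eqP.
have := h0 j; rewrite mem_index_enum => /(_ isT) /=.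
by rewrite mulf_eq0 gt_eqF//= normr_eq0.
Qed.

Hypotheses (delta_ge0 : 0 <= delta) (delta1 : delta < 1).
Hypothesis cols : forall j,
  (1 - delta) * n%:R <= sqnorm (col j X) <= (1 + delta) * n%:R.

Let d_bounds j : 1 - delta <= d j <= 1 + delta.
Proof.
have /andP[h1 h2] := cols j.
have dE : d j ^+ 2 = sqnorm (col j X) / n%:R.
  by rewrite expr_div_n l2norm_sqr sqr_sqrtr// ltW.
have l1 : 1 - delta <= d j ^+ 2 by rewrite dE ler_pdivlMr.
have l2 : d j ^+ 2 <= 1 + delta by rewrite dE ler_pdivrMr.
have := d_ge0 j; move: delta_ge0 delta1 => ? ? ?; apply/andP; split.
  by rewrite leNgt; apply/negP => ?; nra.
by rewrite leNgt; apply/negP => ?; nra.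
Qed.

Variables (k : nat).
Hypothesis sparse : (l0norm beta <= k)%N.

Let vS := \sum_(j | beta j 0 != 0) `|v j 0|.

Let vS_ge0 : 0 <= vS. Proof. exact: sumr_ge0. Qed.

Let vS_sqr : vS ^+ 2 <= k%:R * sqnorm v.
Proof.
pose s : R := (l0norm beta)%:R.
pose q := \sum_(j | beta j 0 != 0) v j 0 ^+ 2.
have q0 : 0 <= q by apply: sumr_ge0 => j _; exact: sqr_ge0.
have qv : q <= sqnorm v.
  rewrite /sqnorm [leRHS](bigID (fun j => beta j 0 != 0))/= lerDl.
  by apply: sumr_ge0 => j _; exact: sqr_ge0.
have sk : s <= k%:R by rewrite ler_nat.
have s_ge0 : 0 <= s by rewrite ler0n.
(* Cauchy-Schwarz through a nonnegative quadratic in t, evaluated below at t = vS / s. *)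
have cs t : 0 <= q - 2 * t * vS + t ^+ 2 * s.
  have -> : q - 2 * t * vS + t ^+ 2 * s =
      \sum_(j | beta j 0 != 0) (`|v j 0| - t) ^+ 2.
    have -> : t ^+ 2 * s = \sum_(j | beta j 0 != 0) t ^+ 2.
      by rewrite sumr_const mulr_natr.
    rewrite mulr_sumr -sumrB -big_split/=; apply: eq_bigr => j _.
    by rewrite -[v j 0 ^+ 2]real_normK ?num_real//; ring.
  by apply: sumr_ge0 => j _; exact: sqr_ge0.
apply: (@le_trans _ _ (s * q)); last by rewrite ler_pM.
have [s0'|s0'] := eqVneq s 0.
  move: s0' => /eqP; rewrite pnatr_eq0 => /eqP/card0_eq b0.
  rewrite /vS big1 ?expr0n ?mulr_ge0// => j bj.
  by have := b0 j; rewrite !inE bj.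
have s_gt0 : 0 < s by rewrite lt_neqAle eq_sym s0'.
have := cs (vS / s); rewrite -(pmulr_rge0 _ s_gt0).
have -> : s * (q - 2 * (vS / s) * vS + (vS / s) ^+ 2 * s) = s * q - vS ^+ 2.
  by field.
by rewrite subr_ge0.
Qed.

Let dS : \sum_(j | beta j 0 != 0) d j * `|v j 0| <= (1 + delta) * vS.
Proof.
rewrite mulr_sumr; apply: ler_sum => j _.
by rewrite ler_wpM2r//; have /andP[] := d_bounds j.
Qed.

Lemma lasso_cone kappa : (1 + rho) * (1 + delta) <= kappa * ((1 - rho) * (1 - delta)) ->
  l1norm v <= (1 + kappa) * vS.
Proof.
move=> hk; have r1 : 0 < 1 - rho by rewrite subr_gt0.
have d1 : 0 < 1 - delta by rewrite subr_gt0.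
rewrite /l1norm (bigID (fun j => beta j 0 == 0))/= -/vS mulrDl mul1r addrC lerD2l.
set vC := \sum_(j | _) _.
have hC : (1 - delta) * vC <= \sum_(j | beta j 0 == 0) d j * `|v j 0|.
  rewrite mulr_sumr; apply: ler_sum => j _.
  by rewrite ler_wpM2r//; have /andP[] := d_bounds j.
have xv : 0 <= sqnorm (X *m v) / n%:R by rewrite divr_ge0 ?sqnorm_ge0// ltW.
have := ineq; rewrite -/d -/lam -/rho -/v => h.
have h1 : lam * ((1 - rho) * ((1 - delta) * vC)) <=
    lam * ((1 + rho) * ((1 + delta) * vS)).
  apply: (@le_trans _ _ (lam * (1 - rho) *
      \sum_(j | beta j 0 == 0) d j * `|v j 0|)).
    by rewrite -[leRHS]mulrA !ler_wpM2l// ltW.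
  apply: (@le_trans _ _ (lam * (1 + rho) *
      \sum_(j | beta j 0 != 0) d j * `|v j 0|)); first lra.
  by rewrite -[leLHS]mulrA !ler_wpM2l ?(ltW lam_gt0)// addr_ge0.
move: h1; rewrite ler_pM2l// => h1.
have h2 := ler_wpM2r vS_ge0 hk.
have c0 : 0 < (1 - rho) * (1 - delta) by rewrite mulr_gt0.
rewrite -(ler_pM2l c0); lra.
Qed.

Lemma lasso_cone_sqr kappa : 0 <= kappa ->
  (1 + rho) * (1 + delta) <= kappa * ((1 - rho) * (1 - delta)) ->
  l1norm v ^+ 2 <= (1 + kappa) ^+ 2 * k%:R * sqnorm v.
Proof.
move=> k0 /lasso_cone h; rewrite -mulrA.
apply: (@le_trans _ _ (((1 + kappa) * vS) ^+ 2)).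
  by rewrite lerXn2r ?nnegrE ?l1norm_ge0 ?mulr_ge0// addr_ge0.
by rewrite exprMn ler_wpM2l ?sqr_ge0.
Qed.

(** The prediction error is at most linear in |v_S|_1 <= sqrt k |v|_2, and by the eigenvalue
    hypothesis at least quadratic in |v|_2; squaring and cancelling |v|_2^2 gives the rate. *)
Lemma lasso_rate : n%:R * sqnorm v <= 16 * sqnorm (X *m v) ->
  sqnorm v <= (64 * A) ^+ 2 * (k%:R * (ln p%:R / n%:R)) * sigma0 ^+ 2.
Proof.
move=> re; have := ineq; rewrite -/d -/lam -/rho -/v => h.
have r1 : 0 < 1 - rho by rewrite subr_gt0.
have C0 : 0 <= lam * (1 - rho) * \sum_(j | beta j 0 == 0) d j * `|v j 0|.
  apply: mulr_ge0; first by rewrite mulr_ge0// ltW.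
  by apply: sumr_ge0 => j _; rewrite mulr_ge0.
(* The 4 bounds (1 + rho) (1 + delta), both factors being below 2; together with 16 it makes the 64
   of the rate. *)
have h1 : sqnorm v <= 16 * (lam * 4 * vS).
  have e1 : sqnorm v <= 16 * (sqnorm (X *m v) / n%:R).
    by rewrite mulrA ler_pdivlMr// mulrC.
  apply: (le_trans e1); rewrite ler_pM2l//.
  apply: (@le_trans _ _ (lam * (1 + rho) *
      \sum_(j | beta j 0 != 0) d j * `|v j 0|)); first lra.
  apply: (@le_trans _ _ (lam * (1 + rho) * ((1 + delta) * vS))).
    by rewrite ler_wpM2l// mulr_ge0 ?(ltW lam_gt0)// addr_ge0.
  rewrite mulrA ler_wpM2r// -mulrA ler_pM2l//.
  by move: rho_ge0 rho_lt1 delta_ge0 delta1; nra.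
have lam2 : lam ^+ 2 = A ^+ 2 * (ln p%:R / n%:R) * sigma0 ^+ 2.
  by rewrite !exprMn sqr_sqrtr// divr_ge0 ?ltW.
have [->|v0] := eqVneq (sqnorm v) 0.
  by rewrite !mulr_ge0 ?sqr_ge0 ?invr_ge0// ltW.
have v_gt0 : 0 < sqnorm v by rewrite lt_neqAle eq_sym v0 sqnorm_ge0.
rewrite -(ler_pM2l v_gt0) -expr2.
apply: (@le_trans _ _ ((16 * (lam * 4 * vS)) ^+ 2)).
  by rewrite lerXn2r// nnegrE ?sqnorm_ge0// !mulr_ge0// ltW.
have -> : (16 * (lam * 4 * vS)) ^+ 2 = (64 * lam) ^+ 2 * vS ^+ 2 by ring.
apply: (@le_trans _ _ ((64 * lam) ^+ 2 * (k%:R * sqnorm v))).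
  by rewrite (ler_wpM2l (sqr_ge0 _)).
by rewrite exprMn lam2 le_eqVlt; apply/orP; left; apply/eqP; ring.
Qed.

End cone.

End lasso.

(** * Comparison of the l_q and Euclidean norms *)

Section norms.
Context {R : realType} (p : nat) (q : R) (v : 'cV[R]_p).
Hypothesis q12 : 1 <= q < 2.
Let S := \sum_i `|v i 0| `^ q.

Let q_gt0 : 0 < q. Proof. by move: q12 => /andP[q1 _]; exact: lt_le_trans q1. Qed.

Let S_ge0 : 0 <= S. Proof. by apply: sumr_ge0 => i _; exact: powR_ge0. Qed.

Lemma lqnorm0 : lqnorm q (0 : 'cV[R]_p) = 0.
Proof.
rewrite /lqnorm big1; last by move=> i _; rewrite mxE normr0 powR0// gt_eqF.
by rewrite powR0// invr_eq0 gt_eqF.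
Qed.

(** Every coordinate is at most the l_q norm N in absolute value, so v_i^2 <= N^(2 - q) |v_i|^q, and
    these sum to N^(2 - q) N^q. *)
Lemma sqnorm_le_lqnorm : sqnorm v <= lqnorm q v ^+ 2.
Proof.
have [q1 q2] := andP q12; set N := lqnorm q v.
have N0 : 0 <= N by exact: powR_ge0.
have NS : N `^ q = S by rewrite /N /lqnorm -powRrM mulVf ?gt_eqF// powRr1.
have vN i : `|v i 0| <= N.
  have -> : `|v i 0| = (`|v i 0| `^ q) `^ q^-1.
    by rewrite -powRrM mulfV ?powRr1// gt_eqF.
  rewrite ge0_ler_powR ?nnegrE ?invr_ge0 ?powR_ge0// ?(ltW q_gt0)//.
  by rewrite /S (bigD1 i)//= lerDl; apply: sumr_ge0 => j _; exact: powR_ge0.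
have [N00|N00] := eqVneq N 0.
  rewrite N00 expr0n/= /sqnorm big1// => i _.
  by have := vN i; rewrite N00 normr_le0 => /eqP ->; rewrite expr0n.
have Np : 0 < N by rewrite lt_neqAle eq_sym N00.
have -> : N ^+ 2 = N `^ (2 - q) * S.
  by rewrite -NS -powRD ?subrK ?powR_mulrn// N00 implybT.
rewrite mulr_sumr; apply: ler_sum => i _.
rewrite -[v i 0 ^+ 2]real_normK ?num_real//.
have [->|vi] := eqVneq `|v i 0| 0; first by rewrite expr0n/= mulr_ge0 ?powR_ge0.
have -> : `|v i 0| ^+ 2 = `|v i 0| `^ (2 - q) * `|v i 0| `^ q.
  by rewrite -powRD ?subrK ?powR_mulrn// vi implybT.
rewrite ler_wpM2r ?powR_ge0// ge0_ler_powR ?nnegrE//.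
by rewrite subr_ge0 ltW.
Qed.

Lemma powR_weighted (t x y : R) : 0 < t < 1 -> 0 <= x -> 0 <= y ->
  x `^ t * y `^ (1 - t) <= t * x + (1 - t) * y.
Proof.
move=> /andP[t0 t1] x0 y0; have t1' : 0 < 1 - t by rewrite subr_gt0.
have := @conjugate_powR R (x `^ t) (y `^ (1 - t)) t^-1 (1 - t)^-1
  (powR_ge0 _ _) (powR_ge0 _ _).
rewrite !invr_gt0 !invrK => /(_ t0 t1').
rewrite -!powRrM !mulfV ?gt_eqF// !powRr1// addrC subrK => /(_ erefl).
by rewrite mulrC [y * _]mulrC [x * _]mulrC.
Qed.

(** Hoelder interpolation of |v_i|^q between |v_i| and v_i^2, obtained coordinatewise from the
    weighted arithmetic-geometric mean after normalising both sums to 1. *)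
Lemma sum_powR_le : S <= l1norm v `^ (2 - q) * sqnorm v `^ (q - 1).
Proof.
have [q1 q2] := andP q12.
set a := l1norm v; set b := sqnorm v.
have a_ge0 : 0 <= a := l1norm_ge0 _; have b_ge0 : 0 <= b := sqnorm_ge0 _.
(* At q = 1 the weight 2 - q is 1, outside the open range of [powR_weighted]. *)
have [qE|qn1] := eqVneq q 1.
  rewrite /S qE subrr powRr0 mulr1 (_ : 2 - 1 = 1) ?powRr1//; last by ring.
  by under eq_bigr do rewrite powRr1//.
have q1' : 1 < q by rewrite lt_neqAle eq_sym qn1.
have [b0|b0] := eqVneq b 0.
  rewrite /S big1 ?mulr_ge0 ?powR_ge0// => i _.
  move: b0 => /eqP; rewrite psumr_eq0; last by move=> k _; exact: sqr_ge0.
  move=> /allP /(_ i); rewrite mem_index_enum sqrf_eq0 => /(_ isT) /eqP ->.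
  by rewrite normr0 powR0// gt_eqF.
have bp : 0 < b by rewrite lt_neqAle eq_sym b0.
have ap : 0 < a.
  rewrite lt_neqAle a_ge0 andbT eq_sym; apply: contraNneq b0 => a0.
  rewrite /b /sqnorm big1// => i _.
  move: a0 => /eqP; rewrite psumr_eq0// => /allP /(_ i).
  by rewrite mem_index_enum normr_eq0 => /(_ isT) /eqP ->; rewrite expr0n.
pose C := a `^ (2 - q) * b `^ (q - 1).
have hi i : `|v i 0| `^ q <= C * ((2 - q) * (`|v i 0| / a) + (q - 1) * (v i 0 ^+ 2 / b)).
  have t01 : 0 < 2 - q < 1 by apply/andP; split; lra.
  have x0 : 0 <= `|v i 0| / a by rewrite divr_ge0.
  have y0 : 0 <= v i 0 ^+ 2 / b by rewrite divr_ge0 ?sqr_ge0.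
  have := powR_weighted t01 x0 y0; rewrite (_ : 1 - (2 - q) = q - 1); last by ring.
  have C0 : 0 <= C by rewrite mulr_ge0 ?powR_ge0.
  move=> /(ler_wpM2l C0); apply: le_trans.
  rewrite /C mulrACA -!powRM// [a * _]mulrC [b * _]mulrC !divfK ?gt_eqF//.
  have [->|vi] := eqVneq (v i 0) 0.
    by rewrite normr0 powR0 ?gt_eqF// mulr_ge0 ?powR_ge0.
  rewrite -[v i 0 ^+ 2]real_normK ?num_real// -powR_mulrn// -powRrM -powRD.
    by rewrite (_ : 2 - q + 2 * (q - 1) = q)//; ring.
  by rewrite normr_eq0 vi implybT.
apply: (le_trans (ler_sum _ (fun i _ => hi i))).
rewrite -mulr_sumr big_split/= -!mulr_sumr -!mulr_suml -/a -/b.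
by rewrite -/(l1norm v) -/(sqnorm v) -/a -/b !divff ?gt_eqF// !mulr1 /C; lra.
Qed.

(** Once [sum_powR_le] is raised to the power 2 / q, the l1 norm has exponent 2 (2 / q - 1). The
    cone condition trades it for |v|_2^2, whose exponents then add up to 1. *)
Lemma lqnorm_le_sqnorm (K : R) : 0 <= K -> l1norm v ^+ 2 <= K * sqnorm v ->
  lqnorm q v ^+ 2 <= K `^ (2 / q - 1) * sqnorm v.
Proof.
move=> K0 hK; have [q1 q2] := andP q12.
set b := sqnorm v in hK *; have b_ge0 : 0 <= b := sqnorm_ge0 _.
have q2' : 0 <= 2 / q by rewrite divr_ge0// ltW.
have e1 : 0 <= 2 / q - 1 by rewrite subr_ge0 ler_pdivlMr// mul1r ltW.
have -> : lqnorm q v ^+ 2 = S `^ (2 / q).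
  by rewrite /lqnorm -powR_mulrn ?powR_ge0// -powRrM mulrC.
apply: (le_trans (ge0_ler_powR q2' _ _ sum_powR_le)).
- by rewrite nnegrE.
- by rewrite nnegrE mulr_ge0 ?powR_ge0.
rewrite powRM ?powR_ge0// -!powRrM -/b.
have -> : (2 - q) * (2 / q) = 2 * (2 / q - 1) by field; rewrite gt_eqF.
rewrite (powRrM (l1norm v)) powR_mulrn ?l1norm_ge0//.
have h1 : (l1norm v ^+ 2) `^ (2 / q - 1) <= K `^ (2 / q - 1) * b `^ (2 / q - 1).
  rewrite -powRM// ge0_ler_powR// nnegrE ?sqr_ge0//.
  by rewrite mulr_ge0.
apply: (le_trans (ler_wpM2r (powR_ge0 _ _) h1)).
rewrite -mulrA ler_wpM2l ?powR_ge0//.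
have e2 : 0 < 2 / q - 1 by rewrite subr_gt0 ltr_pdivlMr// mul1r.
have [->|b0] := eqVneq b 0; first by rewrite powR0 ?mul0r// gt_eqF.
rewrite -powRD ?b0 ?implybT// (_ : 2 / q - 1 + (q - 1) * (2 / q) = 1) ?powRr1//.
by field; rewrite gt_eqF.
Qed.

End norms.

(** * Exceptional events *)

Section prob_aux.
Context {R : realType} {d : measure_display} {T : measurableType d}.

(* Unlike [ge0_le_integral], this does not need measurability. *)
Lemma ge0_le_integralT (mu : {measure set T -> \bar R}) (f g : T -> \bar R) :
  (forall x, 0 <= f x)%E -> (forall x, f x <= g x)%E ->
  (\int[mu]_x f x <= \int[mu]_x g x)%E.
Proof.
move=> f0 fg; have g0 x : (0 <= g x)%E by exact: le_trans (fg x).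
rewrite !ge0_integralTE//; apply: ereal_sup_le => _ [h hf <-].
by exists h => // x; exact: le_trans (fg x).
Qed.

Lemma measurable_lt_set (f g : T -> R) : measurable_fun setT f ->
  measurable_fun setT g -> measurable [set w | f w < g w].
Proof.
move=> mf mg; have := measurable_fun_ltr mf mg => /(_ measurableT [set true]).
by rewrite setTI; apply.
Qed.

Lemma measurable_le_set (f g : T -> R) : measurable_fun setT f ->
  measurable_fun setT g -> measurable [set w | f w <= g w].
Proof.
move=> mf mg; have := measurable_fun_ler mf mg => /(_ measurableT [set true]).
by rewrite setTI; apply.
Qed.

Lemma measurable_sqnorm n (V : T -> 'cV[R]_n) : measurable_fun setT V ->
  measurable_fun setT (fun w => sqnorm (V w)).
Proof.
move=> mV; apply: measurable_sum => i; apply: measurable_funX.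
exact: measurable_mxE.
Qed.

Lemma measurable_exists (I : finType) (A : I -> set T) :
  (forall i, measurable (A i)) -> measurable [set w | exists i, A i w].
Proof.
move=> mA; rewrite (_ : mkset _ = \bigcup_(i in [set: I]) A i).
  by apply: fin_bigcup_measurable => // i _; exact: mA.
by apply/seteqP; split => w [i]; [move=> Aw; exists i|move=> _ Aw; exists i].
Qed.

Lemma prob_exists_le (P : probability T R) (I : finType) (A : I -> set T) (b : R) :
  (forall i, measurable (A i)) -> (forall i, (P (A i) <= b%:E)%E) ->
  (P [set w | exists i, A i w] <= (#|I|%:R * b)%:E)%E.
Proof.
move=> mA hA.
apply: (@le_trans _ _ (\int[P]_w (\sum_(i : I) (\1_(A i) w)%:E))%E).
  apply: measure_le_integral.
  - exact: measurable_exists.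
  - apply: emeasurable_sum => i; apply/measurable_EFinP; exact: measurable_indic.
  - by move=> w; apply: sume_ge0 => i _; rewrite lee_fin.
  - move=> w [i Aiw]; rewrite (bigD1 i)//= indicE mem_set// leeDl//.
    by apply: sume_ge0 => j _; rewrite lee_fin.
rewrite ge0_integral_sum//; last first.
  by move=> i; apply/measurable_EFinP; exact: measurable_indic.
apply: (@le_trans _ _ (\sum_(i : I) b%:E)%E).
  by apply: lee_sum => i _; rewrite integral_indic// setIT; exact: hA.
by rewrite sumEFin sumr_const mulr_natl.
Qed.

End prob_aux.

(** * Laws of the design and noise statistics of one sample *)

Section sample.
Context {R : realType} {d : measure_display} {T : measurableType d}.
Variable P : probability T R.
Local Notation RB := (measurableTypeR R).
Variables (m p : nat) (g : 'I_m * 'I_p.+1 -> T -> R).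
Hypothesis ig : iid_normal P g.

Definition design (w : T) : 'M[R]_(m, p) := \matrix_(i, j) g (i, lift ord0 j) w.
Definition noise (w : T) : 'cV[R]_m := \col_i g (i, ord0) w.

Lemma measurable_design : measurable_fun setT design.
Proof.
by apply: measurable_mx => i j; under eq_fun do rewrite mxE; exact: ig.1.
Qed.

Lemma measurable_noise : measurable_fun setT noise.
Proof.
by apply: measurable_mx => i j; under eq_fun do rewrite mxE; exact: ig.1.
Qed.

(** Dividing the coefficients (s, u) by their length gives the unit vector of [iid_chi2]. *)
Lemma residual_chi2 (s : R) (u : 'cV[R]_p) (B : set RB) :
  0 < s ^+ 2 + sqnorm u -> measurable B ->
  P [set w | B (sqnorm (s *: noise w + design w *m u) / (s ^+ 2 + sqnorm u))] =
  chi2_prob m B.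
Proof.
set c := s ^+ 2 + _ => c0 mB; pose r := Num.sqrt c.
have r2 : r ^+ 2 = c by rewrite sqr_sqrtr// ltW.
have r0 : r != 0 by rewrite gt_eqF// sqrtr_gt0.
pose a k := (if unlift ord0 k is Some j then u j 0 else s) / r.
have a1 : \sum_k a k ^+ 2 = 1.
  rewrite big_ord_recl /a unlift_none.
  under eq_bigr do rewrite liftK expr_div_n.
  by rewrite expr_div_n -mulr_suml -mulrDl -/(sqnorm u) -/c r2 divff// gt_eqF.
rewrite -(iid_chi2 ig a1 mB); congr (P _).
suff E w : sqnorm (s *: noise w + design w *m u) / c =
    \sum_i (\sum_k a k * g (i, k) w) ^+ 2.
  by apply/seteqP; split => w /=; rewrite E.
rewrite mulr_suml; apply: eq_bigr => i _; rewrite -r2 -expr_div_n; congr (_ ^+ 2).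
rewrite big_ord_recl /a unlift_none !mxE mulrDl mulrAC; congr (_ + _).
by rewrite mulr_suml; apply: eq_bigr => j _; rewrite liftK !mxE; ring.
Qed.

Lemma design_chi2 (u : 'cV[R]_p) (B : set RB) : 0 < sqnorm u -> measurable B ->
  P [set w | B (sqnorm (design w *m u) / sqnorm u)] = chi2_prob m B.
Proof.
move=> u0 mB; have := @residual_chi2 0 u B; rewrite expr0n/= add0r.
by under eq_set do rewrite scale0r add0r; apply.
Qed.

(** With the column frozen, its correlation with the noise divided by its length is standard normal.
    Writing the event without division makes it empty for a zero column. *)
Lemma noise_corr_tail (t : R) (j : 'I_p) :
  (P [set w | t * sqnorm (col j (design w)) <
     (\sum_i design w i j * noise w i 0) ^+ 2]%R <=
   chi2_prob 1 [set x : RB | t < x]%R)%E.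
Proof.
pose h1 (x : 'I_m * 'I_1) : 'I_m * 'I_p.+1 := (x.1, lift ord0 j).
pose h2 (x : 'I_1 * 'I_m) : 'I_m * 'I_p.+1 := (x.2, ord0).
have I1 : injective h1 by move=> [x1 x2] [y1 y2] /= [] ->; rewrite !ord1.
have I2 : injective h2 by move=> [x1 x2] [y1 y2] /= [] ->; rewrite !ord1.
have I12 x y : h1 x != h2 y by rewrite xpair_eqE negb_and orbC eq_sym neq_lift.
pose E (M : 'M[R]_(m, 1)) (N : 'M[R]_(1, m)) :=
  t * sqnorm M < (\sum_i M i 0 * N 0 i) ^+ 2.
have mE : measurable [set z | E z.1 z.2].
  apply: measurable_lt_set.
    by apply: measurable_funM => //; apply: measurable_sqnorm; exact: measurable_fst.
  apply: measurable_funX; apply: measurable_sum => i; apply: measurable_funM.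
    by apply: measurable_mxE; exact: measurable_fst.
  by apply: measurable_mxE; exact: measurable_snd.
have := iid_mx_prob (E := E) ig I1 I2 I12 mE.
rewrite (_ : [set w | E _ _] = [set w | t * sqnorm (col j (design w)) <
     (\sum_i design w i j * noise w i 0) ^+ 2]); last first.
  suff Ew w : E (mx_of g h1 w) (mx_of g h2 w) =
     (t * sqnorm (col j (design w)) < (\sum_i design w i j * noise w i 0) ^+ 2).
    by apply/seteqP; split => w /=; rewrite Ew.
  rewrite /E; congr (_ * _ < _ ^+ 2); apply: eq_bigr => i _; rewrite !mxE//.
move=> ->.
have mS : measurable [set x : RB | t < x] by exact: measurable_lt_set.
have bnd w : (P [set w' | E (mx_of g h1 w) (mx_of g h2 w')] <=
    chi2_prob 1 [set x : RB | t < x]%R)%E.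
  set M := mx_of g h1 w.
  have [M0|M0] := eqVneq (sqnorm M) 0.
    rewrite (_ : [set w' | _] = set0) ?measure0//.
    apply/seteqP; split => // w' /=; rewrite /E M0 mulr0 big1 ?expr0n/= ?ltxx// => i _.
    move: M0 => /eqP; rewrite psumr_eq0; last by move=> k _; exact: sqr_ge0.
    move=> /allP /(_ i); rewrite mem_index_enum sqrf_eq0 => /(_ isT) /eqP ->.
    by rewrite mul0r.
  have Mp : 0 < sqnorm M by rewrite lt_neqAle eq_sym M0 sqnorm_ge0.
  pose r := Num.sqrt (sqnorm M).
  have r2 : r ^+ 2 = sqnorm M by rewrite sqr_sqrtr// ltW.
  pose a i := M i 0 / r.
  have a1 : \sum_i a i ^+ 2 = 1.
    by under eq_bigr do rewrite expr_div_n; rewrite -mulr_suml r2 divff.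
  pose g2 (x : 'I_1 * 'I_m) := g (h2 x).
  have ig2 : iid_normal P g2 by exact: iid_normal_inj.
  rewrite -(iid_chi2 ig2 a1 mS) le_eqVlt; apply/orP; left; apply/eqP; congr (P _).
  suff Ew w' : E M (mx_of g h2 w') =
      (t < \sum_(i < 1) (\sum_k a k * g2 (i, k) w') ^+ 2).
    by apply/seteqP; split => w' /=; rewrite Ew.
  rewrite big_ord1 /E -ltr_pdivlMr//; congr (_ < _).
  rewrite -r2 -expr_div_n mulr_suml; congr (_ ^+ 2); apply: eq_bigr => i _.
  by rewrite mx_ofE /a mulrAC.
apply: (@le_trans _ _ (\int[P]_w (chi2_prob 1 [set x : RB | t < x]%R))%E).
  by apply: ge0_le_integralT.
by rewrite integral_cst//= probability_setT mule1.
Qed.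

End sample.

Section bad_events.
Context {R : realType}.
Local Notation RB := (measurableTypeR R).
Variables (m p : nat) (sigma0 : R) (beta : 'cV[R]_p).
Implicit Type Z : 'M[R]_(m, p) * 'cV[R]_m.

Definition bad_noise (tau : R) : set ('M[R]_(m, p) * 'cV[R]_m) :=
  [set Z | exists j, tau * sigma0 * Num.sqrt (ln p%:R) * l2norm (col j Z.1) <
    `|\sum_i Z.1 i j * (Z.2 - Z.1 *m beta) i 0|].

Definition bad_columns (delta : R) : set ('M[R]_(m, p) * 'cV[R]_m) :=
  [set Z | exists j, sqnorm (col j Z.1) < (1 - delta) * m%:R \/
                     (1 + delta) * m%:R < sqnorm (col j Z.1)].

Definition bad_sparse (M : nat) : set ('M[R]_(m, p) * 'cV[R]_m) :=
  [set Z | exists t : M.-tuple (bool * 'I_p),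
    sqnorm (Z.1 *m signed_sum t) < m%:R / 2 * sqnorm (signed_sum t : 'cV[R]_p)].

Definition null_column : set ('M[R]_(m, p) * 'cV[R]_m) :=
  [set Z | exists j, sqnorm (col j Z.1) <= 0].

Let mcol j : measurable_fun setT (fun Z => sqnorm (col j Z.1)).
Proof.
apply: measurable_sum => i; under eq_fun do rewrite mxE.
by apply: measurable_funX; exact: measurable_mxE.
Qed.

Let ml2 j : measurable_fun setT (fun Z => l2norm (col j Z.1)).
Proof.
apply: (measurableT_comp _ (mcol j)).
by apply: continuous_measurable_fun; exact: sqrt_continuous.
Qed.

Lemma measurable_bad_noise tau : measurable (bad_noise tau).
Proof.
apply: measurable_exists => j; apply: measurable_lt_set.
  exact: measurable_funM.
apply: measurableT_comp => //; apply: measurable_sum => i.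
apply: measurable_funM; first exact: measurable_mxE.
apply: measurable_mxE; apply: measurable_mxB => //.
by apply: measurable_mxM.
Qed.

Lemma measurable_bad_columns delta : measurable (bad_columns delta).
Proof.
apply: measurable_exists => j; apply: measurableU; exact: measurable_lt_set.
Qed.

Lemma measurable_bad_sparse M : measurable (bad_sparse M).
Proof.
apply: measurable_exists => t; apply: measurable_lt_set => //.
by apply: measurable_sqnorm; exact: measurable_mxM.
Qed.

Lemma measurable_null_column : measurable null_column.
Proof. by apply: measurable_exists => j; exact: measurable_le_set. Qed.

Section probability.
Context {d : measure_display} {T : measurableType d}.
Variables (P : probability T R) (g : 'I_m * 'I_p.+1 -> T -> R).
Hypothesis ig : iid_normal P g.
Hypothesis s0 : 0 < sigma0.

Definition sample (w : T) : 'M[R]_(m, p) * 'cV[R]_m :=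
  (design g w, design g w *m beta + sigma0 *: noise g w).

Lemma measurable_sample : measurable_fun setT sample.
Proof.
have mX := measurable_design ig; have me := measurable_noise ig.
apply: measurable_fun_pair => //; apply: measurable_mx => i j.
under eq_fun do rewrite mxE; apply: measurable_funD.
  by apply: measurable_mxE; exact: measurable_mxM.
under eq_fun do rewrite mxE.
by apply: measurable_funM => //; exact: measurable_mxE.
Qed.

Let colE w j : col j (design g w) = design g w *m delta_mx j 0.
Proof. exact: colE. Qed.

(** Each column contributes the tail of one squared normal at tau^2 ln p. The tilt [s] stays free
    because coverage and length choose it differently. *)
Lemma prob_bad_noise tau s : 0 <= tau -> 0 <= s < 2^-1 ->
  (P [set w | bad_noise tau (sample w)] <=
   (p%:R * ((Num.sqrt (1 - s *+ 2))^-1 * expR (- (s * (tau ^+ 2 * ln p%:R)))))%:E)%E.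
Proof.
move=> tau0 /andP[s_ge0 s2].
set b := (_^-1 * _); rewrite -[p in leRHS]card_ord.
pose A j := [set w | tau ^+ 2 * ln p%:R * sqnorm (col j (design g w)) <
     (\sum_i design g w i j * noise g w i 0) ^+ 2].
rewrite (_ : mkset _ = [set w | exists j, A j w]); last first.
  suff E w j : (tau * sigma0 * Num.sqrt (ln p%:R) * l2norm (col j (design g w)) <
    `|\sum_i design g w i j * ((sample w).2 - design g w *m beta) i 0|) =
     (tau ^+ 2 * ln p%:R * sqnorm (col j (design g w)) <
     (\sum_i design g w i j * noise g w i 0) ^+ 2).
    by apply/seteqP; split => w [j] h; exists j; move: h; rewrite /A/= E.
  have -> : (sample w).2 - design g w *m beta = sigma0 *: noise g w.
    by rewrite /sample/= addrAC subrr add0r.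
  have -> : \sum_i design g w i j * (sigma0 *: noise g w) i 0 =
      sigma0 * \sum_i design g w i j * noise g w i 0.
    by rewrite mulr_sumr; apply: eq_bigr => i _; rewrite [X in _ * X = _]mxE mulrCA.
  rewrite normrM (gtr0_norm s0) (mulrAC tau) (mulrAC _ sigma0) mulrC ltr_pM2l//.
  rewrite -[LHS]ltr_sqr ?nnegrE ?mulr_ge0 ?sqrtr_ge0//.
  by rewrite real_normK ?num_real// !exprMn l2norm_sqr sqr_sqrtr ?ln_nat_ge0.
apply: prob_exists_le => j.
  apply: measurable_lt_set.
    apply: measurable_funM => //.
    have := measurableT_comp (mcol j) measurable_sample.
    exact.
  apply: measurable_funX; apply: measurable_sum => i.
  apply: measurable_funM; apply: measurable_mxE.
    exact: (measurable_design ig).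
  exact: (measurable_noise ig).
apply: (le_trans (noise_corr_tail ig _ _)).
apply: (le_trans (@chi2_mgf_tail _ s (tau ^+ 2 * ln p%:R) 1 _ _ _ _)) => //.
- exact: measurable_lt_set.
- by move=> x /= /ltW; exact: ler_wpM2l.
Qed.

Lemma prob_bad_columns delta : 0 <= delta <= 1 ->
  (P [set w | bad_columns delta (sample w)] <=
   (p%:R * (2 * expR (- (delta ^+ 2 / 16 * m%:R))))%:E)%E.
Proof.
move=> d01; set b := (2 * _); rewrite -[p in leRHS]card_ord.
apply: (@prob_exists_le _ _ _ P _ (fun j => [set w |
  sqnorm (col j (design g w)) < (1 - delta) * m%:R \/
  (1 + delta) * m%:R < sqnorm (col j (design g w))])) => j.
  have mc := measurableT_comp (mcol j) measurable_sample.
  by apply: measurableU; apply: measurable_lt_set => //; exact: mc.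
pose B := [set x : RB | x <= (1 - delta) * m%:R] `|` [set x | (1 + delta) * m%:R <= x].
have mB : measurable B by apply: measurableU; exact: measurable_le_set.
have h := @design_chi2 _ _ _ P m p g ig (delta_mx j 0) B.
rewrite sqnorm_delta in h.
apply: (@le_trans _ _ (chi2_prob m B)).
  rewrite -h//; apply: le_measure; rewrite ?inE//.
  - have mc := measurableT_comp (mcol j) measurable_sample.
    by apply: measurableU; apply: measurable_lt_set => //; exact: mc.
  - rewrite -[mkset _]setTI.
    have mc : measurable_fun setT (fun w => sqnorm (design g w *m delta_mx j 0) / 1 : RB).
      apply: measurable_funM => //; apply: measurable_sqnorm; apply: measurable_mxM => //.
      exact: (measurable_design ig).
    exact: mc.
  - by move=> w /=; rewrite colE divr1 /B/= => -[/ltW|/ltW]; [left|right].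
apply: (le_trans (measureU2 _ _ _)); try exact: measurable_le_set.
rewrite /b mulr_natl mulr2n EFinD; apply: leeD.
  exact: chi2_lower_tail.
exact: chi2_upper_tail.
Qed.

(** Chi-square lower tail at deviation 1/2, whose exponent is (1/2)^2 / 16 = 1/64. A tuple whose
    signs cancel to the zero vector gives an empty event. *)
Lemma prob_bad_sparse M :
  (P [set w | bad_sparse M (sample w)] <=
   ((2 * p%:R) ^+ M * expR (- (m%:R / 64)))%:E)%E.
Proof.
have -> : (2 * p%:R) ^+ M = #|{: M.-tuple (bool * 'I_p)}|%:R :> R.
  by rewrite card_tuple card_prod card_bool card_ord natrX natrM.
apply: (@prob_exists_le _ _ _ P _ (fun t : M.-tuple (bool * 'I_p) => [set w |
  sqnorm (design g w *m signed_sum t) < m%:R / 2 * sqnorm (signed_sum t : 'cV[R]_p)])) => t.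
  apply: measurable_lt_set => //; apply: measurable_sqnorm; apply: measurable_mxM => //.
  exact: (measurable_design ig).
set u := signed_sum t.
have [u0|u0] := eqVneq (sqnorm u) 0.
  rewrite (_ : mkset _ = set0) ?measure0 ?lee_fin ?expR_ge0//.
  apply/seteqP; split => // w /=; rewrite u0 mulr0 => h.
  by have := sqnorm_ge0 (design g w *m u); rewrite leNgt h.
have up : 0 < sqnorm u by rewrite lt_neqAle eq_sym u0 sqnorm_ge0.
pose B := [set x : RB | x <= (1 - 2^-1) * m%:R].
have mB : measurable B by exact: measurable_le_set.
apply: (@le_trans _ _ (chi2_prob m B)).
  rewrite -(design_chi2 ig up mB); apply: le_measure; rewrite ?inE//.
  - apply: measurable_lt_set => //; apply: measurable_sqnorm; apply: measurable_mxM => //.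
    exact: (measurable_design ig).
  - rewrite -[mkset _]setTI.
    have mc : measurable_fun setT (fun w => sqnorm (design g w *m u) / sqnorm u : RB).
      apply: measurable_funM => //; apply: measurable_sqnorm; apply: measurable_mxM => //.
      exact: (measurable_design ig).
    exact: mc.
  - move=> w /= /ltW h; rewrite /B/= ler_pdivrMr//; apply: (le_trans h).
    by rewrite le_eqVlt; apply/orP; left; apply/eqP; field.
apply: (le_trans (@chi2_lower_tail _ 2^-1 m _)); first by apply/andP; split; lra.
by rewrite lee_fin ler_expR le_eqVlt; apply/orP; left; apply/eqP; field.
Qed.

(** The small-ball bound is available at every level [e], which rules out an atom of the chi-square
    law at 0. *)
Lemma prob_null_column : (0 < m)%N -> (P [set w | null_column (sample w)] <= 0)%E.
Proof.
move=> m0; rewrite -[leRHS]/(0%:E) -(mulr0 #|'I_p|%:R).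
apply: (@prob_exists_le _ _ _ P _ (fun j => [set w |
  sqnorm (col j (design g w)) <= 0])) => j.
  have mc := measurableT_comp (mcol j) measurable_sample.
  by apply: measurable_le_set => //; exact: mc.
pose B := [set x : RB | x <= 0].
have mB : measurable B by exact: measurable_le_set.
have h := @design_chi2 _ _ _ P m p g ig (delta_mx j 0) B.
rewrite sqnorm_delta in h.
rewrite (_ : mkset _ = [set w | B (sqnorm (design g w *m delta_mx j 0) / 1)]); last first.
  by apply/seteqP; split => w; rewrite /B/= divr1 colE.
rewrite h//; apply/lee_addgt0Pr => e e0; rewrite add0e.
have [dd dd0 hd] := chi2_small_ball e0.
apply: le_trans (hd m m0); apply: le_measure; rewrite ?inE//.
  exact: measurable_le_set.
by move=> x /= x0; apply: (le_trans x0); rewrite mulr_ge0// ltW.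
Qed.

End probability.

End bad_events.

(** * Sample splitting *)

Section random_split.
Context {R : realType} {d : measure_display} {T : measurableType d}.
Variable P : probability T R.
Variables (n p : nat) (X : {mfun T >-> 'M[R]_(n, p)}) (y : {mfun T >-> 'cV[R]_n}).
Variable pi : T -> 'S_n.
Hypothesis split : random_split P X y pi.
Variable F : 'S_n -> set ('M[R]_(n, p) * 'cV[R]_n).
Hypothesis mF : forall s, measurable (F s).

Let G := [set w | F (pi w) (X w, y w)].

Let mXy : measurable_fun setT (fun w => (X w, y w)).
Proof. by apply: measurable_fun_pair; exact: measurable_funP. Qed.

Let GE : G = [set w | exists s, pi w = s /\ F s (X w, y w)].
Proof. by apply/seteqP; split => w; rewrite /G/=; [move=> h; exists (pi w)|move=> [s [ws Fs]]; rewrite ws]. Qed.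

Let mGs s : measurable [set w | pi w = s /\ F s (X w, y w)].
Proof.
apply: measurableI; first exact: split.1.
by rewrite -[X in measurable X]setTI; exact: mXy.
Qed.

Lemma measurable_split : measurable G.
Proof. by rewrite GE; exact: measurable_exists. Qed.

(** The union bound over permutations is lossless: independence gives each of the n! pieces the
    weight 1 / n!, so the common bound is recovered unchanged. *)
Lemma random_split_le (b : R) :
  (forall s, (P [set w | F s (X w, y w)] <= b%:E)%E) -> (P G <= b%:E)%E.
Proof.
move=> hb; rewrite GE.
have -> : b = #|'S_n|%:R * ((n`!)%:R^-1 * b).
  by rewrite card_Sn mulrA mulfV ?mul1r// pnatr_eq0 -lt0n fact_gt0.
apply: (@prob_exists_le _ _ _ P _ (fun s => [set w | pi w = s /\ F s (X w, y w)])) => // s.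
by rewrite split.2// EFinM lee_wpmul2l// lee_fin invr_ge0.
Qed.

End random_split.

(** The upper bound [random_split_le], applied to the event and to its complement, becomes an
    equality. *)
Lemma random_split_law {R : realType} {d : measure_display} {T : measurableType d}
    (P : probability T R) (n p : nat) (X : {mfun T >-> 'M[R]_(n, p)})
    (y : {mfun T >-> 'cV[R]_n}) (pi : T -> 'S_n)
    (F : 'S_n -> set ('M[R]_(n, p) * 'cV[R]_n)) (b : R) :
  random_split P X y pi -> (forall s, measurable (F s)) ->
  (forall s, P [set w | F s (X w, y w)] = b%:E) ->
  P [set w | F (pi w) (X w, y w)] = b%:E.
Proof.
move=> split mF hb.
have mG := measurable_split split mF.
have mFs s : measurable [set w | F s (X w, y w)].
  rewrite -[X in measurable X]setTI.
  have mXy : measurable_fun setT (fun w => (X w, y w)).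
    by apply: measurable_fun_pair; exact: measurable_funP.
  exact: mXy.
apply/eqP; rewrite eq_le; apply/andP; split.
  by apply: random_split_le => // s; rewrite hb.
have : (P [set w | (~` F (pi w)) (X w, y w)] <= (1 - b)%:E)%E.
  apply: (@random_split_le _ _ _ P n p X y pi split (fun s => ~` F s)) => s.
    exact: measurableC.
  rewrite (_ : mkset _ = ~` [set w | F s (X w, y w)])//.
  by rewrite probability_setC// hb.
rewrite (_ : mkset _ = ~` [set w | F (pi w) (X w, y w)])// probability_setC//.
have /fineK <- : P [set w | F (pi w) (X w, y w)] \is a fin_num by exact: fin_num_measure.
by rewrite -EFinB !lee_fin; lra.
Qed.

(** * The chi-square pivot built from the second subsample *)

Section residual_stat.
Context {R : realType} (n1 n2 p : nat) (sigma0 : R).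
Variable b : {mfun ('M[R]_(n1, p) * 'cV[R]_n1)%type >-> 'cV[R]_p}.

Definition residual_stat (beta : 'cV[R]_p) (Z1 : 'M[R]_(n1, p) * 'cV[R]_n1)
    (Z2 : 'M[R]_(n2, p) * 'cV[R]_n2) : R :=
  sqnorm (Z2.2 - Z2.1 *m b Z1) / (sigma0 ^+ 2 + sqnorm (b Z1 - beta)).

Lemma measurable_residual_stat beta d (S : measurableType d)
    (Z1 : S -> 'M[R]_(n1, p) * 'cV[R]_n1) (Z2 : S -> 'M[R]_(n2, p) * 'cV[R]_n2) :
  measurable_fun setT Z1 -> measurable_fun setT Z2 ->
  measurable_fun setT (fun w => residual_stat beta (Z1 w) (Z2 w)).
Proof.
move=> m1 m2.
have mb : measurable_fun setT (fun w => b (Z1 w)) by exact: measurableT_comp m1.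
have mX : measurable_fun setT (fun w => (Z2 w).1) by exact: measurableT_comp m2.
have my : measurable_fun setT (fun w => (Z2 w).2) by exact: measurableT_comp m2.
apply: measurable_funM.
  by apply: measurable_sqnorm; apply: measurable_mxB => //; exact: measurable_mxM.
pose D w := sigma0 ^+ 2 + sqnorm (b (Z1 w) - beta).
have mD : measurable_fun setT D.
  by apply: measurable_funD => //; apply: measurable_sqnorm; exact: measurable_mxB.
(* The inverse is written as the power -1, which is legitimate as the denominator is nonnegative. *)
rewrite [X in measurable_fun _ X](_ : _ = (fun w => D w `^ (-1))).
  apply: (measurableT_comp (f := fun x : R => x `^ (-1)) _ mD); exact: measurable_powR.
by apply/funext => w; rewrite powR_inv1// addr_ge0 ?sqr_ge0 ?sqnorm_ge0.
Qed.

End residual_stat.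

Section subsamples.
Context {R : realType} {d : measure_display} {T : measurableType d}.
Variable P : probability T R.
Local Notation RB := (measurableTypeR R).
Variables (n1 n2 p k : nat) (sigma0 : R) (theta : param R p).
Variables (X : {mfun T >-> 'M[R]_(n1 + n2, p)}) (y : {mfun T >-> 'cV[R]_(n1 + n2)}).
Hypotheses (s0 : 0 < sigma0) (Th : Theta0 sigma0 k theta).
Hypothesis lm : linear_model P theta X y.
Variable s : 'S_(n1 + n2).
Let g := data_entry theta X y.
Let g1 (x : 'I_n1 * 'I_p.+1) := g (s (lshift n2 x.1), x.2).
Let g2 (x : 'I_n2 * 'I_p.+1) := g (s (rshift n1 x.1), x.2).

Let ig : iid_normal P g. Proof. exact: data_entry_iid s0 Th lm. Qed.

Lemma iid_normal_sub1 : iid_normal P g1.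
Proof.
apply: (iid_normal_inj (h := fun x => (s (lshift n2 x.1), x.2))) => //.
by move=> [i1 i2] [j1 j2] /= [] /perm_inj/lshift_inj -> ->.
Qed.

Lemma iid_normal_sub2 : iid_normal P g2.
Proof.
apply: (iid_normal_inj (h := fun x => (s (rshift n1 x.1), x.2))) => //.
by move=> [i1 i2] [j1 j2] /= [] /perm_inj/rshift_inj -> ->.
Qed.

Let yE i w : (X w *m coef theta) i 0 + sigma0 * g (i, ord0) w = y w i 0.
Proof.
have [_ _ sd] := Th.
rewrite /g /data_entry/= unlift_none sd mulVKf ?gt_eqF//.
by rewrite [X in _ + X]mxE [X in _ + (_ + X)]mxE addrC subrK.
Qed.

Lemma subsample1E w : subsample1 s (X w) (y w) = sample sigma0 (coef theta) g1 w.
Proof.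
rewrite /subsample1 /sample.
have XE : usubmx (row_perm s (X w)) = design g1 w.
  by apply/matrixP => i j; rewrite !mxE /g1 /g /data_entry/= liftK.
congr pair => //; apply/matrixP => i j; rewrite ord1.
rewrite [LHS]mxE [LHS]mxE -yE [RHS]mxE; congr (_ + _); last by rewrite !mxE.
by rewrite [LHS]mxE [RHS]mxE; apply: eq_bigr => l _; rewrite -XE !mxE.
Qed.

Lemma subsample2E w : subsample2 s (X w) (y w) = sample sigma0 (coef theta) g2 w.
Proof.
rewrite /subsample2 /sample.
have XE : dsubmx (row_perm s (X w)) = design g2 w.
  by apply/matrixP => i j; rewrite !mxE /g2 /g /data_entry/= liftK.
congr pair => //; apply/matrixP => i j; rewrite ord1.
rewrite [LHS]mxE [LHS]mxE -yE [RHS]mxE; congr (_ + _); last by rewrite !mxE.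
by rewrite [LHS]mxE [RHS]mxE; apply: eq_bigr => l _; rewrite -XE !mxE.
Qed.

Variable b : {mfun ('M[R]_(n1, p) * 'cV[R]_n1)%type >-> 'cV[R]_p}.

Lemma residual_stat_law (B : set RB) : measurable B ->
  P [set w | B (residual_stat sigma0 b (coef theta)
    (subsample1 s (X w) (y w)) (subsample2 s (X w) (y w)))] = chi2_prob n2 B.
Proof.
move=> mB; set beta := coef theta.
have ig1 := iid_normal_sub1; have ig2 := iid_normal_sub2.
(* Rebuilds a sample from a raw block, which turns the event into a function of two independent
   matrices. *)
pose dec m (M : 'M[R]_(m, p.+1)) : 'M[R]_(m, p) * 'cV[R]_m :=
  let D := \matrix_(i, j) M i (lift ord0 j) in
  (D, D *m beta + sigma0 *: \col_i M i ord0).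
have mdec m : measurable_fun setT (@dec m).
  have mD : measurable_fun setT (fun M : 'M[R]_(m, p.+1) =>
      \matrix_(i, j) M i (lift ord0 j) : 'M[R]_(m, p)).
    by apply: measurable_mx => i j; under eq_fun do rewrite mxE; exact: measurable_entry.
  apply: measurable_fun_pair => //; apply: measurable_mx => i j.
  under eq_fun do rewrite mxE; apply: measurable_funD.
    by apply: measurable_mxE; exact: measurable_mxM.
  under eq_fun do rewrite mxE mxE; apply: measurable_funM => //.
  exact: measurable_entry.
pose h1 (x : 'I_n1 * 'I_p.+1) := (s (lshift n2 x.1), x.2).
pose h2 (x : 'I_n2 * 'I_p.+1) := (s (rshift n1 x.1), x.2).
have I1 : injective h1.
  by move=> [i1 i2] [j1 j2] /= [] /perm_inj/lshift_inj -> ->.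
have I2 : injective h2.
  by move=> [i1 i2] [j1 j2] /= [] /perm_inj/rshift_inj -> ->.
have I12 x z : h1 x != h2 z.
  by rewrite xpair_eqE negb_and (inj_eq perm_inj) eq_lrshift.
have dec1 w : dec _ (mx_of g h1 w) = sample sigma0 beta g1 w.
  have E : \matrix_(i, j) mx_of g h1 w i (lift ord0 j) = design g1 w.
    by apply/matrixP => i j; rewrite !mxE.
  by rewrite /dec E; congr (_, _ + _ *: _); apply/matrixP => i j; rewrite !mxE.
have dec2 w : dec _ (mx_of g h2 w) = sample sigma0 beta g2 w.
  have E : \matrix_(i, j) mx_of g h2 w i (lift ord0 j) = design g2 w.
    by apply/matrixP => i j; rewrite !mxE.
  by rewrite /dec E; congr (_, _ + _ *: _); apply/matrixP => i j; rewrite !mxE.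
pose E (M : 'M[R]_(n1, p.+1)) (N : 'M[R]_(n2, p.+1)) :=
  B (residual_stat sigma0 b beta (dec _ M) (dec _ N)).
have mE : measurable [set z | E z.1 z.2].
  have mr : measurable_fun setT (fun z : ('M[R]_(n1, p.+1) * 'M[R]_(n2, p.+1))%type =>
      residual_stat sigma0 b beta (dec _ z.1) (dec _ z.2)).
    by apply: measurable_residual_stat; apply: measurableT_comp (mdec _) _.
  by rewrite -[X in measurable X]setTI; exact: mr.
transitivity (P [set w | E (mx_of g h1 w) (mx_of g h2 w)]).
  congr (P _).
  by apply/seteqP; split => w /=; rewrite /E dec1 dec2 subsample1E subsample2E.
rewrite (iid_mx_prob (E := E) ig I1 I2 I12 mE).
rewrite -[RHS]mule1 -(probability_setT P) -integral_cst//.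
apply: eq_integral => w _.
pose u := beta - b (sample sigma0 beta g1 w).
have u0 : 0 < sigma0 ^+ 2 + sqnorm u by rewrite ltr_pwDl ?sqnorm_ge0// exprn_gt0.
rewrite -[RHS](residual_chi2 ig2 u0 mB); congr (P _).
suff e w' : residual_stat sigma0 b beta (dec _ (mx_of g h1 w)) (dec _ (mx_of g h2 w')) =
   sqnorm (sigma0 *: noise g2 w' + design g2 w' *m u) / (sigma0 ^+ 2 + sqnorm u).
  by apply/seteqP; split => w' /=; rewrite /E e.
rewrite dec1 dec2 /residual_stat /=; congr (sqnorm _ / (_ + _)).
  by rewrite /u mulmxBr addrA [_ *: _ + _]addrC.
by rewrite /u -opprB -scaleN1r sqnormZ sqrrN expr1n mul1r.
Qed.

End subsamples.

(** * Deterministic consequences of avoiding the bad events *)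

Section good_events.
Context {R : realType}.
Variables (m p k : nat) (sigma0 A tau delta kappa : R) (M : nat).
Variables (beta b : 'cV[R]_p) (Z : 'M[R]_(m, p) * 'cV[R]_m).
Hypotheses (m0 : (0 < m)%N) (p1 : (1 < p)%N) (s0 : 0 < sigma0) (A0 : 0 < A).
Hypothesis b_min : lasso_objective sigma0 A Z b <= lasso_objective sigma0 A Z beta.
Hypotheses (tau_ge0 : 0 <= tau) (tauA : 2 * tau < A).
Hypothesis good_noise : ~ bad_noise sigma0 beta tau Z.

Let e := Z.2 - Z.1 *m beta.

Let ZE : Z = (Z.1, Z.1 *m beta + e).
Proof. by rewrite /e addrC subrK -surjective_pairing. Qed.

Let b_min' : lasso_objective sigma0 A (Z.1, Z.1 *m beta + e) b <=
  lasso_objective sigma0 A (Z.1, Z.1 *m beta + e) beta.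
Proof. by rewrite -ZE. Qed.

Let noise_le j : `|\sum_i Z.1 i j * e i 0| <=
  tau * sigma0 * Num.sqrt (ln p%:R) * l2norm (col j Z.1).
Proof. by rewrite leNgt; apply/negP => h; apply: good_noise; exists j. Qed.

Lemma good_null : l0norm beta = 0%N -> ~ null_column Z -> b - beta = 0.
Proof.
move=> beta0 hcol; apply: (lasso_null m0 p1 s0 A0 b_min' noise_le) => // j.
by rewrite ltNge; apply/negP => h; apply: hcol; exists j.
Qed.

Hypotheses (delta0 : 0 <= delta) (delta1 : delta < 1) (k1 : (0 < k)%N).
Hypothesis sparse : (l0norm beta <= k)%N.
Hypothesis good_columns : ~ bad_columns delta Z.
Hypothesis good_sparse : ~ bad_sparse M Z.
Hypotheses (kappa0 : 0 <= kappa)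
  (kappaE : (1 + 2 * tau / A) * (1 + delta) <=
            kappa * ((1 - 2 * tau / A) * (1 - delta)))
  (M_large : 60 * ((1 + kappa) ^+ 2 * k%:R) <= M%:R).

Let columns j : (1 - delta) * m%:R <= sqnorm (col j Z.1) <= (1 + delta) * m%:R.
Proof.
by apply/andP; split; rewrite leNgt; apply/negP => h; apply: good_columns;
  exists j; [left|right].
Qed.

Lemma good_cone :
  l1norm (b - beta) ^+ 2 <= (1 + kappa) ^+ 2 * k%:R * sqnorm (b - beta).
Proof.
exact: (lasso_cone_sqr m0 p1 s0 A0 b_min' noise_le tau_ge0 tauA delta0 delta1
  columns sparse kappa0 kappaE).
Qed.

Lemma good_rate : sqnorm (b - beta) <=
  (64 * A) ^+ 2 * (k%:R * (ln p%:R / m%:R)) * sigma0 ^+ 2.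
Proof.
apply: (lasso_rate m0 p1 s0 A0 b_min' noise_le tau_ge0 tauA delta0 delta1
  columns sparse).
apply: (restricted_eigenvalue m0 _ _ _ M_large good_cone).
- by rewrite mulr_gt0 ?exprn_gt0 ?ltr0n// ltr_pwDl.
- move=> j; have /andP[_ h] := columns j; apply: (le_trans h).
  by rewrite ler_wpM2r//; move: delta1 => ?; lra.
- by move=> t; rewrite leNgt; apply/negP => h; apply: good_sparse; exists t.
Qed.

End good_events.

(** * Coverage *)

Section interval.
Context {R : realType}.

Lemma psi_le (sigma0 : R) n p (Z : 'M[R]_(n, p) * 'cV[R]_n) (b : 'cV[R]_p) :
  psi sigma0 Z b <= sqnorm (Z.2 - Z.1 *m b) / n%:R.
Proof. by rewrite /psi l2norm_sqr ge_min lexx. Qed.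

(** The lower endpoint needs only an upper bound on [psi], so truncation is harmless there; the
    upper endpoint needs [psi] to equal the untruncated residual. The first alternative is sparsity
    0, where the upper endpoint degenerates to 0. *)
Lemma mem_CI2 (sigma0 alpha q : R) (k n p : nat) (Z : 'M[R]_(n, p) * 'cV[R]_n)
    (b beta : 'cV[R]_p)
    (V := sqnorm (b - beta)) (W := sqnorm (Z.2 - Z.1 *m b) / (sigma0 ^+ 2 + V))
    (L := lqnorm q (b - beta) ^+ 2) :
  (0 < n)%N -> 0 < sigma0 ->
  0 < chi2_quantile (1 - alpha / 2) n -> 0 < chi2_quantile (alpha / 2) n ->
  W <= chi2_quantile (1 - alpha / 2) n -> V <= L ->
  (L = 0 /\ (16 * k%:R : R) `^ (2 / q - 1) = 0 \/
   [/\ L <= (16 * k%:R) `^ (2 / q - 1) * V, chi2_quantile (alpha / 2) n <= W &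
       (sigma0 ^+ 2 + V) * W / n%:R <= sigma0 ^+ 2 * ln p%:R]) ->
  L \in CI2 sigma0 alpha q k Z b.
Proof.
move=> n0 s0; set qa := chi2_quantile (1 - _) n; set qb := chi2_quantile _ n.
set K := _ `^ _ => qa0 qb0 Wqa VL cases.
have n_gt0 : 0 < n%:R :> R by rewrite ltr0n.
have V0 : 0 <= V := sqnorm_ge0 _.
have D0 : 0 < sigma0 ^+ 2 + V by rewrite ltr_pwDl// exprn_gt0.
have SE : sqnorm (Z.2 - Z.1 *m b) / n%:R = (sigma0 ^+ 2 + V) * W / n%:R.
  by rewrite /W [X in _ = X / _]mulrCA mulfV ?mulr1// gt_eqF.
clearbody W V.
rewrite /CI2 in_itv/= -/qa -/qb -/K; apply/andP; split.
  rewrite ge_max; apply/andP; split; last exact: sqr_ge0.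
  apply: le_trans VL; rewrite lerBlDr ler_pdivrMr ?mulr_gt0 ?invr_gt0//.
  apply: (le_trans (psi_le _ _ _)); rewrite SE [V + _]addrC.
  rewrite (mulrC _^-1) mulrA ler_pM2r ?invr_gt0//.
  by rewrite ler_wpM2l// ltW.
case: cases => [[-> K0]|[LK qbW trunc]]; first by rewrite K0 mul0r.
apply: (le_trans LK); rewrite ler_wpM2l ?powR_ge0//.
rewrite le_max; apply/orP; left.
have -> : psi sigma0 Z b = (sigma0 ^+ 2 + V) * W / n%:R.
  by rewrite /psi l2norm_sqr SE; apply/min_idPl.
rewrite lerBrDr ler_pdivlMr ?mulr_gt0 ?invr_gt0// [V + _]addrC.
by rewrite (mulrC _^-1) mulrA ler_pM2r ?invr_gt0// ler_wpM2l// ltW.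
Qed.

End interval.

Section subsample_events.
Context {R : realType} {d : measure_display} {T : measurableType d}.
Variable P : probability T R.
Local Notation RB := (measurableTypeR R).
Variables (n1 n2 p k : nat) (sigma0 : R) (theta : param R p).
Variables (X : {mfun T >-> 'M[R]_(n1 + n2, p)}) (y : {mfun T >-> 'cV[R]_(n1 + n2)}).
Variable pi : T -> 'S_(n1 + n2).
Hypotheses (s0 : 0 < sigma0) (Th : Theta0 sigma0 k theta).
Hypothesis lm : linear_model P theta X y.
Hypothesis split : random_split P X y pi.
Let beta := coef theta.
Let Z1 w := subsample1 (pi w) (X w) (y w).
Let Z2 w := subsample2 (pi w) (X w) (y w).

Lemma measurable_subsample1 s : measurable_fun setT
  (fun Z : 'M[R]_(n1 + n2, p) * 'cV[R]_(n1 + n2) => subsample1 s Z.1 Z.2).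
Proof.
by apply: measurable_fun_pair; apply: measurable_mx => i j; under eq_fun do rewrite !mxE;
  apply: measurable_mxE; [exact: measurable_fst|exact: measurable_snd].
Qed.

Lemma measurable_subsample2 s : measurable_fun setT
  (fun Z : 'M[R]_(n1 + n2, p) * 'cV[R]_(n1 + n2) => subsample2 s Z.1 Z.2).
Proof.
by apply: measurable_fun_pair; apply: measurable_mx => i j; under eq_fun do rewrite !mxE;
  apply: measurable_mxE; [exact: measurable_fst|exact: measurable_snd].
Qed.

Let pre1 (B : set ('M[R]_(n1, p) * 'cV[R]_n1)) s :
  set ('M[R]_(n1 + n2, p) * 'cV[R]_(n1 + n2)) :=
  [set Z | B (subsample1 s Z.1 Z.2)].

Let mpre1 B s : measurable B -> measurable (pre1 B s).
Proof.
by move=> mB; rewrite -[X in measurable X]setTI; exact: measurable_subsample1.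
Qed.

Lemma measurable_event1 B : measurable B -> measurable [set w | B (Z1 w)].
Proof.
by move=> mB; exact: (measurable_split split (fun s => mpre1 s mB)).
Qed.

(** For each fixed permutation the first subsample is the [sample] of some independent normal
    family, so a bound valid for all such families passes to the random split. *)
Lemma prob_event1 (B : set ('M[R]_(n1, p) * 'cV[R]_n1)) (c : R) : measurable B ->
  (forall g : 'I_n1 * 'I_p.+1 -> T -> R, iid_normal P g ->
     (P [set w | B (sample sigma0 beta g w)] <= c%:E)%E) ->
  (P [set w | B (Z1 w)] <= c%:E)%E.
Proof.
move=> mB h; apply: (@random_split_le _ _ _ P _ _ X y pi split (pre1 B)) => s.
  exact: mpre1.
have := h _ (iid_normal_sub1 s0 Th lm s).
by under eq_set do rewrite -(subsample1E X y s0 Th s).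
Qed.

Section bad.
Variables (tau s delta r c : R) (M0 : nat).
Hypotheses (tau0 : 0 <= tau) (s2 : 0 <= s < 2^-1) (d2 : 0 <= delta <= 2^-1).
Hypotheses (M1 : (0 < M0)%N) (k1 : (0 < k)%N) (p1 : (1 < p)%N).
Hypotheses (r0 : 0 < r) (n21 : n2%:R <= r * n1%:R) (c0 : 0 < c).
Hypothesis kn : k%:R * ln p%:R <= c * (n1 + n2)%:R.
Hypothesis cr : c * (1 + r) <= delta ^+ 2 / (64 * M0%:R).

Definition bad_sample : set ('M[R]_(n1, p) * 'cV[R]_n1) :=
  bad_noise sigma0 beta tau `|` (bad_columns delta `|` bad_sparse (M0 * k)).

Lemma measurable_bad_sample : measurable bad_sample.
Proof.
apply: measurableU; first exact: measurable_bad_noise.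
apply: measurableU; first exact: measurable_bad_columns.
exact: measurable_bad_sparse.
Qed.

Let p_exp : (p%:R : R) = expR (ln p%:R).
Proof. by rewrite lnK// posrE ltr0n (ltn_trans _ p1). Qed.

(** The union over columns costs one power of p, which is beaten as soon as s tau^2 > 1. *)
Lemma noise_bound :
  p%:R * ((Num.sqrt (1 - s *+ 2))^-1 * expR (- (s * (tau ^+ 2 * ln p%:R)))) =
  (Num.sqrt (1 - s *+ 2))^-1 * expR (- ((s * tau ^+ 2 - 1) * ln p%:R)).
Proof.
rewrite mulrCA {1}p_exp -expRD; congr (_ * expR _); ring.
Qed.

(** The smallness of [c] acts here: the entropies ln p of the columns and M0 k ln (2 p) of the
    integer vectors must stay below a small multiple of n1. *)
Let lnp : k%:R * ln p%:R <= delta ^+ 2 / (64 * M0%:R) * n1%:R.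
Proof.
apply: (le_trans kn); apply: (@le_trans _ _ (c * ((1 + r) * n1%:R))).
  by rewrite ler_pM2l// natrD mulrDl mul1r lerD2l.
by rewrite mulrA ler_wpM2r.
Qed.

Let lnp0 : 0 <= ln (p%:R : R). Proof. exact: ln_nat_ge0. Qed.

Lemma prob_bad_sample : (P [set w | bad_sample (Z1 w)] <=
  ((Num.sqrt (1 - s *+ 2))^-1 * expR (- ((s * tau ^+ 2 - 1) * ln p%:R)) +
   3 * expR (- (delta ^+ 2 / 32 * n1%:R)))%:E)%E.
Proof.
have M0R : 1 <= M0%:R :> R by rewrite ler1n.
have k1R : 1 <= k%:R :> R by rewrite ler1n.
have M0p : 0 < M0%:R :> R by rewrite ltr0n.
have /andP[d0 dh] := d2.
have mk : M0%:R * (k%:R * ln p%:R) <= delta ^+ 2 / 64 * n1%:R.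
  apply: (le_trans (ler_wpM2l (ltW M0p) lnp)).
  by rewrite le_eqVlt; apply/orP; left; apply/eqP; field; rewrite gt_eqF.
have l1 : ln p%:R <= delta ^+ 2 / 64 * n1%:R.
  apply: le_trans mk; rewrite mulrA ler_peMl// mulr_ege1//.
apply: prob_event1; first exact: measurable_bad_sample.
move=> g ig; pose S B := [set w | B (sample sigma0 beta g w)].
have mS B : measurable B -> measurable (S B).
  move=> mB; rewrite -[X in measurable X]setTI; exact: (measurable_sample sigma0 beta ig).
have mn := mS _ (@measurable_bad_noise R n1 p sigma0 beta tau).
have mc := mS _ (@measurable_bad_columns R n1 p delta).
have ms := mS _ (@measurable_bad_sparse R n1 p (M0 * k)).
rewrite (_ : mkset _ = S (bad_noise sigma0 beta tau) `|`
   (S (bad_columns delta) `|` S (bad_sparse (M0 * k))))//.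
apply: (le_trans (measureU2 _ mn (measurableU _ _ mc ms))).
rewrite EFinD; apply: leeD.
  by rewrite -noise_bound; exact: prob_bad_noise.
apply: (le_trans (measureU2 _ mc ms)).
have -> : 3 * expR (- (delta ^+ 2 / 32 * n1%:R)) =
  2 * expR (- (delta ^+ 2 / 32 * n1%:R)) + expR (- (delta ^+ 2 / 32 * n1%:R)) :> R.
  by ring.
rewrite EFinD; apply: leeD.
  have d1 : 0 <= delta <= 1 by apply/andP; split; lra.
  apply: (le_trans (prob_bad_columns sigma0 beta ig d1)).
  rewrite lee_fin mulrCA ler_pM2l// {1}p_exp -expRD ler_expR.
  have n0 : 0 <= n1%:R :> R by []; have := sqr_ge0 delta; nra.
apply: (le_trans (prob_bad_sparse sigma0 beta ig _)).
(* As p >= 2, the tuples cost at most 2 M0 k ln p <= delta^2 n1 / 32 in the exponent. With delta <=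
   1/2, subtracting n1 / 64 leaves at most - delta^2 n1 / 32. *)
have p2 : 2 * p%:R <= expR (2 * ln p%:R) :> R.
  have -> : 2 * ln p%:R = ln p%:R + ln p%:R :> R by ring.
  by rewrite expRD -p_exp ler_wpM2r// ler_nat.
rewrite lee_fin; apply: (@le_trans _ _ (expR (2 * ln p%:R) ^+ (M0 * k) * expR (- (n1%:R / 64)))).
  by rewrite ler_wpM2r ?expR_ge0// lerXn2r ?nnegrE ?expR_ge0 ?mulr_ge0.
rewrite -expRM_natl -expRD ler_expR natrM.
have n0 : 0 <= n1%:R :> R by [].
have dd : delta ^+ 2 <= 4^-1 by nra.
have := ler_wpM2r n0 dd; nra.
Qed.

End bad.

End subsample_events.

(** * Measurability of the coverage event *)

Section measurable_interval.
Context {R : realType} {d : measure_display} {S : measurableType d}.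
Variables (n p : nat) (sigma0 alpha q : R) (k : nat).
Variables (Z : S -> 'M[R]_(n, p) * 'cV[R]_n) (b : S -> 'cV[R]_p).
Hypotheses (mZ : measurable_fun setT Z) (mb : measurable_fun setT b).

Lemma measurable_psi : measurable_fun setT (fun w => psi sigma0 (Z w) (b w)).
Proof.
apply: measurable_minr => //; apply: measurable_funM => //.
under eq_fun do rewrite l2norm_sqr; apply: measurable_sqnorm; apply: measurable_mxB.
  exact: measurableT_comp mZ.
by apply: measurable_mxM => //; exact: measurableT_comp mZ.
Qed.

Lemma measurable_lqnorm : measurable_fun setT (fun w => lqnorm q (b w)).
Proof.
apply: (measurableT_comp (f := fun x : R => x `^ q^-1)); first exact: measurable_powR.
apply: measurable_sum => i.
apply: (measurableT_comp (f := fun x : R => x `^ q)); first exact: measurable_powR.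
by apply: measurableT_comp => //; exact: measurable_mxE.
Qed.

Lemma measurable_mem_CI2 (L : S -> R) : measurable_fun setT L ->
  measurable [set w | L w \in CI2 sigma0 alpha q k (Z w) (b w)].
Proof.
move=> mL; have mp := measurable_psi.
have mm c : measurable_fun setT (fun w => Num.max (psi sigma0 (Z w) (b w) / c - sigma0 ^+ 2) 0).
  apply: measurable_maxr => //; apply: measurable_funB => //.
  exact: measurable_funM.
rewrite (_ : mkset _ =
  [set w | Num.max (psi sigma0 (Z w) (b w) /
     (n%:R^-1 * chi2_quantile (1 - alpha / 2) n) - sigma0 ^+ 2) 0 <= L w] `&`
  [set w | L w <= (16 * k%:R) `^ (2 / q - 1) * Num.max (psi sigma0 (Z w) (b w) /
     (n%:R^-1 * chi2_quantile (alpha / 2) n) - sigma0 ^+ 2) 0]).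
  by apply: measurableI; apply: measurable_le_set => //; exact: measurable_funM.
apply/seteqP; split => w /=; rewrite /CI2 in_itv/=; first by move=> /andP[].
by move=> [-> ->].
Qed.

End measurable_interval.

Section coverage.
Context {R : realType} {d : measure_display} {T : measurableType d}.
Variable P : probability T R.
Local Notation RB := (measurableTypeR R).
Variables (n1 n2 p k : nat) (sigma0 : R) (theta : param R p).
Variables (X : {mfun T >-> 'M[R]_(n1 + n2, p)}) (y : {mfun T >-> 'cV[R]_(n1 + n2)}).
Variable pi : T -> 'S_(n1 + n2).
Variable b : {mfun ('M[R]_(n1, p) * 'cV[R]_n1)%type >-> 'cV[R]_p}.
Hypotheses (s0 : 0 < sigma0) (Th : Theta0 sigma0 k theta).
Hypothesis lm : linear_model P theta X y.
Hypothesis split : random_split P X y pi.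
Hypotheses (n1_gt0 : (0 < n1)%N) (n2_gt0 : (0 < n2)%N) (p1 : (1 < p)%N).
Let beta := coef theta.
Let Z1 w := subsample1 (pi w) (X w) (y w).
Let Z2 w := subsample2 (pi w) (X w) (y w).
Let Q w := residual_stat sigma0 b beta (Z1 w) (Z2 w).

Let mres s B : measurable B -> measurable
  [set Z : 'M[R]_(n1 + n2, p) * 'cV[R]_(n1 + n2) |
    B (residual_stat sigma0 b beta (subsample1 s Z.1 Z.2) (subsample2 s Z.1 Z.2))].
Proof.
move=> mB; rewrite -[X in measurable X]setTI.
have mr := measurable_residual_stat sigma0 b beta
  (@measurable_subsample1 R n1 n2 p s) (@measurable_subsample2 R n1 n2 p s).
exact: mr.
Qed.

Lemma measurable_residual : measurable_fun setT (Q : T -> RB).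
Proof.
move=> _ B mB; rewrite setTI.
exact: (measurable_split split (fun s => mres s mB)).
Qed.

Lemma residual_law (B : set RB) : measurable B -> P [set w | B (Q w)] = chi2_prob n2 B.
Proof.
move=> mB; rewrite -[RHS]fineK ?fin_num_measure//.
apply: (random_split_law split (fun s => mres s mB)) => s.
rewrite fineK ?fin_num_measure//.
exact: (residual_stat_law s0 Th lm s b mB).
Qed.

Variables (alpha q A : R).
Hypotheses (alpha01 : 0 < alpha < 1) (q12 : 1 <= q < 2) (A0 : 0 < A).
Hypothesis b_lasso : is_lasso sigma0 A b.

Let covered := [set w | lqnorm q (b (Z1 w) - beta) ^+ 2 \in
  CI2 sigma0 alpha q k (Z2 w) (b (Z1 w))].

Lemma measurable_covered : measurable covered.
Proof.
apply: (measurable_split split (F := fun s => [set Z |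
  lqnorm q (b (subsample1 s Z.1 Z.2) - beta) ^+ 2 \in
  CI2 sigma0 alpha q k (subsample2 s Z.1 Z.2) (b (subsample1 s Z.1 Z.2))])) => s.
have m1 := @measurable_subsample1 R n1 n2 p s.
have m2 := @measurable_subsample2 R n1 n2 p s.
have mb : measurable_fun setT (fun Z : 'M[R]_(n1 + n2, p) * 'cV[R]_(n1 + n2) =>
    b (subsample1 s Z.1 Z.2)) by exact: measurableT_comp m1.
apply: measurable_mem_CI2 => //; apply: measurable_funX; apply: measurable_lqnorm.
exact: measurable_mxB.
Qed.

Let a2 : 0 < alpha / 2 < 1.
Proof. by have /andP[? ?] := alpha01; apply/andP; split; lra. Qed.

Let a2' : 0 < 1 - alpha / 2 < 1.
Proof. by have /andP[? ?] := alpha01; apply/andP; split; lra. Qed.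

Let quantile_gt0 (t : R) : 0 < t < 1 -> 0 < chi2_quantile t n2.
Proof.
move=> t01; have [e e0 he] := chi2_quantile_ge t01.
by apply: lt_le_trans (he _ n2_gt0); rewrite mulr_gt0// ltr0n.
Qed.

Let qa := chi2_quantile (1 - alpha / 2) n2.
Let qb := chi2_quantile (alpha / 2) n2.

Let prob_above : (P [set w | (qa < Q w)%R] <= (alpha / 2)%:E)%E.
Proof.
have mB : measurable [set x : RB | qa < x] by exact: measurable_lt_set.
rewrite (residual_law mB); have := chi2_gt_quantile a2' n2_gt0.
by rewrite subKr.
Qed.

Let prob_below : (P [set w | (Q w < qb)%R] <= (alpha / 2)%:E)%E.
Proof.
have mB : measurable [set x : RB | x < qb] by exact: measurable_lt_set.
by rewrite (residual_law mB); exact: chi2_lt_quantile.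
Qed.

Let prob_twice : (P [set w | (2 * n2%:R <= Q w)%R] <= (expR (- (n2%:R / 16)))%:E)%E.
Proof.
have mB : measurable [set x : RB | 2 * n2%:R <= x] by exact: measurable_le_set.
rewrite (residual_law mB).
have d1 : 0 <= (1 : R) <= 1 by rewrite ler01 lexx.
apply: (le_trans _ (le_trans (chi2_upper_tail n2 d1) _)).
  by rewrite (_ : 1 + 1 = 2).
by rewrite lee_fin ler_expR expr1n mul1r mulrC.
Qed.

Let mQ := measurable_residual.

Let cover_ge (Bad : set T) (e : R) : measurable Bad -> (P Bad <= e%:E)%E ->
  ~` Bad `<=` covered -> ((1 - e)%:E <= P covered)%E.
Proof.
move=> mBad Pe sub; apply: (@le_trans _ _ (P (~` Bad))).
  rewrite probability_setC// EFinB; exact: leeB.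
apply: le_measure; rewrite ?inE//; first exact: measurableC.
exact: measurable_covered.
Qed.

Section positive_sparsity.
Variables (tau s delta r c : R) (M0 : nat).
Hypotheses (tau0 : 0 <= tau) (s2 : 0 <= s < 2^-1) (d2 : 0 <= delta <= 2^-1).
Hypotheses (M1 : (60 * 16 <= M0)%N) (k1 : (0 < k)%N).
Hypotheses (r0 : 0 < r) (n21 : n2%:R <= r * n1%:R) (c0 : 0 < c).
Hypothesis kn : k%:R * ln p%:R <= c * (n1 + n2)%:R.
Hypothesis cr : c * (1 + r) <= delta ^+ 2 / (64 * M0%:R).
Hypotheses (tauA : 2 * tau < A)
  (cone3 : (1 + 2 * tau / A) * (1 + delta) <= 3 * ((1 - 2 * tau / A) * (1 - delta))).
Hypothesis lnp_large : 2 * (1 + (64 * A) ^+ 2) <= ln p%:R.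

(** The level is spent as alpha / 2 on each side of the pivot [Q]; the further event that [Q]
    reaches 2 n2 is there to keep the truncation of [psi] inactive. *)
Lemma coverage_pos : ((1 - (alpha +
  ((Num.sqrt (1 - s *+ 2))^-1 * expR (- ((s * tau ^+ 2 - 1) * ln p%:R)) +
   3 * expR (- (delta ^+ 2 / 32 * n1%:R)) + expR (- (n2%:R / 16)))))%:E <= P covered)%E.
Proof.
have M0p : (0 < M0)%N by exact: leq_trans M1.
have /andP[d0 dh] := d2.
have mB1 := measurable_event1 split (@measurable_bad_sample R n1 p k sigma0 theta tau delta M0).
have PB1 := prob_bad_sample s0 Th lm split tau0 s2 d2 M0p k1 p1 n21 c0 kn cr.
have ma : measurable [set w | qa < Q w] by exact: measurable_lt_set.
have mb : measurable [set w | Q w < qb] by exact: measurable_lt_set.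
have mt : measurable [set w | 2 * n2%:R <= Q w] by exact: measurable_le_set.
apply: (@cover_ge ([set w | bad_sample k sigma0 theta tau delta M0 (Z1 w)] `|`
  ([set w | qa < Q w] `|` ([set w | Q w < qb] `|` [set w | 2 * n2%:R <= Q w])))).
- by do 3 (apply: measurableU => //).
- have mU1 := measurableU _ _ mb mt; have mU2 := measurableU _ _ ma mU1.
  apply: (le_trans (measureU2 _ mB1 mU2)).
  set e1 := (_ + 3 * _); set e2 := expR (- (n2%:R / 16)).
  have -> : alpha + (e1 + e2) = e1 + (alpha / 2 + (alpha / 2 + e2)) by field.
  rewrite EFinD; apply: leeD; first exact: PB1.
  apply: (le_trans (measureU2 _ ma mU1)); rewrite EFinD; apply: leeD => //.
  by apply: (le_trans (measureU2 _ mb mt)); rewrite EFinD; apply: leeD.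
move=> w /= /not_orP[gB /not_orP[ga /not_orP[gb gt]]].
have gN : ~ bad_noise sigma0 beta tau (Z1 w) by move=> h; apply: gB; left.
have gC : ~ bad_columns delta (Z1 w) by move=> h; apply: gB; right; left.
have gS : ~ bad_sparse (M0 * k) (Z1 w) by move=> h; apply: gB; right; right.
have [sp _ _] := Th.
have delta1 : delta < 1 by lra.
have n1R : 0 < n1%:R :> R by rewrite ltr0n.
have n2R : 0 < n2%:R :> R by rewrite ltr0n.
(* The 60 comes from [restricted_eigenvalue], and 16 = (1 + 3)^2 from the cone constant 3. *)
have M_large : 60 * ((1 + 3) ^+ 2 * k%:R) <= (M0 * k)%:R :> R.
  have : (60 * 16)%:R <= M0%:R :> R by rewrite ler_nat.
  by rewrite natrM natrM => h; rewrite mulrA ler_wpM2r//; lra.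
have cone := good_cone n1_gt0 p1 s0 A0 (b_lasso (Z1 w) beta) tau0 tauA gN d0 delta1
  sp gC (ler0n R 3) cone3.
have rate := good_rate n1_gt0 p1 s0 A0 (b_lasso (Z1 w) beta) tau0 tauA gN d0 delta1
  k1 sp gC gS (ler0n R 3) cone3 M_large.
rewrite /covered/=; set v := b (Z1 w) - beta in cone rate *.
have V0 : 0 <= sqnorm v := sqnorm_ge0 _.
have QD : sqnorm ((Z2 w).2 - (Z2 w).1 *m b (Z1 w)) / (sigma0 ^+ 2 + sqnorm v) = Q w.
  by [].
apply: mem_CI2 => //; try exact: quantile_gt0.
- by rewrite -/v QD leNgt; apply/negP.
- exact: sqnorm_le_lqnorm.
right; rewrite -/v QD; split.
- apply: lqnorm_le_sqnorm => //; apply: (le_trans cone).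
  by rewrite le_eqVlt; apply/orP; left; apply/eqP; ring.
- by rewrite leNgt; apply/negP.
have Q2 : Q w <= 2 * n2%:R by rewrite ltW// ltNge; apply/negP.
have kl : k%:R * (ln p%:R / n1%:R) <= 1 :> R.
  rewrite mulrA ler_pdivrMr// mul1r; apply: (le_trans kn).
  apply: (@le_trans _ _ (c * (1 + r) * n1%:R)).
    by rewrite -mulrA ler_pM2l// natrD mulrDl mul1r lerD2l.
  have M0R : 1 <= M0%:R :> R by rewrite ler1n.
  have : delta ^+ 2 / (64 * M0%:R) <= 1 :> R.
    rewrite ler_pdivrMr ?mul1r; last by lra.
    have : delta ^+ 2 <= 1 by nra.
    lra.
  by move=> h; rewrite ler_piMl//; exact: le_trans cr h.
have V1 : sqnorm v <= (64 * A) ^+ 2 * sigma0 ^+ 2.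
  apply: (le_trans rate); rewrite ler_wpM2r ?sqr_ge0// ler_piMr// sqr_ge0//.
rewrite ler_pdivrMr//.
(* With [Q] at most 2 n2, the residual mean square is at most 2 (1 + (64 A)^2) sigma0^2, which
   [lnp_large] puts below the truncation level. *)
apply: (@le_trans _ _ ((sigma0 ^+ 2 + (64 * A) ^+ 2 * sigma0 ^+ 2) * (2 * n2%:R))).
  apply: (@le_trans _ _ ((sigma0 ^+ 2 + sqnorm v) * (2 * n2%:R))).
    by rewrite ler_wpM2l// addr_ge0 ?sqr_ge0.
  by rewrite ler_wpM2r ?mulr_ge0 ?lerD2l// ltW.
have -> : (sigma0 ^+ 2 + (64 * A) ^+ 2 * sigma0 ^+ 2) * (2 * n2%:R) =
  sigma0 ^+ 2 * (2 * (1 + (64 * A) ^+ 2)) * n2%:R by ring.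
by rewrite ler_pM2r// ler_wpM2l ?sqr_ge0.
Qed.

End positive_sparsity.

Section zero_sparsity.
Variables (tau s : R).
Hypotheses (tau0 : 0 <= tau) (s2 : 0 <= s < 2^-1) (k0 : k = 0%N).
Hypothesis tauA : 2 * tau < A.

Lemma prob_bad_null : (P [set w | (bad_noise sigma0 beta tau `|` @null_column R n1 p) (Z1 w)] <=
  ((Num.sqrt (1 - s *+ 2))^-1 * expR (- ((s * tau ^+ 2 - 1) * ln p%:R)))%:E)%E.
Proof.
apply: (prob_event1 s0 Th lm split).
  by apply: measurableU; [exact: measurable_bad_noise|exact: measurable_null_column].
move=> g ig; pose S B := [set w | B (sample sigma0 beta g w)].
have mS B : measurable B -> measurable (S B).
  move=> mB; rewrite -[X in measurable X]setTI; exact: (measurable_sample sigma0 beta ig).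
have mn := mS _ (@measurable_bad_noise R n1 p sigma0 beta tau).
have mc := mS _ (@measurable_null_column R n1 p).
apply: (le_trans (measureU2 _ mn mc)).
rewrite -[leRHS]adde0; apply: leeD; last exact: prob_null_column.
by rewrite -noise_bound//; exact: prob_bad_noise.
Qed.

Lemma null_estimate w : ~ (bad_noise sigma0 beta tau `|` @null_column R n1 p) (Z1 w) ->
  b (Z1 w) - beta = 0.
Proof.
move=> gB; have [sp _ _] := Th.
apply: (good_null n1_gt0 p1 s0 A0 (b_lasso (Z1 w) beta) tauA).
- by move=> h; apply: gB; left.
- by apply/eqP; rewrite -leqn0 -k0.
- by move=> h; apply: gB; right.
Qed.

(** The upper endpoint is 0 and the Lasso error vanishes off the bad event, so only the lower
    endpoint has to be controlled, at the cost alpha / 2 <= alpha. *)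
Lemma coverage_null : ((1 - (alpha +
  (Num.sqrt (1 - s *+ 2))^-1 * expR (- ((s * tau ^+ 2 - 1) * ln p%:R))))%:E <= P covered)%E.
Proof.
have mB1 := measurable_event1 split (measurableU _ _
  (@measurable_bad_noise R n1 p sigma0 beta tau) (@measurable_null_column R n1 p)).
have ma : measurable [set w | qa < Q w] by exact: measurable_lt_set.
apply: (@cover_ge ([set w | (bad_noise sigma0 beta tau `|` @null_column R n1 p) (Z1 w)] `|`
  [set w | qa < Q w])).
- exact: measurableU.
- apply: (le_trans (measureU2 _ mB1 ma)); rewrite addrC EFinD; apply: leeD.
    by apply: (le_trans prob_above); rewrite lee_fin; have /andP[? ?] := alpha01; lra.
  exact: prob_bad_null.
move=> w /= /not_orP[gB ga]; have v0 := null_estimate gB.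
have QD : sqnorm ((Z2 w).2 - (Z2 w).1 *m b (Z1 w)) /
  (sigma0 ^+ 2 + sqnorm (b (Z1 w) - beta)) = Q w by [].
have [q1 q2] := andP q12; have q0 : 0 < q by lra.
apply: mem_CI2 => //; try exact: quantile_gt0.
- by rewrite QD leNgt; apply/negP.
- exact: sqnorm_le_lqnorm.
left; split; first by rewrite v0 lqnorm0// expr0n.
rewrite k0 mulr0 powR0// gt_eqF// subr_gt0 ltr_pdivlMr// mul1r//.
Qed.

End zero_sparsity.

End coverage.

(** * Expected length *)

Section interval_length.
Context {R : realType}.
Variables (sigma0 alpha q : R) (k n p : nat).
Variables (Z : 'M[R]_(n, p) * 'cV[R]_n) (b : 'cV[R]_p).
Let qb : R := chi2_quantile (alpha / 2) n.
Let K : R := (16 * k%:R) `^ (2 / q - 1).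

(** The lower endpoint is nonnegative, so the upper one bounds the length; having sigma0^2
    subtracted, it is itself small enough for the claimed rate. *)
Lemma measure_CI2_le :
  (lebesgue_measure [set` CI2 sigma0 alpha q k Z b] <=
   (K * Num.max (psi sigma0 Z b / (n%:R^-1 * qb) - sigma0 ^+ 2) 0)%:E)%E.
Proof.
have h0 : 0 <= K * Num.max (psi sigma0 Z b / (n%:R^-1 * qb) - sigma0 ^+ 2) 0.
  by rewrite mulr_ge0 ?powR_ge0// le_max lexx orbT.
rewrite /CI2 -/qb -/K lebesgue_measure_itv/=; case: ifP => _; last by rewrite lee_fin.
by rewrite -EFinB lee_fin lerBlDr lerDl le_max lexx orbT.
Qed.

Variables (beta : 'cV[R]_p) (c0 K0 v : R).
Let V := sqnorm (b - beta).
Let W := sqnorm (Z.2 - Z.1 *m b) / (sigma0 ^+ 2 + V).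
Hypotheses (n0 : (0 < n)%N) (s0 : 0 < sigma0) (c0_gt0 : 0 < c0) (v0 : 0 <= v).
Hypotheses (qb_ge : c0 * n%:R <= qb) (qb_dev : `|qb - n%:R| <= K0 * Num.sqrt n%:R).

(** One inequality covers both cases so that it can be integrated as it stands. On the bad event
    [psi] is cut at sigma0^2 ln p; off it, [V] gives way to the deterministic [v], and what remains
    is |W - n| plus the deviation of the quantile from n. *)
Lemma width_le (bad : bool) : (~~ bad -> V <= v * sigma0 ^+ 2) ->
  Num.max (psi sigma0 Z b / (n%:R^-1 * qb) - sigma0 ^+ 2) 0 <=
  sigma0 ^+ 2 / (c0 * n%:R) * ((1 + v) * `|W - n%:R| + (K0 * Num.sqrt n%:R + v * n%:R)) +
  sigma0 ^+ 2 / c0 * ln p%:R * bad%:R.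
Proof.
move=> hV.
have n_gt0 : 0 < n%:R :> R by rewrite ltr0n.
have cn : 0 < c0 * n%:R by exact: mulr_gt0.
have qb0 : 0 < qb by exact: lt_le_trans qb_ge.
have V0 : 0 <= V := sqnorm_ge0 _.
have D0 : 0 < sigma0 ^+ 2 + V by rewrite ltr_pwDl// exprn_gt0.
have W0 : 0 <= W by rewrite divr_ge0 ?sqnorm_ge0// ltW.
have l0 : 0 <= ln (p%:R : R) := ln_nat_ge0 p.
have s2 : 0 < sigma0 ^+ 2 by rewrite exprn_gt0.
have a0 : 0 <= `|W - n%:R| := normr_ge0 _.
have Ks : 0 <= K0 * Num.sqrt n%:R by apply: le_trans qb_dev.
have T1 : 0 <= sigma0 ^+ 2 / (c0 * n%:R) *
    ((1 + v) * `|W - n%:R| + (K0 * Num.sqrt n%:R + v * n%:R)).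
  apply: mulr_ge0; first by rewrite divr_ge0// ltW.
  by rewrite addr_ge0// ?addr_ge0// mulr_ge0// addr_ge0.
have T2 : 0 <= sigma0 ^+ 2 / c0 * ln p%:R * bad%:R.
  by rewrite mulr_ge0// mulr_ge0// divr_ge0// ltW.
rewrite ge_max addr_ge0// andbT lerBlDr.
case: bad hV T2 => [_ _|/(_ isT) hV _].
  apply: (@le_trans _ _ (sigma0 ^+ 2 / c0 * ln p%:R)); last first.
    by rewrite mulr1 -addrA addrCA lerDl addr_ge0// ltW.
  have -> : sigma0 ^+ 2 / c0 * ln p%:R = sigma0 ^+ 2 * ln p%:R / c0 by rewrite mulrAC.
  apply: (@le_trans _ _ (sigma0 ^+ 2 * ln p%:R / (n%:R^-1 * qb))).
    by rewrite ler_pM2r ?invr_gt0 ?mulr_gt0 ?invr_gt0// /psi ge_min lexx orbT.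
  apply: ler_wpM2l; first by rewrite mulr_ge0// ltW.
  rewrite lef_pV2 ?posrE ?mulr_gt0 ?invr_gt0//.
  by rewrite mulrC ler_pdivlMr.
rewrite mulr0 addr0.
have SE : sqnorm (Z.2 - Z.1 *m b) = (sigma0 ^+ 2 + V) * W.
  by rewrite /W mulrCA mulfV ?mulr1// gt_eqF.
apply: (@le_trans _ _ ((sigma0 ^+ 2 + V) * W / qb)).
  rewrite ler_pdivrMr ?mulr_gt0 ?invr_gt0//; apply: (le_trans (psi_le _ _ _)).
  by rewrite SE (mulrC n%:R^-1) [_ / qb * _]mulrA divfK ?gt_eqF.
rewrite ler_pdivrMr// mulrDl.
set a := `|W - n%:R| in a0 T1 *.
have Wle : W <= n%:R + a by have := ler_norm (W - n%:R); rewrite -/a; lra.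
have nle : n%:R <= qb + K0 * Num.sqrt n%:R.
  by have := ler_norm (n%:R - qb); rewrite distrC; move: qb_dev; lra.
set X := _ + (_ + v * _); have X0 : 0 <= X.
  by rewrite addr_ge0// ?addr_ge0// mulr_ge0// addr_ge0.
have h1 : sigma0 ^+ 2 * X <= sigma0 ^+ 2 / (c0 * n%:R) * X * qb.
  have -> : sigma0 ^+ 2 / (c0 * n%:R) * X * qb = sigma0 ^+ 2 * (X * (qb / (c0 * n%:R))).
    by ring.
  by rewrite ler_pM2l// ler_peMr// ler_pdivlMr// mul1r.
rewrite mulrDl; apply: (le_trans _ (lerD h1 (lexx _))); rewrite -mulrDr.
apply: (@le_trans _ _ (sigma0 ^+ 2 * ((1 + v) * W))).
  rewrite -mulrDl mulrA ler_wpM2r// mulrDr mulr1 lerD2l mulrC//.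
rewrite ler_pM2l// /X; have := ler_wpM2l v0 Wle; lra.
Qed.

End interval_length.

Section expected_length.
Context {R : realType} {d : measure_display} {T : measurableType d}.
Variable P : probability T R.
Local Notation RB := (measurableTypeR R).
Variables (n1 n2 p k1 k2 : nat) (sigma0 : R) (theta : param R p).
Variables (X : {mfun T >-> 'M[R]_(n1 + n2, p)}) (y : {mfun T >-> 'cV[R]_(n1 + n2)}).
Variable pi : T -> 'S_(n1 + n2).
Variable b : {mfun ('M[R]_(n1, p) * 'cV[R]_n1)%type >-> 'cV[R]_p}.
Hypotheses (s0 : 0 < sigma0) (Th : Theta0 sigma0 k1 theta).
Hypothesis lm : linear_model P theta X y.
Hypothesis split : random_split P X y pi.
Hypotheses (n1_gt0 : (0 < n1)%N) (n2_gt0 : (0 < n2)%N).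
Variables (alpha q : R).
Let beta := coef theta.
Let Z1 w := subsample1 (pi w) (X w) (y w).
Let Z2 w := subsample2 (pi w) (X w) (y w).
Let Q w := residual_stat sigma0 b beta (Z1 w) (Z2 w).
Let qb : R := chi2_quantile (alpha / 2) n2.
Variables (c0 K0 v e : R) (Bad : set T).
Hypotheses (c0_gt0 : 0 < c0) (K00 : 0 <= K0) (v0 : 0 <= v).
Hypotheses (qb_ge : c0 * n2%:R <= qb) (qb_dev : `|qb - n2%:R| <= K0 * Num.sqrt n2%:R).
Hypotheses (mBad : measurable Bad) (PBad : (P Bad <= e%:E)%E).
Hypothesis good : forall w, ~ Bad w -> sqnorm (b (Z1 w) - beta) <= v * sigma0 ^+ 2.

Let C0 : R := 8 * expR 4^-1.

(** The bound of [width_le] sees the Lasso error only through the constant [v] and the indicator of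
    [Bad], so the chi-square law of [Q] alone yields the expectation. *)
Lemma expected_length_le :
  (\int[P]_w lebesgue_measure [set` CI2 sigma0 alpha q k2 (Z2 w) (b (Z1 w))] <=
   ((16 * k2%:R) `^ (2 / q - 1) * (sigma0 ^+ 2 / c0 *
     ((C0 + K0) / Num.sqrt n2%:R + v * (1 + C0) + ln p%:R * e)))%:E)%E.
Proof.
have n_gt0 : 0 < n2%:R :> R by rewrite ltr0n.
have sn0 : 0 < Num.sqrt n2%:R :> R by rewrite sqrtr_gt0.
have l0 : 0 <= ln (p%:R : R) := ln_nat_ge0 p.
have C00 : 0 <= C0 by rewrite mulr_ge0// expR_ge0.
pose K := (16 * k2%:R) `^ (2 / q - 1) : R.
have K_ge0 : 0 <= K by exact: powR_ge0.
pose a := K * (sigma0 ^+ 2 / (c0 * n2%:R) * (1 + v)).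
pose a' := K * (sigma0 ^+ 2 / (c0 * n2%:R) * (K0 * Num.sqrt n2%:R + v * n2%:R)).
pose a'' := K * (sigma0 ^+ 2 / c0 * ln p%:R).
have scn : 0 <= sigma0 ^+ 2 / (c0 * n2%:R).
  by rewrite divr_ge0 ?sqr_ge0// ltW// mulr_gt0.
have a0 : 0 <= a by do 2 apply: mulr_ge0 => //; rewrite addr_ge0.
have a'0 : 0 <= a' by do 2 apply: mulr_ge0 => //; rewrite addr_ge0// mulr_ge0// ltW.
have a''0 : 0 <= a'' by do 2 apply: mulr_ge0 => //; rewrite divr_ge0 ?sqr_ge0// ltW.
pose f (x : RB) : \bar R := (a%:E * `|x - n2%:R|%:E + a'%:E)%E.
have f0 x : (0 <= f x)%E by rewrite /f -EFinM -EFinD lee_fin addr_ge0// mulr_ge0.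
have mdev : measurable_fun setT (fun x : RB => `|(x : R) - n2%:R|%:E : \bar R).
  by apply/measurable_EFinP; apply: measurableT_comp => //; exact: measurable_funB.
have mf : measurable_fun setT f.
  by apply: emeasurable_funD => //; exact: emeasurable_funM.
have mQ := measurable_residual sigma0 theta b split.
have mfQ : measurable_fun setT (fun w => f (Q w)) by exact: (measurableT_comp mf mQ).
apply: (@le_trans _ _ (\int[P]_w (f (Q w) + a''%:E * (\1_Bad w)%:E))%E).
  apply: ge0_le_integralT => [w|w]; first exact: measure_ge0.
  apply: (le_trans (measure_CI2_le _ _ _ _ _ _)).
  rewrite /f -!EFinM -!EFinD lee_fin.
  have -> : \1_Bad w = (w \in Bad)%:R :> R by rewrite indicE.
  apply: (@le_trans _ _ (K * (sigma0 ^+ 2 / (c0 * n2%:R) *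
    ((1 + v) * `|Q w - n2%:R| + (K0 * Num.sqrt n2%:R + v * n2%:R)) +
    sigma0 ^+ 2 / c0 * ln p%:R * (w \in Bad)%:R))).
    apply: ler_wpM2l => //; apply: width_le => //.
    by move=> /negP hB; apply: good => h; apply: hB; rewrite inE.
  by rewrite le_eqVlt; apply/orP; left; apply/eqP; rewrite /a /a' /a''; ring.
rewrite ge0_integralD//; last 2 first.
- by move=> w _; rewrite -EFinM lee_fin mulr_ge0// indicE.
- by apply: emeasurable_funM => //; apply/measurable_EFinP.
rewrite (integral_law mQ (residual_law b s0 Th lm split) mf f0) /f.
rewrite ge0_integralD//; last 2 first.
- by move=> x _; rewrite -EFinM lee_fin mulr_ge0.
- exact: emeasurable_funM.
rewrite ge0_integralZl_EFin// ge0_integralZl_EFin//; last exact/measurable_EFinP.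
rewrite integral_indic// setIT.
have cst : (\int[@chi2_prob R n2]__ a'%:E <= a'%:E)%E.
  rewrite integral_cst// -[leRHS]mule1; apply: lee_wpmul2l; first by rewrite lee_fin.
  exact: probability_le1.
have dev := @chi2_abs_dev R n2.
have a0E : (0 <= a%:E)%E by rewrite lee_fin.
have a''0E : (0 <= a''%:E)%E by rewrite lee_fin.
apply: (le_trans (leeD (leeD (lee_wpmul2l a0E dev) cst) (lee_wpmul2l a''0E PBad))).
rewrite -!EFinM -!EFinD lee_fin -/C0.
have sE : n2%:R = Num.sqrt n2%:R * Num.sqrt n2%:R :> R.
  by rewrite -expr2 sqr_sqrtr ?ler0n.
have s1 : 1 <= Num.sqrt n2%:R :> R by rewrite -[leLHS]sqrtr1 ler_wsqrtr// ler1n.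
have -> : a * (C0 * Num.sqrt n2%:R) + a' + a'' * e = K * (sigma0 ^+ 2 / c0 *
   ((C0 + K0) / Num.sqrt n2%:R + v * (1 + C0 / Num.sqrt n2%:R) + ln p%:R * e)).
  rewrite /a /a' /a''; set rt := Num.sqrt n2%:R in sE sn0 *; rewrite sE; field.
  by rewrite !gt_eqF.
rewrite -/K ler_wpM2l// ler_wpM2l ?divr_ge0 ?sqr_ge0 ?(ltW c0_gt0)//.
rewrite lerD2r lerD2l ler_wpM2l// lerD2l ler_pdivrMr// ler_peMr//.
Qed.

End expected_length.

(** * Elementary bounds that reduce tail terms to 1 / sqrt n *)

Section tails.
Context {R : realType}.

Lemma expRN_le_invr2 (x : R) : 0 < x -> expR (- x) <= 4 / x ^+ 2.
Proof.
move=> x0; have h : x / 2 <= expR (x / 2).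
  by apply: le_trans (expR_ge1Dx _); rewrite lerDr.
have -> : - x = - (x / 2 + x / 2) by field.
rewrite expRN expRD ler_pdivlMr ?exprn_gt0// ler_pdivrMl ?mulr_gt0 ?expR_gt0//.
have x20 : 0 <= x / 2 by rewrite divr_ge0// ltW.
have := ler_pM x20 x20 h h; set y := expR _ * _; lra.
Qed.

Lemma sqrt_nat_le (n : nat) : Num.sqrt n%:R <= n%:R :> R.
Proof.
have [->|n0] := posnP n; first by rewrite sqrtr0.
rewrite -[leRHS]sqr_sqrtr// expr2 ler_peMr ?sqrtr_ge0//.
by rewrite -[leLHS]sqrtr1 ler_wsqrtr// ler1n.
Qed.

(** The left side is 2 ln p / p^2 <= 2 / p, and p >= n. *)
Lemma ln_le_sqrt_tail (p n : nat) : (0 < n)%N -> (n <= p)%N ->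
  ln p%:R * (2 * expR (- (2 * ln p%:R))) <= 2 / Num.sqrt n%:R :> R.
Proof.
move=> n0 np; have p0 : (0 < p)%N by exact: leq_trans np.
have pR : 0 < p%:R :> R by rewrite ltr0n.
have -> : - (2 * ln p%:R) = - ln p%:R - ln p%:R :> R by ring.
have lp : ln p%:R <= p%:R :> R by exact/ltW/ln_sublinear.

rewrite expRD expRN lnK ?posrE//.
have -> : ln p%:R * (2 * (p%:R^-1 / p%:R)) = 2 * (ln p%:R / p%:R / p%:R) :> R by ring.
rewrite ler_pM2l//; apply: (@le_trans _ _ p%:R^-1).
  by rewrite ler_piMl ?invr_ge0// ler_pdivrMr// mul1r.
have nR : 0 < n%:R :> R by rewrite ltr0n.
rewrite lef_pV2 ?posrE ?sqrtr_gt0//.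
apply: (@le_trans _ _ (n%:R : R)); last by rewrite ler_nat.
exact: sqrt_nat_le.
Qed.

Lemma mul_expRN_le (h : R) (n : nat) : 0 < h -> (0 < n)%N ->
  n%:R * expR (- (h * n%:R)) <= 4 / h ^+ 2 / Num.sqrt n%:R.
Proof.
move=> h0 n0; have nR : 0 < n%:R :> R by rewrite ltr0n.
have hn : 0 < h * n%:R by exact: mulr_gt0.
apply: (le_trans (ler_wpM2l (ltW nR) (expRN_le_invr2 hn))).
have -> : n%:R * (4 / (h * n%:R) ^+ 2) = 4 / h ^+ 2 / n%:R.
  by field; rewrite !gt_eqF.
rewrite ler_wpM2l ?divr_ge0 ?sqr_ge0// lef_pV2 ?posrE ?sqrtr_gt0//.
exact: sqrt_nat_le.
Qed.

(** The factor 1 + r is a crude substitute for its square root. *)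
Lemma invr_sqrt_le (r : R) (m n : nat) : 0 <= r -> (0 < m)%N -> (0 < n)%N ->
  n%:R <= (1 + r) * m%:R -> (Num.sqrt m%:R)^-1 <= (1 + r) / Num.sqrt n%:R.
Proof.
move=> r0 m0 n0 h; have mR : 0 < m%:R :> R by rewrite ltr0n.
have nR : 0 < n%:R :> R by rewrite ltr0n.
rewrite ler_pdivlMr ?sqrtr_gt0// mulrC ler_pdivrMr ?sqrtr_gt0//.
have r1 : 0 <= 1 + r by rewrite addr_ge0.
apply: (@le_trans _ _ (Num.sqrt ((1 + r) ^+ 2 * m%:R))); last first.
  by rewrite sqrtrM ?sqr_ge0// sqrtr_sqr ger0_norm.
rewrite ler_wsqrtr//; apply: (le_trans h); rewrite ler_pM2r// expr2 ler_peMr//.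
by rewrite lerDl.
Qed.

Lemma powRM16_le (x e : R) : 0 <= x -> 0 <= e <= 1 -> (16 * x) `^ e <= 16 * x `^ e.
Proof.
move=> x0 /andP[e0 e1]; rewrite powRM// ler_wpM2r ?powR_ge0//.
by rewrite -[leRHS]powRr1// ler_powR// ler1n.
Qed.

End tails.

Section length_bound.
Context {R : realType} {d : measure_display} {T : measurableType d}.
Variable P : probability T R.
Variables (n1 n2 p k1 k2 : nat) (sigma0 : R) (theta : param R p).
Variables (X : {mfun T >-> 'M[R]_(n1 + n2, p)}) (y : {mfun T >-> 'cV[R]_(n1 + n2)}).
Variable pi : T -> 'S_(n1 + n2).
Variable b : {mfun ('M[R]_(n1, p) * 'cV[R]_n1)%type >-> 'cV[R]_p}.
Hypotheses (s0 : 0 < sigma0) (Th : Theta0 sigma0 k1 theta).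
Hypothesis lm : linear_model P theta X y.
Hypothesis split : random_split P X y pi.
Hypotheses (n1_gt0 : (0 < n1)%N) (n2_gt0 : (0 < n2)%N) (np : (n1 + n2 <= p)%N).
Variables (alpha q A : R).
Hypotheses (q12 : 1 <= q < 2) (A_gt : 4 * Num.sqrt 2 < A).
Hypothesis b_lasso : is_lasso sigma0 A b.
Let beta := coef theta.
Let Z1 w := subsample1 (pi w) (X w) (y w).
Let Z2 w := subsample2 (pi w) (X w) (y w).
Variables (r c kappa c0 K0 : R) (M0 : nat).
Hypotheses (r0 : 0 < r) (n12 : n1%:R <= r * n2%:R) (n21 : n2%:R <= r * n1%:R).
Hypotheses (c_gt0 : 0 < c) (kn : k1%:R * ln p%:R <= c * (n1 + n2)%:R).
Hypotheses (M0_gt0 : (0 < M0)%N) (cr : c * (1 + r) <= 2^-1 ^+ 2 / (64 * M0%:R)).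
(* With [tau ^+ 2 = 8] the exceptional event has probability of order [p ^- 2],
   which absorbs the truncation level [ln p] of [psi]. *)
Let tau : R := 2 * Num.sqrt 2.
Hypotheses (kappa0 : 0 <= kappa)
  (kappaE : (1 + 2 * tau / A) * (1 + 2^-1) <= kappa * ((1 - 2 * tau / A) * (1 - 2^-1)))
  (M_large : 60 * (1 + kappa) ^+ 2 <= M0%:R).
Let qb : R := chi2_quantile (alpha / 2) n2.
Hypotheses (c0_gt0 : 0 < c0) (K00 : 0 <= K0).
Hypotheses (qb_ge : c0 * n2%:R <= qb) (qb_dev : `|qb - n2%:R| <= K0 * Num.sqrt n2%:R).

Let tau0 : 0 <= tau. Proof. by rewrite mulr_ge0// sqrtr_ge0. Qed.
Let tauA : 2 * tau < A. Proof. by rewrite /tau mulrA -natrM. Qed.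
Let A0 : 0 < A. Proof. by apply: le_lt_trans tauA; rewrite mulr_ge0. Qed.
Let p1 : (1 < p)%N. Proof. by apply: leq_trans np; rewrite -[2%N]/(1 + 1)%N leq_add. Qed.
Let h : R := 2^-1 ^+ 2 / 32.
Let h0 : 0 < h. Proof. by rewrite /h divr_gt0// exprn_gt0. Qed.
(** At the tilt 3/8 the prefactor (1 - 2 s)^(-1/2) equals 2 and, with tau^2 = 8, the exponent s
    tau^2 - 1 equals 2. *)
Let s2 : 0 <= (3 / 8 : R) < 2^-1. Proof. by apply/andP; split; lra. Qed.

Let noiseE : (Num.sqrt (1 - (3 / 8) *+ 2))^-1 *
  expR (- ((3 / 8 * tau ^+ 2 - 1) * ln p%:R)) = 2 * expR (- (2 * ln p%:R)) :> R.
Proof.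
have -> : 1 - (3 / 8) *+ 2 = 2^-1 ^+ 2 :> R by rewrite mulr2n; field.
rewrite sqrtr_sqr ger0_norm ?invr_ge0// invrK.
have -> : 3 / 8 * tau ^+ 2 - 1 = 2 by rewrite /tau exprMn sqr_sqrtr//; field.
by [].
Qed.

(** For k1 = 0 the ratio ln p / n is not bounded, and a probability of order exp (- h n1) need not
    offset the truncation level ln p. Exact recovery avoids the column and sparse-vector events in
    that case, which the factor [(0 < k1)] records. *)
Lemma rate_event : exists Bad : set T, [/\ measurable Bad,
  (P Bad <= (2 * expR (- (2 * ln p%:R)) +
     3 * expR (- (h * n1%:R)) * (0 < k1)%N%:R)%:E)%E &
  forall w, ~ Bad w -> sqnorm (b (Z1 w) - beta) <=
    (64 * A) ^+ 2 * (k1%:R * (ln p%:R / n1%:R)) * sigma0 ^+ 2].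
Proof.
have [k0|k0] := posnP k1.
  exists [set w | (bad_noise sigma0 beta tau `|` @null_column R n1 p) (Z1 w)]; split.
  - exact: (measurable_event1 split (measurableU _ _
      (@measurable_bad_noise R n1 p sigma0 beta tau) (@measurable_null_column R n1 p))).
  - rewrite mulr0 addr0 -noiseE.
    exact: (prob_bad_null s0 Th lm split n1_gt0 p1 tau0 s2).
  - move=> w gB; rewrite (null_estimate s0 Th n1_gt0 p1 A0 b_lasso k0 tauA gB) k0.
    by rewrite mul0r mulr0 mul0r /sqnorm big1// => i _; rewrite mxE expr0n.
have d2 : 0 <= (2^-1 : R) <= 2^-1 by apply/andP; split; lra.
exists [set w | bad_sample k1 sigma0 theta tau 2^-1 M0 (Z1 w)]; split.
- exact: (measurable_event1 split (@measurable_bad_sample R n1 p k1 sigma0 theta tau 2^-1 M0)).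
- rewrite mulr1 -noiseE.
  exact: (prob_bad_sample s0 Th lm split tau0 s2 d2 M0_gt0 k0 p1 n21 c_gt0 kn cr).
move=> w gB; have [sp _ _] := Th.
have d0 : 0 <= (2^-1 : R) by rewrite invr_ge0.
have d1 : (2^-1 : R) < 1 by lra.
apply: (good_rate n1_gt0 p1 s0 A0 (b_lasso (Z1 w) beta) tau0 tauA _ d0 d1
  k0 sp _ _ kappa0 kappaE (M := (M0 * k1)%N)).
- by move=> g; apply: gB; left.
- by move=> g; apply: gB; right; left.
- by move=> g; apply: gB; right; right.
by rewrite natrM mulrA ler_wpM2r.
Qed.

Lemma expected_length_bound :
  (\int[P]_w lebesgue_measure [set` CI2 sigma0 alpha q k2 (Z2 w) (b (Z1 w))] <=
   (16 / c0 * (1 + r) *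
     ((8 * expR 4^-1 + K0 + 2 + 12 / h ^+ 2) + (64 * A) ^+ 2 * (1 + 8 * expR 4^-1)) *
    (k2%:R `^ (2 / q - 1) *
     (k1%:R * (ln p%:R / (n1 + n2)%:R) + (Num.sqrt (n1 + n2)%:R)^-1) *
     sigma0 ^+ 2))%:E)%E.
Proof.
have [Bad [mB PB gB]] := rate_event.
have n1R : 0 < n1%:R :> R by rewrite ltr0n.
have n2R : 0 < n2%:R :> R by rewrite ltr0n.
have nR : 0 < (n1 + n2)%:R :> R by rewrite ltr0n addn_gt0 n1_gt0.
have n_gt0 : (0 < n1 + n2)%N by rewrite addn_gt0 n1_gt0.
have l0 : 0 <= ln (p%:R : R) := ln_nat_ge0 p.
have r1 : 0 <= r by exact: ltW.
have le1 : (n1 + n2)%:R <= (1 + r) * n1%:R :> R by rewrite natrD mulrDl mul1r lerD2l.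
have le2 : (n1 + n2)%:R <= (1 + r) * n2%:R :> R.
  by rewrite natrD mulrDl mul1r addrC lerD2l.
pose v := (64 * A) ^+ 2 * (k1%:R * (ln p%:R / n1%:R)).
have v0 : 0 <= v.
  by rewrite /v mulr_ge0 ?sqr_ge0// mulr_ge0// divr_ge0.
apply: (le_trans (expected_length_le k2 s0 Th lm split n2_gt0 q c0_gt0 K00 v0
  qb_ge qb_dev mB PB gB)).
rewrite lee_fin.
have C00 : 0 <= 8 * expR 4^-1 :> R by rewrite mulr_ge0// expR_ge0.
set C0 := 8 * expR 4^-1 in C00 *.
set e := 2 / q - 1.
have e01 : 0 <= e <= 1.
  have [q1 q2] := andP q12; have q0 : 0 < q by lra.
  rewrite /e subr_ge0 lerBlDr ler_pdivlMr// ler_pdivrMr//; apply/andP; split; lra.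
set rn := (Num.sqrt (n1 + n2)%:R)^-1.
have rn0 : 0 <= rn by rewrite invr_ge0 sqrtr_ge0.
have rn1 : (Num.sqrt n1%:R)^-1 <= (1 + r) * rn by exact: invr_sqrt_le.
have rn2 : (Num.sqrt n2%:R)^-1 <= (1 + r) * rn by exact: invr_sqrt_le.
pose x := k1%:R * (ln p%:R / (n1 + n2)%:R) : R.
have x0 : 0 <= x by rewrite mulr_ge0// divr_ge0// ltW.
have vx : v <= (64 * A) ^+ 2 * ((1 + r) * x).
  rewrite /v ler_wpM2l ?sqr_ge0// /x [leRHS]mulrCA ler_wpM2l// [leRHS]mulrCA ler_wpM2l//.
  by rewrite ler_pdivlMr// mulrC ler_pdivrMr.
(* The truncation level times the bad probability: p^-2 absorbs ln p in the first term, and for k1 >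
   0 the bound ln p <= n1 lets exp (- h n1) absorb it in the second. *)
have tail : ln p%:R * (2 * expR (- (2 * ln p%:R)) +
    3 * expR (- (h * n1%:R)) * (0 < k1)%N%:R) <= (2 + 12 / h ^+ 2) * ((1 + r) * rn).
  rewrite mulrDr [leRHS]mulrDl; apply: lerD.
    apply: (le_trans (ln_le_sqrt_tail n_gt0 np)); rewrite ler_pM2l//.
    by rewrite ler_peMl// lerDl.
  have [k0|k0] := posnP k1.
    rewrite !mulr0; apply: mulr_ge0; first by rewrite divr_ge0// sqr_ge0.
    by rewrite mulr_ge0// addr_ge0.
  have M0R : 1 <= M0%:R :> R by rewrite ler1n.
  have c1 : c * (1 + r) <= 1.
    apply: (le_trans cr); rewrite ler_pdivrMr ?mul1r; last by lra.
    by rewrite expr2; lra.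
  have lpn : ln p%:R <= n1%:R :> R.
    apply: (@le_trans _ _ (k1%:R * ln p%:R)); first by rewrite ler_peMl// ler1n.
    apply: (le_trans kn); apply: (@le_trans _ _ (c * ((1 + r) * n1%:R))).
      by rewrite ler_pM2l.
    by rewrite mulrA ler_piMl.
  rewrite mulr1 mulrCA; have -> : 12 / h ^+ 2 = 3 * (4 / h ^+ 2) by ring.
  rewrite -mulrA ler_pM2l//; apply: (@le_trans _ _ (n1%:R * expR (- (h * n1%:R)))).
    by rewrite ler_wpM2r// expR_ge0.
  apply: (le_trans (mul_expRN_le h0 n1_gt0)).
  by rewrite ler_wpM2l// divr_ge0// sqr_ge0.
have s0' : 0 <= sigma0 ^+ 2 by exact: sqr_ge0.
apply: (@le_trans _ _ (16 * k2%:R `^ e * (sigma0 ^+ 2 / c0 *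
  ((C0 + K0) * ((1 + r) * rn) + (64 * A) ^+ 2 * ((1 + r) * x) * (1 + C0) +
   (2 + 12 / h ^+ 2) * ((1 + r) * rn))))).
  apply: ler_pM; first exact: powR_ge0.
  - apply: mulr_ge0; first by rewrite divr_ge0// ltW.
    apply: addr_ge0; [apply: addr_ge0|]; apply: mulr_ge0 => //.
    + exact: addr_ge0.
    + exact: addr_ge0.
  - exact: powRM16_le.
  rewrite ler_wpM2l ?divr_ge0 ?(ltW c0_gt0)//; apply: lerD => //.
  by apply: lerD; [rewrite ler_wpM2l// addr_ge0 | rewrite ler_wpM2r// addr_ge0].
have -> : 16 * k2%:R `^ e * (sigma0 ^+ 2 / c0 *
  ((C0 + K0) * ((1 + r) * rn) + (64 * A) ^+ 2 * ((1 + r) * x) * (1 + C0) +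
   (2 + 12 / h ^+ 2) * ((1 + r) * rn))) =
  16 / c0 * (1 + r) * (k2%:R `^ e * sigma0 ^+ 2) *
  ((C0 + K0 + 2 + 12 / h ^+ 2) * rn + (64 * A) ^+ 2 * (1 + C0) * x) by ring.
rewrite -/x; set D := _ + 12 / _; set D' := _ * (1 + C0).
have -> : 16 / c0 * (1 + r) * (D + D') * (k2%:R `^ e * (x + rn) * sigma0 ^+ 2) =
  16 / c0 * (1 + r) * (k2%:R `^ e * sigma0 ^+ 2) * ((D + D') * (x + rn)) by ring.
have D0 : 0 <= D by rewrite !addr_ge0// divr_ge0// sqr_ge0.
have D'0 : 0 <= D' by rewrite mulr_ge0 ?sqr_ge0// addr_ge0.
rewrite ler_wpM2l//.
  apply: mulr_ge0; last by rewrite mulr_ge0// powR_ge0.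
  by rewrite mulr_ge0 ?addr_ge0// divr_ge0// ltW.
have := mulr_ge0 D0 x0; have := mulr_ge0 D'0 rn0; lra.
Qed.

End length_bound.

(** * Constants and limits *)

Section constants.
Context {R : realType}.
Variables (A : R) (A_gt : 4 * Num.sqrt 2 < A).

Let A0 : 0 < A.
Proof. by apply: le_lt_trans A_gt; rewrite mulr_ge0// sqrtr_ge0. Qed.

(* [sqrt 2 < tau] beats the union bound over the [p] columns; [tau < A / 4] leaves
   room for a cone constant 3, that is [|v|_1^2 <= 16 k |v|_2^2]. *)
Lemma coverage_constants : exists tau s delta : R,
  [/\ 0 <= tau, 0 <= s < 2^-1, 0 < delta <= 2^-1, 2 * tau < A &
   [/\ (1 + 2 * tau / A) * (1 + delta) <= 3 * ((1 - 2 * tau / A) * (1 - delta)) &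
       1 < s * tau ^+ 2]].
Proof.
(* Midpoint of the interval from sqrt 2 to A / 4, nonempty because A > 4 sqrt 2. *)
pose tau := (A / 4 + Num.sqrt 2) / 2.
have r2 : 0 < Num.sqrt 2 :> R by rewrite sqrtr_gt0.
have tau_gt : Num.sqrt 2 < tau by rewrite /tau; move: A_gt; lra.
have tau_lt : 4 * tau < A by rewrite /tau; move: A_gt; lra.
have tau0 : 0 < tau by exact: lt_trans tau_gt.
have tau2 : 2 < tau ^+ 2.
  by have := ltr_pM (ltW r2) (ltW r2) tau_gt tau_gt; rewrite -!expr2 sqr_sqrtr.
pose rho := 2 * tau / A.
have rho0 : 0 <= rho by apply: divr_ge0; [apply: mulr_ge0 => //|]; exact: ltW.
have rho2 : rho < 2^-1 by rewrite /rho ltr_pdivrMr//; move: tau_lt; lra.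
(* Midpoint between 1 / tau^2 and 1/2: above the first, s tau^2 > 1; below the second, the
   generating function is finite. *)
pose s := ((tau ^+ 2)^-1 + 2^-1) / 2.
have t0 : 0 < tau ^+ 2 by rewrite exprn_gt0.
have i0 : 0 < (tau ^+ 2)^-1 by rewrite invr_gt0.
have i2 : (tau ^+ 2)^-1 < 2^-1 by rewrite ltf_pV2 ?posrE.
have sE : s * tau ^+ 2 = (1 + tau ^+ 2 / 2) / 2.
  by rewrite /s; field; rewrite gt_eqF.
(* Positive since rho < 1/2, this delta leaves the slack rho (1 - 2 rho) in the cone condition. *)
exists tau, s, ((1 - 2 * rho) / 2); split.
- exact: ltW.
- by rewrite /s; apply/andP; split; lra.
- by apply/andP; split; lra.
- by lra.
split; last by rewrite sE; lra.
rewrite -/rho -subr_ge0; set E := (X in 0 <= X).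
have -> : E = rho * (1 - 2 * rho) by rewrite /E; field.
by rewrite mulr_ge0// subr_ge0; lra.
Qed.

(** Here rho is only known to be below 1, so the cone constant may be large; it influences [M0] and
    through it the admissible [c], but not the interval. *)
Lemma length_constants : exists (kappa : R) (M0 : nat),
  [/\ 0 <= kappa,
   (1 + 2 * (2 * Num.sqrt 2) / A) * (1 + 2^-1) <=
     kappa * ((1 - 2 * (2 * Num.sqrt 2) / A) * (1 - 2^-1)),
   (0 < M0)%N & 60 * (1 + kappa) ^+ 2 <= M0%:R].
Proof.
pose rho := 2 * (2 * Num.sqrt 2) / A.
have r2 : 0 <= Num.sqrt 2 :> R by exact: sqrtr_ge0.
have rho0 : 0 <= rho by rewrite /rho divr_ge0 ?mulr_ge0// ltW.
have rho1 : rho < 1 by rewrite /rho ltr_pdivrMr//; move: A_gt; lra.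
(* The 3 is (1 + 1/2) / (1 - 1/2), for delta = 1/2. *)
pose kappa := 3 * (1 + rho) / (1 - rho).
have k0 : 0 <= kappa by rewrite /kappa divr_ge0 ?mulr_ge0//; lra.
have h0 : 0 <= 60 * (1 + kappa) ^+ 2 by rewrite mulr_ge0// sqr_ge0.
exists kappa, (Num.bound (60 * (1 + kappa) ^+ 2)); split => //.
- rewrite -/rho le_eqVlt; apply/orP; left; apply/eqP.
  by rewrite /kappa; field; rewrite gt_eqF// subr_gt0.
- exact/ltW/archi_boundP.
Qed.

End constants.

(** * Lower limits and divergence to infinity *)

Section limits.
Context {R : realType}.

Lemma limn_einf_ge (u : (\bar R)^nat) (a : \bar R) :
  (\forall t \near \oo, (a <= u t)%E) -> (a <= limn_einf u)%E.
Proof.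
move=> [N _ h]; rewrite limn_einf_lim (cvg_lim _ (@cvg_einfs_sup R u))//.
apply: (@le_trans _ _ (einfs u N)); last by apply: ereal_sup_ubound; exists N.
by apply: le_ereal_inf_tmp => _ [t /= Nt <-]; exact: h.
Qed.

Lemma cvgny_real (u : nat -> nat) (M : R) : u @ \oo --> \oo ->
  \forall t \near \oo, M <= (u t)%:R.
Proof.
move=> /cvgnyPge /(_ (Num.bound `|M|)) h; near=> t.
apply: (le_trans (ler_norm M)); apply: (le_trans (ltW (archi_boundP (normr_ge0 M)))).
by rewrite ler_nat; near: t.
Unshelve. all: by end_near. Qed.

Lemma cvgny_ln (u : nat -> nat) (M : R) : u @ \oo --> \oo ->
  \forall t \near \oo, M <= ln (u t)%:R.
Proof.
move=> /(cvgny_real (expR M)) h; near=> t.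
by rewrite -ler_expR lnK ?posrE; [near: t|apply: lt_le_trans (expR_gt0 M) _; near: t].
Unshelve. all: by end_near. Qed.

Lemma expRN_le_invr (h M x : R) : 0 < h -> 0 < M -> M <= x ->
  expR (- (h * x)) <= (h * M)^-1.
Proof.
move=> h0 M0 Mx; have x0 : 0 < h * x by rewrite mulr_gt0// (lt_le_trans M0).
rewrite expRN lef_pV2 ?posrE ?expR_gt0 ?mulr_gt0//.
apply: (@le_trans _ _ (h * x)); first by rewrite ler_pM2l.
by apply: le_trans (expR_ge1Dx _); rewrite lerDr.
Qed.

End limits.

(** Both constants can precede the sequences and the noise level because the finite-sample bounds
    apply at each t separately; divergence of n and p only makes the error terms of coverage
    small. *)
Theorem proposition4 (R : realType) (alpha q A r : R)
    (alpha01 : 0 < alpha < 1) (q12 : 1 <= q < 2)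
    (A_gt : 4 * Num.sqrt 2 < A) (r_gt0 : 0 < r) :
  exists c C : R, 0 < c /\ 0 < C /\
  forall (sigma0 : R) (n1 n2 p k1 k2 : nat -> nat)
    (d : nat -> measure_display) (Omega : forall t, measurableType (d t))
    (P : forall t, param R (p t) -> probability (Omega t) R)
    (X : forall t, {mfun Omega t >-> 'M[R]_(n1 t + n2 t, p t)})
    (y : forall t, {mfun Omega t >-> 'cV[R]_(n1 t + n2 t)})
    (pi : forall t, Omega t -> 'S_(n1 t + n2 t))
    (lasso : forall t,
      {mfun ('M[R]_(n1 t, p t) * 'cV[R]_(n1 t))%type >-> 'cV[R]_(p t)}),
  let n t := (n1 t + n2 t)%N in
  let Theta0_ t k := @Theta0 R (p t) sigma0 k in
  let betaL t w := lasso t (subsample1 (pi t w) (X t w) (y t w)) in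
  let CI t w := CI2 sigma0 alpha q (k2 t)
                  (subsample2 (pi t w) (X t w) (y t w)) (betaL t w) in
  let coverage t := ereal_inf
    [set P t theta [set w | lqnorm q (betaL t w - coef theta) ^+ 2 \in CI t w]
      | theta in Theta0_ t (k2 t)] in
  let expected_length t := ereal_sup
    [set (\int[P t theta]_w lebesgue_measure [set` CI t w])%E
      | theta in Theta0_ t (k1 t)] in
  0 < sigma0 ->
  (forall t, (0 < n1 t)%N /\ (0 < n2 t)%N) ->
  (forall t, (n1 t)%:R <= r * (n2 t)%:R /\ (n2 t)%:R <= r * (n1 t)%:R) ->
  n @ \oo --> \oo -> p @ \oo --> \oo ->
  (forall t, (n t <= p t)%N) ->
  (forall t, (k1 t <= k2 t)%N) ->
  (forall t, (k2 t)%:R <= c * ((n t)%:R / ln (p t)%:R)) ->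
  (forall t theta, Theta0_ t (k2 t) theta ->
    linear_model (P t theta) theta (X t) (y t) /\
    random_split (P t theta) (X t) (y t) (pi t)) ->
  (forall t, is_lasso sigma0 A (lasso t)) ->
  ((1 - alpha)%:E <= limn_einf coverage)%E /\
  (forall t,
    (expected_length t <=
       (C * ((k2 t)%:R `^ (2 / q - 1) *
             ((k1 t)%:R * (ln (p t)%:R / (n t)%:R) + (Num.sqrt (n t)%:R)^-1) *
             sigma0 ^+ 2))%:E)%E).
Proof.
have r2 : 0 <= Num.sqrt 2 :> R by exact: sqrtr_ge0.
have A0 : 0 < A by apply: le_lt_trans A_gt; rewrite mulr_ge0.
have [tau [s [delta [tau0 s2 /andP[delta0 delta2] tauA [cone3 stau]]]]] :=
  coverage_constants A_gt.
have [kappa [M0 [kappa0 kappaE M0_gt0 M_large]]] := length_constants A_gt.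
have a2 : 0 < alpha / 2 < 1 by have /andP[? ?] := alpha01; apply/andP; split; lra.
have [K0 K0_gt0 qb_dev] := chi2_quantile_dev a2.
have [c0 c0_gt0 qb_ge] := chi2_quantile_ge a2.
have r1 : 0 < 1 + r by rewrite addr_gt0.
pose M1 := (60 * 16)%N.
have M0R : 0 < M0%:R :> R by rewrite ltr0n.
have M1R : 0 < M1%:R :> R by rewrite ltr0n.
pose b1 := delta ^+ 2 / (64 * M1%:R); pose b2 := 2^-1 ^+ 2 / (64 * M0%:R) : R.
have b10 : 0 < b1 by rewrite divr_gt0 ?exprn_gt0 ?mulr_gt0.
have b20 : 0 < b2 by rewrite divr_gt0 ?exprn_gt0 ?mulr_gt0 ?invr_gt0.
(* [c] serves two exceptional events at once, that of coverage with [delta] and [M1] and that of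
   length with 1/2 and [M0]; the factor 1 + r compares n with n1. *)
pose c := Num.min b1 b2 / (1 + r).
have c_gt0 : 0 < c by rewrite divr_gt0// lt_min b10.
have crE : c * (1 + r) = Num.min b1 b2 by rewrite /c divfK// gt_eqF.
have cr1 : c * (1 + r) <= b1 by rewrite crE ge_min lexx.
have cr2 : c * (1 + r) <= b2 by rewrite crE ge_min lexx orbT.
clearbody c; clear crE.
pose h := (2^-1 : R) ^+ 2 / 32.
have h0 : 0 < h by rewrite divr_gt0// exprn_gt0// invr_gt0.
have e0 : 0 < expR (4^-1 : R) by exact: expR_gt0.
exists c, (16 / c0 * (1 + r) *
  ((8 * expR 4^-1 + K0 + 2 + 12 / h ^+ 2) + (64 * A) ^+ 2 * (1 + 8 * expR 4^-1))).
split => //; split.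
  apply: mulr_gt0; first by rewrite mulr_gt0// divr_gt0.
  apply: addr_gt0; last by rewrite mulr_gt0 ?exprn_gt0 ?mulr_gt0// addr_gt0// mulr_gt0.
  by rewrite !addr_gt0 ?mulr_gt0 ?invr_gt0 ?exprn_gt0.
move=> sigma0 n1 n2 p k1 k2 d Omega P X y pi lasso n Theta0_ betaL CI coverage
  expected_length s0 n_gt0 ratio n_oo p_oo np k12 k2n model b_lasso.
have p1 t : (1 < p t)%N.
  apply: leq_trans (np t); have [? ?] := n_gt0 t.
  by rewrite /n -[2%N]/(1 + 1)%N leq_add.
have k2n' t : (k2 t)%:R * ln (p t)%:R <= c * (n1 t + n2 t)%:R.
  have lp : 0 < ln (p t)%:R :> R by rewrite ln_gt0// ltr1n.
  by have := k2n t; rewrite mulrA ler_pdivlMr.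
split; last first.
  move=> t; apply: ge_ereal_sup => _ [theta Th <-].
  have [ng1 ng2] := n_gt0 t; have [n12 n21] := ratio t.
  have Th2 : Theta0_ t (k2 t) theta.
    by case: Th => sp S1 S2; split => //; exact: leq_trans (k12 t).
  have [lm split] := model t theta Th2.
  have k1n : (k1 t)%:R * ln (p t)%:R <= c * (n1 t + n2 t)%:R.
    by apply: le_trans (k2n' t); rewrite ler_wpM2r ?ln_nat_ge0// ler_nat.
  exact: (expected_length_bound (k2 t) s0 Th lm split ng1 ng2 (np t) q12 A_gt
    (b_lasso t) r_gt0 n12 n21 c_gt0 k1n M0_gt0 cr2 kappa0 kappaE M_large
    c0_gt0 (ltW K0_gt0) (qb_ge _ ng2) (qb_dev _ ng2)).
pose a := s * tau ^+ 2 - 1; have a0 : 0 < a by rewrite /a subr_gt0.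
pose g := delta ^+ 2 / 32; have g0 : 0 < g by rewrite /g divr_gt0// exprn_gt0.
pose cs := (Num.sqrt (1 - s *+ 2))^-1; have cs0 : 0 <= cs by rewrite invr_ge0 sqrtr_ge0.
pose covered t theta := [set w | lqnorm q (betaL t w - coef theta) ^+ 2 \in CI t w].
have cov t theta : Theta0_ t (k2 t) theta ->
    2 * (1 + (64 * A) ^+ 2) <= ln (p t)%:R ->
    ((1 - (alpha + (cs * expR (- (a * ln (p t)%:R)) + 3 * expR (- (g * (n1 t)%:R)) +
       expR (- ((n2 t)%:R / 16)))))%:E <=
     P t theta (covered t theta))%E.
  move=> Th lp; have [ng1 ng2] := n_gt0 t; have [n12 n21] := ratio t.
  have [lm split] := model t theta Th.
  have [k0|k0] := posnP (k2 t); last first.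
    have d2 : 0 <= delta <= 2^-1 by rewrite ltW.
    exact: (coverage_pos s0 Th lm split ng1 ng2 (p1 t) alpha01 q12 A0 (b_lasso t)
      tau0 s2 d2 (leqnn M1) k0 n21 c_gt0 (k2n' t) cr1 tauA cone3 lp).
  apply: le_trans (coverage_null s0 Th lm split ng1 ng2 (p1 t) alpha01 q12 A0
    (b_lasso t) tau0 s2 k0 tauA).
  rewrite lee_fin lerD2l lerN2 lerD2l -addrA lerDl.
  by rewrite addr_ge0 ?mulr_ge0 ?expR_ge0.
apply/lee_subgt0Pr => e e_gt0; apply: limn_einf_ge.
(* S collects the coefficients of 1 / M in the three tail bounds, so that with M = S / e they add up
   to exactly e. *)
pose S := cs / a + 3 / g + 16.
have S0 : 0 < S.
  by rewrite ltr_wpDl//; apply: addr_ge0; apply: divr_ge0 => //; exact: ltW.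
pose M := S / e; have M_gt0 : 0 < M by exact: divr_gt0.
have lp1 := cvgny_ln (2 * (1 + (64 * A) ^+ 2)) p_oo.
have lp2 := cvgny_ln M p_oo.
have nM := cvgny_real ((1 + r) * M) n_oo.
near=> t; apply: le_ereal_inf_tmp => _ [theta Th <-].
have l1 : 2 * (1 + (64 * A) ^+ 2) <= ln (p t)%:R by near: t.
have l2 : M <= ln (p t)%:R by near: t.
have l3 : (1 + r) * M <= (n t)%:R by near: t.
apply: le_trans (cov t theta Th l1).
have [n12 n21] := ratio t.
have M1' : M <= (n1 t)%:R.
  rewrite -(ler_pM2l r1); apply: (le_trans l3).
  by rewrite /n natrD mulrDl mul1r lerD2l.
have M2' : M <= (n2 t)%:R.
  rewrite -(ler_pM2l r1); apply: (le_trans l3).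
  by rewrite /n natrD mulrDl mul1r addrC lerD2l.
rewrite -EFinB lee_fin opprD addrA lerD2l lerN2.
have E1 := ler_wpM2l cs0 (expRN_le_invr a0 M_gt0 l2).
have E2 := expRN_le_invr g0 M_gt0 M1'.
have h16 : 0 < (16^-1 : R) by rewrite invr_gt0.
have E3 := expRN_le_invr h16 M_gt0 M2'; rewrite mulrC in E3.
have -> : e = cs * (a * M)^-1 + 3 * (g * M)^-1 + (16^-1 * M)^-1.
  have SE : e = S / M by rewrite /M invf_div mulrCA mulfV ?mulr1// gt_eqF.
  rewrite [LHS]SE /S; field; rewrite !gt_eqF//.
by rewrite lerD// lerD// ler_pM2l.
Unshelve. all: by end_near. Qed.
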